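(* Let $\lambda,\mu>0$, let $k\ge 1$ be an integer, let $\nu\in(0,1)$, and let $Q^\nu$ be the state-phase process of the $\nu$-fractional Erlang queue $M/E_k/1$, with state probabilities $p_0^\nu(t)$ and $p_{n,s}^\nu(t)$, $n\ge1$, $1\le s\le k$. Then these state probabilities are a solution of the fractional difference-differential Cauchy problem $$\begin{cases} D_t^\nu p_0^\nu=-\lambda p_0^\nu(t)+k\mu\, p_{1,1}^\nu(t) \\ D_t^\nu p_{1,s}^\nu=-(\lambda+k\mu)p_{1,s}^\nu(t)+k\mu\, p_{1,s+1}^\nu(t) & 1 \le s \le k-1 \\ D_t^\nu p_{1,k}^\nu=-(\lambda+k\mu)p_{1,k}^\nu(t)+k\mu\, p_{2,1}^\nu(t)+\lambda p_0^\nu(t) \\ D_t^\nu p_{n,s}^\nu=-(\lambda+k\mu)p_{n,s}^\nu(t)+k\mu\, p_{n,s+1}^\nu(t)+\lambda p_{n-1,s}^\nu(t) & n \ge 2,\ 1 \le s \le k-1 \\ D_t^\nu p_{n,k}^\nu=-(\lambda+k\mu)p_{n,k}^\nu(t)+k\mu\, p_{n+1,1}^\nu(t)+\lambda p_{n-1,k}^\nu(t) & n \ge 2 \\ p_0^\nu(0)=1 \\ p_{n,s}^\nu(0)=0 & n \ge 1,\ 1 \le s \le k, \end{cases}$$ where $D_t^\nu$ is the Caputo fractional derivative of order $\nu$.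
   Context: Classical queue: let $\mathcal{S}^*=\{(n,s): n\ge 1,\ 1\le s\le k\}$ ($n,s$ integers) and $\mathcal{S}=\mathcal{S}^*\cup\{(0,0)\}$. The state-phase process $Q(t)=(N(t),S(t))$ of the classical $M/E_k/1$ queue ($N$ = number of customers in the system, $S$ = phase of the customer currently being served, $S=0$ if $N=0$; arrivals Poisson of rate $\lambda$, service consisting of $k$ exponential phases of rate $k\mu$ each) is the continuous-time Markov chain on $\mathcal{S}$ with transition rates: $(0,0)\to(1,k)$ at rate $\lambda$; $(n,s)\to(n+1,s)$ at rate $\lambda$ for $(n,s)\in\mathcal{S}^*$; $(n,s)\to(n,s-1)$ at rate $k\mu$ for $s\ge2$; $(n,1)\to(n-1,k)$ at rate $k\mu$ for $n\ge2$; $(1,1)\to(0,0)$ at rate $k\mu$. Fractional queue: let $\{\sigma_\nu(t)\}_{t\ge0}$ be a $\nu$-stable subordinator independent of $Q$, with $\mathbb{E}[e^{-v\sigma_\nu(t)}]=e^{-tv^\nu}$ for $v>0$, and let $L_\nu(t)=\inf\{s\ge0:\sigma_\nu(s)>t\}$ be its inverse. The state-phase process of the $\nu$-fractional $M/E_k/1$ queue is $Q^\nu(t)=(N^\nu(t),S^\nu(t)):=Q(L_\nu(t))$. State probabilities: $p_{n,s}^\nu(t)=\mathbb{P}(Q^\nu(t)=(n,s)\mid Q^\nu(0)=(0,0))$ for $(n,s)\in\mathcal{S}^*$, and $p_0^\nu(t)=\mathbb{P}(Q^\nu(t)=(0,0)\mid Q^\nu(0)=(0,0))$. Caputo derivative: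 $D_t^\nu x=\frac{1}{\Gamma(1-\nu)}\int_0^t \frac{x'(\tau)}{(t-\tau)^\nu}\,d\tau$. *)

(* Defs.v *)
From HB Require Import structures.
From mathcomp Require Import all_boot all_order all_algebra.
From mathcomp Require Import all_classical all_reals all_analysis.
Import Order.TTheory GRing.Theory Num.Theory.
Import numFieldNormedType.Exports.

Set Implicit Arguments.
Unset Strict Implicit.
Unset Printing Implicit Defensive.

Local Open Scope classical_set_scope.
Local Open Scope ring_scope.

(* Time is the half-line [0, +oo[ of R: processes are
   indexed by R, and nothing is assumed about negative indices. *)

Section caputo_derivative.
Context {R : realType}.
Implicit Types (a nu t l : R) (x : R -> R).

Definition Gamma a : R :=
  \int[lebesgue_measure]_(u in `]0, +oo[) (u `^ (a - 1) * expR (- u)).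

Definition caputo nu x t : R :=
  (Gamma (1 - nu))^-1 *
  \int[lebesgue_measure]_(tau in `]0, t[) (derive1 x tau / (t - tau) `^ nu).

(* Derivatives and integrals are total functions in the library, hence the
   explicit conditions that make the integral meaningful.  Continuity up to 0
   is what ties the equation to the initial value x 0. *)
Definition caputo_derivable nu x t : Prop :=
  [/\ {within `[0, t], continuous x},
      {in `]0, t[, forall tau : R, derivable x tau 1} &
      lebesgue_measure.-integrable `]0, t[
        (fun tau : R => (derive1 x tau / (t - tau) `^ nu)%:E)].

Definition is_caputo nu x t l : Prop :=
  caputo_derivable nu x t /\ caputo nu x t = l.

End caputo_derivative.

Section markov_chain.
Context {R : realType} {S : countType}.
Implicit Types (p : R -> S -> S -> R) (q : S -> S -> R).

Record transition_function p : Prop := TransitionFunction {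
  transition0 : forall x y, p 0 x y = (x == y)%:R ;
  transition_ge0 : forall t x y, 0 <= t -> 0 <= p t x y ;
  transition_sum1 : forall t x, 0 <= t ->
    \esum_(y in [set: S]) (p t x y)%:E = 1%:E ;
  transitionD : forall s t x y, 0 <= s -> 0 <= t ->
    (p (s + t) x y)%:E = \esum_(z in [set: S]) (p s x z * p t z y)%:E }.

(* Only the off-diagonal values of q are used. *)
Definition generator q (x y : S) : R :=
  if x == y then - fine (\esum_(z in [set z | z != x]) (q x z)%:E) else q x y.

Definition has_rates p q : Prop :=
  forall x y, (p h x y - p 0 x y) / h @[h --> 0^'+] --> generator q x y.

(* The last clause is the Markov property with stationary transition
   probabilities, in product form to avoid conditioning on null events. *)
Definition markov_chain d (T : measurableType d) (P : probability T R)
    q (X : R -> T -> S) : Prop :=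
  [/\ forall t x, 0 <= t -> measurable (X t @^-1` [set x]),
      forall w t, 0 <= t -> \forall u \near t^'+, X u w = X t w &
      exists p, [/\ transition_function p, has_rates p q &
        forall n (t : nat -> R) (x : nat -> S),
          0 <= t 0%N -> (forall i, t i < t i.+1) ->
          P (\bigcap_(i in `I_n.+2) (X (t i) @^-1` [set x i])) =
          (P (\bigcap_(i in `I_n.+1) (X (t i) @^-1` [set x i])) *
             (p (t n.+1 - t n) (x n) (x n.+1))%:E)%E]].

End markov_chain.

Section subordinators.
Context {R : realType} d (T : measurableType d) (P : probability T R).
Implicit Type sigma : R -> T -> R.

Definition increment sigma s t : T -> R := fun w => sigma t w - sigma s w.

Definition independent_increments sigma : Prop :=
  forall n (t : nat -> R) (B : nat -> set R),
    0 <= t 0%N -> (forall i, t i <= t i.+1) -> (forall i, measurable (B i)) ->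
    P (\bigcap_(i in `I_n) (increment sigma (t i) (t i.+1) @^-1` B i)) =
    (\prod_(i < n) P (increment sigma (t i) (t i.+1) @^-1` B i))%E.

Definition stationary_increments sigma : Prop :=
  forall s t (B : set R), 0 <= s -> 0 <= t -> measurable B ->
    P (increment sigma s (s + t) @^-1` B) = P (increment sigma 0 t @^-1` B).

(* Left limits exist automatically, by monotonicity.  Path properties are
   required for every w rather than almost surely: P need not be complete, and
   the inverse process and the time change must stay measurable. *)
Record subordinator sigma : Prop := Subordinator {
  subordinator_measurable : forall t, 0 <= t -> measurable_fun setT (sigma t) ;
  subordinator0 : forall w, sigma 0 w = 0 ;
  subordinator_nondecreasing : forall w s t,
    0 <= s -> s <= t -> sigma s w <= sigma t w ;
  subordinator_right_continuous : forall w t, 0 <= t ->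
    sigma u w @[u --> t^'+] --> sigma t w ;
  subordinator_independent : independent_increments sigma ;
  subordinator_stationary : stationary_increments sigma }.

Definition stable_subordinator (nu : R) sigma : Prop :=
  subordinator sigma /\
  forall t v, 0 <= t -> 0 < v ->
    ('E_P[fun w => expR (- v * sigma t w)] = (expR (- t * v `^ nu))%:E)%E.

End subordinators.

Section processes.
Context {R : realType} d (T : measurableType d) (P : probability T R).

(* When the path is bounded by t (a null event for a stable subordinator) the
   set is empty and inf takes its default value 0. *)
Definition inverse_process (sigma : R -> T -> R) (t : R) (w : T) : R :=
  inf [set s | 0 <= s /\ t < sigma s w].

Definition time_change {S : Type} (X : R -> T -> S) (L : R -> T -> R)
  (t : R) (w : T) : S := X (L t w) w.

(* sigma-algebra generated by X, where G is a sigma-algebra on the value space *)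
Definition process_sigma_algebra {S : Type} (G : set (set S))
    (X : R -> T -> S) : set (set T) :=
  <<s [set A | exists t B, [/\ 0 <= t, G B & A = X t @^-1` B]] >>.

(* X is real-valued (Borel sigma-algebra), Y takes values in a countable space
   (all subsets). *)
Definition independent_processes {S : countType}
    (X : R -> T -> R) (Y : R -> T -> S) : Prop :=
  forall A B, process_sigma_algebra measurable X A ->
    process_sigma_algebra [set: set S] Y B ->
    P (A `&` B) = (P A * P B)%E.

(* Meaningful only when P B != 0. *)
Definition cond_prob (A B : set T) : R := fine (P (A `&` B)) / fine (P B).

End processes.

Section erlang_queue.
Context {R : realType}.
Local Open Scope nat_scope.

Definition erlang_state (k : nat) : countType :=
  {x : nat * nat | (x == (0, 0)) || ((1 <= x.1) && (1 <= x.2 <= k))}.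

Definition erlang_rate (k : nat) (lambda mu : R) (x y : erlang_state k) : R :=
  let: (n, s) := val x in
  if ((n, s) == (0, 0)) && (val y == (1, k)) then lambda
  else if (1 <= n) && (val y == (n.+1, s)) then lambda
  else if (2 <= s) && (val y == (n, s.-1)) then (k%:R * mu)%R
  else if [&& 2 <= n, s == 1 & val y == (n.-1, k)] then (k%:R * mu)%R
  else if ((n, s) == (1, 1)) && (val y == (0, 0)) then (k%:R * mu)%R
  else 0%R.

Definition in_state (k : nat) (T : Type) (X : R -> T -> erlang_state k)
    (n s : nat) (t : R) : set T :=
  [set w | val (X t w) = (n, s)].

Definition erlang_prob (k : nat) d (T : measurableType d)
    (P : probability T R) (X : R -> T -> erlang_state k) (n s : nat) (t : R) : R :=
  cond_prob P (in_state X n s t) (in_state X 0 0 0%R).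

End erlang_queue.

(* Main.v *)
(** Conditioning on the inverse subordinator gives p_x(t) = E[phi_x(L(t))], where
    phi_x(s) is the transition probability of the classical queue from the empty
    state to x.  Self-similarity of sigma and the inversion
    {L(t) >= s} = {sigma(s) <= t} show that L(t) is distributed as t^nu Y^(-nu)
    with Y = sigma(1), so p_x(t) = E[phi_x(t^nu Y^(-nu))].  The rates are bounded
    and every state has finitely many predecessors, so phi_x is Lipschitz and
    solves the forward equation phi_x' = r_x on ]0, +oo[, where r_x is a finite
    combination of the phi_z.  Differentiating under the expectation, the Caputo
    integrand is an average of
      nu tau^(nu-1) (t - tau)^(-nu) Y^(-nu) r_x((Y / tau)^(-nu)),
    and everything reduces to the identity
      int_0^t nu tau^(nu-1) (t - tau)^(-nu) E[Y^(-nu) g(Y / tau)] dtau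
        = Gamma(1 - nu) E[g(Y / t)].
    For g(y) = e^(-vy) it follows from the Laplace transform of Y and Tonelli; the
    general case holds because a measure on [0, +oo[ is determined by the values
    of its Laplace transform at the positive integers. *)
Require Import Defs.
From HB Require Import structures.
From mathcomp Require Import all_boot all_order all_algebra.
From mathcomp Require Import all_classical all_reals all_analysis.
From mathcomp Require Import measurable_realfun.
From mathcomp Require Import ring lra zify.
Import Order.TTheory GRing.Theory Num.Theory.
Import numFieldNormedType.Exports.
Import HBNNSimple.

Set Implicit Arguments.
Unset Strict Implicit.
Unset Printing Implicit Defensive.

Local Open Scope classical_set_scope.
Local Open Scope ring_scope.

(** * Uniqueness of Laplace transforms *)

(** No density of Y enters. Only its Laplace transform is known, so the identity for general g is a
    comparison of two measures, which needs nonnegative g. Since r_x has both signs, a bound K of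
    its absolute value is added and subtracted.

    Differentiating under the expectation needs E[Y^(-nu)] to be finite. This is not assumed: it
    comes out of the identity itself, taken with g = 1 and t = 1.

    The constant Gamma(1 - nu) has its origin in the singularity (t - tau)^(-nu), which the
    substitution turns into w^(-nu) on the half-line. Beyond being positive and finite, its value is
    never computed.

    Independence is given only for events generated by the two processes, while X(L(t)) mixes them.
    It is therefore approached by X at grid times just above L(t), where the time is deterministic
    on each grid cell; that the paths are constant immediately to the right of every time makes the
    limit exact. *)

Section weighted_distribution.
Context d (T : measurableType d) (R : realType).
Variables (m : {measure set T -> \bar R}) (phi : T -> R) (Z : T -> R).
Hypotheses (mphi : measurable_fun setT phi) (phi0 : forall x, 0 <= phi x).
Hypothesis mZ : measurable_fun setT Z.
Local Open Scope ereal_scope.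

(** The image under [Z] of the measure with density [phi] with respect to [m]. Both sides of the
    convolution identity are integrals against measures of this kind. *)
Definition weighted_distribution (A : set R) : \bar R :=
  \int[m]_(x in Z @^-1` A) (phi x)%:E.

Let mpre (A : set R) : measurable A -> measurable (Z @^-1` A).
Proof. by move=> mA; rewrite -[X in measurable X]setTI; exact: mZ. Qed.

Let wd0 : weighted_distribution set0 = 0.
Proof. by rewrite /weighted_distribution preimage_set0 integral_set0. Qed.

Let wd_ge0 A : 0 <= weighted_distribution A.
Proof. by apply: integral_ge0 => x _; rewrite lee_fin. Qed.

Let wd_sigma_additive : semi_sigma_additive weighted_distribution.
Proof.
move=> F mF tF mUF; rewrite /weighted_distribution preimage_bigcup.
apply: cvg_toP; first by apply: is_cvg_nneseries => n _ _; exact: wd_ge0.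
rewrite ge0_integral_bigcup//.
- by move=> k; exact: mpre.
- apply/measurable_EFinP; apply: (measurable_funS measurableT) => //.
- by move=> x _; rewrite lee_fin.
- apply/trivIsetP => /= i j _ _ ij.
  by rewrite -preimage_setI; move/trivIsetP : tF => -> //; rewrite preimage_set0.
Qed.

HB.instance Definition _ := isMeasure.Build _ _ _ weighted_distribution
  wd0 wd_ge0 wd_sigma_additive.

Definition weighted_measure : {measure set R -> \bar R} := weighted_distribution.

(** The change of variables formula: clear for simple functions, then by monotone convergence on
    both sides. *)
Lemma ge0_integral_weighted_measure (g : R -> R) :
  measurable_fun setT g -> (forall x, 0 <= g x)%R ->
  \int[weighted_measure]_y (g y)%:E = \int[m]_x (phi x * g (Z x))%:E.
Proof.
move=> mg g0; have mEg : measurable_fun setT (fun y => (g y)%:E) by exact/measurable_EFinP.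
pose g_ := nnsfun_approx measurableT mEg.
transitivity (limn (fun n => \int[weighted_measure]_x (g_ n x)%:E)).
  rewrite -monotone_convergence//.
  - apply: eq_integral => y _; apply/esym/cvg_lim => //.
    by apply: cvg_nnsfun_approx=> // *; rewrite lee_fin.
  - by move=> n; exact/measurable_EFinP/measurable_funP.
  - by move=> n y _; rewrite lee_fin.
  - by move=> y _ a b ab; rewrite lee_fin; exact/lefP/nd_nnsfun_approx.
have mphig n : measurable_fun setT (fun x => (phi x * g_ n (Z x))%:E).
  apply/measurable_EFinP/measurable_funM => //.
  by apply: measurableT_comp => //; exact/measurable_funP.
rewrite [X in limn X](_ : _ = (fun n => \int[m]_x (phi x * g_ n (Z x))%:E)).
  rewrite -monotone_convergence//.
  - apply: eq_integral => x _; apply/cvg_lim => //.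
    under eq_fun do rewrite EFinM; rewrite EFinM.
    apply: cvgeZl => //.
    by apply: cvg_nnsfun_approx=> // *; rewrite lee_fin.
  - by move=> n x _; rewrite lee_fin mulr_ge0.
  - move=> x _ a b ab; rewrite lee_fin ler_wpM2l//.
    exact/lefP/nd_nnsfun_approx.
apply/funext => n.
have mZpre r : measurable (Z @^-1` (g_ n @^-1` [set r])) by exact: mpre.
have mphi1 r : measurable_fun setT
    (fun x => (phi x * \1_(Z @^-1` (g_ n @^-1` [set r])) x)%R).
  exact: measurable_funM.
transitivity (\sum_(r \in range (g_ n))
    \int[m]_x (r * (phi x * \1_(Z @^-1` (g_ n @^-1` [set r])) x))%:E).
  rewrite integralT_nnsfun sintegralE; apply: eq_fsbigr => r.
  rewrite inE => -[y _ <-]; rewrite /weighted_distribution.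
  under [RHS]eq_integral do rewrite EFinM.
  rewrite ge0_integralZl//; last 3 first.
  - exact/measurable_EFinP.
  - by move=> x _; rewrite lee_fin mulr_ge0.
  - by rewrite lee_fin.
  congr (_ * _).
  change (\int[m]_(x in Z @^-1` (g_ n @^-1` [set g_ n y])) (phi x)%:E =
    \int[m]_x (phi x * \1_(Z @^-1` (g_ n @^-1` [set g_ n y])) x)%:E).
  rewrite integral_mkcond; apply: eq_integral => x _.
  rewrite patchE; case: ifPn => xZ.
  - by rewrite indicE xZ mulr1.
  - by rewrite indicE (negbTE xZ) mulr0.
rewrite -ge0_integral_fsum//.
- apply: eq_integral => x _; rewrite fsumEFin//; congr EFin.
  rewrite [in RHS](fimfunE (g_ n)) mulr_fsumr//.
  by apply: eq_fsbigr => r _; rewrite mulrCA.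
- by move=> r; exact/measurable_EFinP/measurable_funM.
- move=> r x _; rewrite lee_fin.
  (* A value [r] that is not attained has an empty preimage, so a possibly negative [r] contributes
     0. *)
  have [|/set0P[y ryZ]] := eqVneq (Z @^-1` (g_ n @^-1` [set r])) set0.
    by move=> ->; rewrite indic0 mulr0 mulr0.
  by move: ryZ => /= <-; rewrite !mulr_ge0.
Qed.

End weighted_distribution.

Section step_approximation.
Context (R : realType).
Implicit Types x z : R.

Lemma bernoulli_ineq (a : R) n : 0 <= a <= 1 -> 1 - n%:R * a <= (1 - a) ^+ n.
Proof.
move=> /andP[a0 a1]; elim: n => [|n ih]; first by rewrite mul0r subr0 expr0.
rewrite exprS; apply: (@le_trans _ _ ((1 - a) * (1 - n%:R * a))); last first.
  by rewrite ler_wpM2l// subr_ge0.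
have : 0 <= n%:R * (a * a) by rewrite mulr_ge0// mulr_ge0.
rewrite -natr1; nra.
Qed.

(* The polynomials [1 - (1 - u^n)^m] with [m] of order [n e^(n x)], evaluated at
   [u = e^(-z)], converge to the indicator of [z <= x]; the extra factor [n] in
   [m] settles the case [z = x]. *)
Definition step_approx x (n : nat) z : R :=
  1 - (1 - expR (- z) ^+ n) ^+ (Num.truncn (n%:R * expR (n%:R * x))).+1.

Let pow01 z n : 0 <= z -> 0 <= expR (- z) ^+ n <= 1.
Proof.
move=> z0.
by rewrite exprn_ge0 ?expR_ge0//= exprn_ile1 ?expR_ge0// -expR0 ler_expR oppr_le0.
Qed.

Lemma step_approx_bound x z n : 0 <= z -> 0 <= step_approx x n z <= 1.
Proof.
move=> z0; rewrite /step_approx.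
have /andP[u0 u1] := pow01 n z0.
rewrite subr_ge0 exprn_ile1 ?subr_ge0//.
  by rewrite lerBlDr lerDl exprn_ge0// subr_ge0.
Qed.

(** Write m for the outer exponent. If z <= x, then (1 - u^n)^m <= exp(- m u^n) <= e^(-n), because m
    u^n >= n e^(n (x - z)) >= n. If z > x, Bernoulli's inequality bounds the value by m u^n <= n
    e^(-n (z - x)) + e^(-n z), which is O(1/n). *)
Lemma cvg_step_approx x z : 0 <= x -> 0 <= z ->
  step_approx x n z @[n --> \oo] --> ((z <= x)%R%:R : R).
Proof.
move=> x0 z0; have [zx|xz] := leP z x.
  rewrite -[X in _ --> X]subr0; apply: cvgB; first exact: cvg_cst.
  apply: (@squeeze_cvgr _ _ _ _ (cst 0) (fun n : nat => expR (- n%:R))).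
  - near=> n; have /andP[u0 u1] := pow01 n z0.
    rewrite exprn_ge0 ?subr_ge0//=.
    have h : 1 - expR (- z) ^+ n <= expR (- expR (- z) ^+ n) by exact: expR_ge1Dx.
    apply: (@le_trans _ _ (expR (- expR (- z) ^+ n) ^+
        (Num.truncn (n%:R * expR (n%:R * x))).+1)).
      by apply: lerXn2r => //; rewrite nnegrE ?subr_ge0 ?expR_ge0.
    rewrite -expRM_natl ler_expR mulrN lerN2.
    apply: (@le_trans _ _ (n%:R * expR (n%:R * x) * expR (- z) ^+ n)).
      rewrite -mulrA ler_peMr// -expRM_natl -expRD -expR0 ler_expR.
      by rewrite mulrN -mulrBr mulr_ge0// subr_ge0.
    by rewrite ler_wpM2r// ltW// truncnS_gt.
  - exact: cvg_cst.
  - exact: cvgn_expR.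
(* The first term bounds n e^(-n (z - x)) through e^y >= y^2 / 2 and n + 1 <= 2 n; the second bounds
   e^(-n z) through e^y >= 1 + y. Both carry the factor 1 / (n + 1) of [harmonic]. *)
pose C : R := 4 / (z - x) ^+ 2 + (1 + z^-1).
apply: (@squeeze_cvgr _ _ _ _ (cst 0) (fun n : nat => C * harmonic n)).
- near=> n; have /andP[u0 u1] := pow01 n z0.
  have /andP[-> _]/= := step_approx_bound x n z0.
  have zx0 : 0 < z - x by rewrite subr_gt0.
  have z1 : 0 < z by exact: le_lt_trans xz.
  apply: (@le_trans _ _ ((n%:R * expR (n%:R * x) + 1) * expR (- z) ^+ n)).
    rewrite /step_approx lerBlDr -lerBlDl.
    apply: le_trans (bernoulli_ineq _ (pow01 n z0)).
    rewrite lerD2l lerN2 ler_wpM2r// -natr1 lerD2r truncn_le.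
    by rewrite mulr_ge0 ?expR_ge0.
  rewrite mulrDl mul1r /C mulrDl lerD//.
    rewrite -mulrA -expRM_natl -expRD mulrN -mulrBr.
    rewrite -[x - z]opprB mulrN expRN ler_pdivrMr ?expR_gt0//.
    rewrite mulrAC ler_pdivlMr// mulrAC ler_pdivlMr ?exprn_gt0//.
    have := @expR_ge1Dxn R (n%:R * (z - x)) 1 (mulr_ge0 (ler0n _ _) (ltW zx0)).
    rewrite exprMn (_ : 2`!%:R = 2 :> R)// => h.
    have h2 : n%:R ^+ 2 * (z - x) ^+ 2 <= 2 * expR (n%:R * (z - x)).
      by move: h; lra.
    have h3 : (n%:R * n.+1%:R : R) <= 2 * n%:R ^+ 2.
      rewrite -natrX -!natrM ler_nat; case: (n) => // m; nia.
    apply: (@le_trans _ _ ((2 * n%:R ^+ 2) * (z - x) ^+ 2)).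
      by rewrite ler_wpM2r// exprn_ge0// ltW.
    by rewrite -mulrA; lra.
  rewrite -expRM_natl mulrN expRN -div1r ler_pdivrMr ?expR_gt0//.
  rewrite mulrAC ler_pdivlMr// mul1r.
  apply: (@le_trans _ _ ((1 + z^-1) * (1 + n%:R * z))).
    rewrite mulrDr mulr1 mulrDl mul1r mulrCA mulVf ?gt_eqF// mulr1 -natr1.
    have : 0 <= z^-1 by rewrite invr_ge0 ltW.
    have : 0 <= n%:R * z by rewrite mulr_ge0// ltW.
    lra.
  by rewrite ler_wpM2l ?expR_ge1Dx// addr_ge0// invr_ge0 ltW.
- exact: cvg_cst.
- rewrite -[X in _ --> X](mulr0 C); apply: cvgM; first exact: cvg_cst.
  exact: cvg_harmonic.
Unshelve. all: by end_near. Qed.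

End step_approximation.

Section laplace_uniqueness.
Context (R : realType).
Implicit Types m : {measure set R -> \bar R}.

Lemma finite_integrable_bounded d (T : measurableType d)
    (m : {measure set T -> \bar R}) (f : T -> R) (M : R) :
  (m setT < +oo)%E -> measurable_fun setT f -> (forall x, `|f x| <= M) ->
  m.-integrable setT (EFin \o f).
Proof.
move=> mfin mf fM; apply: measurable_bounded_integrable => //.
by exists M; split; [exact: num_real|move=> y My x _; exact: le_trans (ltW My)].
Qed.

(** The absolute value keeps the function bounded by 1 on the whole line. It changes nothing for the
    measures of [laplace_unique], which do not charge the negative half-line. *)
Let absexp (z : R) := expR (- `|z|).

Let mabsexp : measurable_fun setT absexp.
Proof.
by apply: measurableT_comp => //; apply: measurableT_comp.
Qed.

Let absexp01 z : 0 <= absexp z <= 1.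
Proof. by rewrite expR_ge0/= -expR0 ler_expR oppr_le0. Qed.

Let lap m n := (\int[m]_z (absexp z ^+ n)%:E)%E.

Let lap0 m : lap m 0 = m setT.
Proof. by rewrite /lap; under eq_integral do rewrite expr0; rewrite integral_cst// mul1e. Qed.

Lemma laplace_poly m1 m2 : (m1 setT < +oo)%E ->
  (forall n, \int[m1]_z (expR (- `|z|) ^+ n)%:E = \int[m2]_z (expR (- `|z|) ^+ n)%:E)%E ->
  forall p : {poly R}, (\int[m1]_z (p.[expR (- `|z|)])%:E =
                        \int[m2]_z (p.[expR (- `|z|)])%:E)%E.
Proof.
move=> m1fin m12 p.
have m2fin : (m2 setT < +oo)%E.
  by move: (m12 0%N); rewrite -/(lap m1 0) -/(lap m2 0) !lap0 => <-.
have H m : (m setT < +oo)%E -> (\int[m]_z (p.[absexp z])%:E =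
    \sum_(i < size p) (p`_i)%:E * lap m i)%E.
  move=> mfin; under eq_integral do rewrite horner_coef -sumEFin.
  have int i : m.-integrable setT (fun x => (absexp x ^+ i)%:E).
    apply: (finite_integrable_bounded mfin (M := 1)) => [|x].
      by apply: measurable_funX; exact: mabsexp.
    have /andP[a0 a1] := absexp01 x.
    by rewrite ger0_norm ?exprn_ge0// exprn_ile1.
  rewrite integral_sum//; last by move=> i; under eq_fun do rewrite EFinM; exact: integrableZl.
  by apply: eq_bigr => i _; under eq_integral do rewrite EFinM; rewrite integralZl.
rewrite !H//; apply: eq_bigr => i _; congr (_ * _)%E; exact: m12.
Qed.

(** Integer arguments suffice because [step_approx x n] is a polynomial in e^(-z). By dominated
    convergence the measures agree on the sets |z| <= x, hence on the half-lines, which form a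
    generating class stable under intersection. *)
Lemma laplace_unique m1 m2 : (m1 setT < +oo)%E ->
  m1 `]-oo, 0[%classic = 0%E -> m2 `]-oo, 0[%classic = 0%E ->
  (forall n, \int[m1]_z (expR (- `|z|) ^+ n)%:E = \int[m2]_z (expR (- `|z|) ^+ n)%:E)%E ->
  forall A, measurable A -> m1 A = m2 A.
Proof.
move=> m1fin m1N m2N m12.
have m2fin : (m2 setT < +oo)%E.
  by move: (m12 0%N); rewrite -/(lap m1 0) -/(lap m2 0) !lap0 => <-.
have stepE (x : R) : 0 <= x -> m1 [set z : R | `|z| <= x] = m2 [set z : R | `|z| <= x].
  move=> x0.
  have mstep n : measurable_fun setT (fun z : R => step_approx x n `|z|).
    apply: measurable_funB => //; apply: measurable_funX; apply: measurable_funB => //.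
    by apply: measurable_funX; exact: mabsexp.
  have mset : measurable [set z : R | `|z| <= x].
    rewrite (_ : [set _ | _] = `[- x, x]%classic)//.
    by apply/seteqP; split => z /=; rewrite in_itv/= ler_norml.
  have lim m : (m setT < +oo)%E ->
      (\int[m]_z (step_approx x n `|z|)%:E)%E @[n --> \oo] --> m [set z : R | `|z| <= x].
    move=> mfin; rewrite -[X in _ --> m X]setIT -integral_indic//.
    apply: (@dominated_cvg _ _ _ m setT measurableT _ _ (cst 1%E)) => //.
    - by move=> n; exact/measurable_EFinP.
    - move=> z _; rewrite indicE; apply: cvg_EFin; first exact: nearW.
      have -> : (z \in [set z : R | `|z| <= x]) = (`|z| <= x).
        by apply/idP/idP; rewrite inE.
      exact: cvg_step_approx.
    - rewrite -[cst 1%E]/(EFin \o cst 1).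
      by apply: (finite_integrable_bounded mfin (M := 1)) => // y; rewrite normr1.
    - move=> n z _; rewrite lee_fin.
      have /andP[a0 a1] := @step_approx_bound R x `|z| n (normr_ge0 _).
      by rewrite ger0_norm.
  have eqn n : (\int[m1]_z (step_approx x n `|z|)%:E = \int[m2]_z (step_approx x n `|z|)%:E)%E.
    pose p : {poly R} := 1 - (1 - 'X^n) ^+ (Num.truncn (n%:R * expR (n%:R * x))).+1.
    have pE z : step_approx x n `|z| = p.[expR (- `|z|)].
      by rewrite /p /step_approx !hornerE.
    under eq_integral do rewrite pE; under [RHS]eq_integral do rewrite pE.
    exact: laplace_poly.
  have /cvg_lim <- // := lim _ m1fin; apply/cvg_lim => //.
  by under eq_fun do rewrite eqn; exact: lim.
have mT : m1 setT = m2 setT.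
  by move: (m12 0%N); rewrite -/(lap m1 0) -/(lap m2 0) !lap0.
have null m (B : set R) : m `]-oo, 0[%classic = 0%E -> measurable B ->
    B `<=` `]-oo, 0[%classic -> m B = 0%E.
  move=> m0 mB B0; apply/eqP; rewrite -measure_le0 -m0.
  by apply: le_measure => //; rewrite inE.
have cdfE (x : R) : m1 `]-oo, x]%classic = m2 `]-oo, x]%classic.
  have [x0|x0] := ltP x 0.
    have xN : `]-oo, x]%classic `<=` `]-oo, 0[%classic.
      by apply: subset_itvl; rewrite bnd_simp.
    by rewrite (null m1 _ m1N _ xN)// (null m2 _ m2N _ xN).
  have -> : `]-oo, x]%classic = [set z : R | `|z| <= x] `|` `]-oo, (- x)[%classic.
    apply/seteqP; split => z /=; rewrite !in_itv/= ler_norml.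
      by move=> ->; rewrite andbT; case: (leP (- x) z); [left|right].
    case=> [/andP[]//|zx]; apply/ltW/(lt_le_trans zx); lra.
  have mset : measurable [set z : R | `|z| <= x].
    rewrite (_ : [set _ | _] = `[- x, x]%classic)//.
    by apply/seteqP; split => z /=; rewrite in_itv/= ler_norml.
  have mU m : m `]-oo, 0[%classic = 0%E -> m ([set z : R | `|z| <= x] `|`
      `]-oo, (- x)[%classic) = m [set z : R | `|z| <= x].
    move=> m0; rewrite measureU//; last first.
      apply/seteqP; split => z //= [].
      by rewrite ler_norml in_itv/= => /andP[a _]; rewrite ltNge a.
    have xN : `]-oo, (- x)[%classic `<=` `]-oo, 0[%classic.
      by apply: subset_itvl; rewrite bnd_simp oppr_le0.
    have h0 : m `]-oo, (- x)[%classic = 0%E by exact: null xN.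
    by rewrite [X in (_ + X)%E]h0 adde0.
  by rewrite !mU// stepE.
apply: (measure_unique (@RGenOInfty.G R) (fun n => `](- n%:R), +oo[%classic)).
- exact: RGenOInfty.measurableE.
- move=> _ _ [x ->] [y ->]; exists (Num.max x y).
  apply/seteqP; split => z /=; rewrite !in_itv/= !andbT gt_max.
    by move=> [-> ->].
  by move=> /andP.
- by move=> n; exists (- n%:R).
- apply/seteqP; split => // z _; exists (Num.truncn `|z|).+1 => //=.
  rewrite in_itv/= andbT; have := truncnS_gt `|z|.
  by rewrite ltr_norml => /andP[].
- move=> _ [x ->].
  have cE (m : {measure set R -> \bar R}) : (m setT < +oo)%E ->
      m `]x, +oo[%classic = (m setT - m `]-oo, x]%classic)%E.
    by move=> mfin; rewrite -setCitvl -setTD measureD// setTI.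
  by rewrite !cE// mT cdfE.
- by move=> n; apply: le_lt_trans m1fin; apply: le_measure; rewrite ?inE.
Qed.

End laplace_uniqueness.

(* Weighting by [e^(-Z)] makes the two image measures finite. *)
Lemma weighted_laplace_unique (R : realType) d1 d2 (T1 : measurableType d1)
    (T2 : measurableType d2) (m1 : {measure set T1 -> \bar R})
    (m2 : {measure set T2 -> \bar R}) (phi1 Z1 : T1 -> R) (phi2 Z2 : T2 -> R) :
  measurable_fun setT phi1 -> (forall x, 0 <= phi1 x) ->
  measurable_fun setT Z1 -> (forall x, 0 <= Z1 x) ->
  measurable_fun setT phi2 -> (forall x, 0 <= phi2 x) ->
  measurable_fun setT Z2 -> (forall x, 0 <= Z2 x) ->
  (\int[m1]_x (phi1 x * expR (- Z1 x))%:E < +oo)%E ->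
  (forall n, \int[m1]_x (phi1 x * expR (- (n.+1%:R * Z1 x)))%:E =
             \int[m2]_x (phi2 x * expR (- (n.+1%:R * Z2 x)))%:E)%E ->
  forall g : R -> R, measurable_fun setT g -> (forall z, 0 <= g z) ->
  (\int[m1]_x (phi1 x * g (Z1 x))%:E = \int[m2]_x (phi2 x * g (Z2 x))%:E)%E.
Proof.
move=> mphi1 phi10 mZ1 Z10 mphi2 phi20 mZ2 Z20 fin lap g mg g0.
pose psi1 x := phi1 x * expR (- Z1 x).
pose psi2 x := phi2 x * expR (- Z2 x).
have mpsi1 : measurable_fun setT psi1.
  by apply: measurable_funM => //; do 2 apply: measurableT_comp => //.
have mpsi2 : measurable_fun setT psi2.
  by apply: measurable_funM => //; do 2 apply: measurableT_comp => //.
have psi10 x : 0 <= psi1 x by rewrite mulr_ge0 ?expR_ge0.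
have psi20 x : 0 <= psi2 x by rewrite mulr_ge0 ?expR_ge0.
pose w1 := weighted_measure m1 mpsi1 psi10 mZ1.
pose w2 := weighted_measure m2 mpsi2 psi20 mZ2.
have neg0 d (T : measurableType d) (m : {measure set T -> \bar R}) (psi Z : T -> R)
    (mpsi : measurable_fun setT psi) (psi0 : forall x, 0 <= psi x)
    (mZ : measurable_fun setT Z) : (forall x, 0 <= Z x) ->
    weighted_measure m mpsi psi0 mZ `]-oo, 0[%classic = 0%E.
  move=> Z0; rewrite /weighted_measure/= /weighted_distribution.
  rewrite (_ : _ @^-1` _ = set0) ?integral_set0//.
  by apply/seteqP; split => x //=; rewrite in_itv/= ltNge Z0.
have lapE d (T : measurableType d) (m : {measure set T -> \bar R}) (phi Z : T -> R)
    (psi := fun x => phi x * expR (- Z x))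
    (mpsi : measurable_fun setT psi) (psi0 : forall x, 0 <= psi x)
    (mZ : measurable_fun setT Z) n : (forall x, 0 <= Z x) ->
    (\int[weighted_measure m mpsi psi0 mZ]_z (expR (- `|z|) ^+ n)%:E =
     \int[m]_x (phi x * expR (- (n.+1%:R * Z x)))%:E)%E.
  move=> Z0; rewrite ge0_integral_weighted_measure; last 2 first.
  - apply: measurable_funX; apply: measurableT_comp => //.
    by apply: measurableT_comp.
  - by move=> z; rewrite exprn_ge0// expR_ge0.
  apply: eq_integral => x _; rewrite /psi ger0_norm// -mulrA -exprS -expRM_natl.
  by rewrite mulrN.
have w12 A : measurable A -> w1 A = w2 A.
  apply: laplace_unique; try exact: neg0.
    rewrite /w1 /weighted_measure/= /weighted_distribution preimage_setT.
    exact: fin.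
  by move=> n; rewrite !lapE.
(* The factor [expR z] undoes the weight e^(-Z) put into [psi1] and [psi2]. *)
pose h z := expR z * g z.
have mh : measurable_fun setT h by exact: measurable_funM.
have h0 z : 0 <= h z by rewrite mulr_ge0 ?expR_ge0.
have hE d (T : measurableType d) (m : {measure set T -> \bar R}) (phi Z : T -> R) :
    (\int[m]_x (phi x * g (Z x))%:E = \int[m]_x (phi x * expR (- Z x) * h (Z x))%:E)%E.
  apply: eq_integral => x _; congr EFin; rewrite /h -mulrA; congr (_ * _).
  by rewrite mulrA expRN mulVf ?mul1r// expR_eq0.
rewrite !hE -(ge0_integral_weighted_measure m1 mpsi1 psi10 mZ1)//.
rewrite -(ge0_integral_weighted_measure m2 mpsi2 psi20 mZ2)//.
by apply: eq_measure_integral => A mA _; exact: w12.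
Qed.

(** * Substitutions and gamma integrals *)

Section exhaustion.
Context (R : realType).
Local Notation mu := (@lebesgue_measure R).
Local Open Scope ereal_scope.

(** Carries a substitution from compact intervals to the open or unbounded intervals that they
    exhaust. *)
Lemma ge0_exhaustion_eq (f g : R -> R) (A B : (set R)^nat) :
  nondecreasing_seq A -> nondecreasing_seq B ->
  (forall n, measurable (A n)) -> (forall n, measurable (B n)) ->
  (forall n, measurable_fun (A n) f) -> (forall n, measurable_fun (B n) g) ->
  (forall n x, A n x -> 0 <= f x)%R -> (forall n x, B n x -> 0 <= g x)%R ->
  (forall n, \int[mu]_(x in A n) (f x)%:E = \int[mu]_(x in B n) (g x)%:E) ->
  \int[mu]_(x in \bigcup_n A n) (f x)%:E = \int[mu]_(x in \bigcup_n B n) (g x)%:E.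
Proof.
move=> ndA ndB mA mB mf mg f0 g0 fg.
have /cvg_lim <- // : \int[mu]_(x in A n) (f x)%:E @[n --> \oo] -->
    \int[mu]_(x in \bigcup_n A n) (f x)%:E.
  apply: ge0_nondecreasing_set_cvg_integral => //.
  by move=> n; apply/measurable_EFinP; exact: mf.
apply/cvg_lim => //; under eq_fun do rewrite fg.
apply: ge0_nondecreasing_set_cvg_integral => //.
by move=> n; apply/measurable_EFinP; exact: mg.
Qed.

End exhaustion.

Lemma is_derive_continuous (R : realType) (f : R -> R) (x l : R) :
  is_derive x 1 f l -> {for x, continuous f}.
Proof.
by move=> h; apply: differentiable_continuous; apply/derivable1_diffP; exact: ex_derive.
Qed.

Lemma is_derive_div_shift (R : realType) (k c x : R) : x + c != 0 ->
  is_derive x 1 (fun y => k / (y + c)) (- (k / (x + c) ^+ 2)).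
Proof.
move=> xc.
have d : is_derive x 1 (fun y : R => y + c) 1.
  by apply: is_derive_eq; rewrite addr0.
have dV : derivable (fun y : R => (y + c)^-1) x 1.
  by apply: derivableV => //; exact: ex_derive.
apply: DeriveDef; first exact: derivableM.
have -> : (fun y : R => k / (y + c)) = k \*: (fun y : R => (y + c)^-1) by [].
have d1 : derivable (fun y : R => y + c) x 1 by exact: ex_derive.
rewrite deriveZ//= deriveV//.
by rewrite derive_val /GRing.scale/= mulr1 mulrN.
Qed.

Section power_integrals.
Context (R : realType).
Local Notation mu := (@lebesgue_measure R).

Lemma continuous_within_itvcy (a : R) (f : R -> R) :
  (forall x, a <= x -> {for x, continuous f}) -> {within `[a, +oo[, continuous f}.
Proof.
move=> cf; apply/continuous_within_itvcyP; split.
  by move=> x; rewrite in_itv/= andbT => /ltW; exact: cf.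
exact/cvg_at_right_filter/cf.
Qed.

Lemma cvg_expRN_comp (f : R -> R) :
  f x @[x --> +oo] --> +oo -> expR (- f x) @[x --> +oo] --> 0.
Proof. by move=> fy; exact: (cvg_comp f (fun y => expR (- y)) fy (@cvgr_expR R)). Qed.

Lemma cvgr_powRy (r : R) : 0 < r -> x `^ r @[x --> +oo] --> +oo.
Proof.
move=> r0; apply/cvgryPge => A.
near=> x.
have M0 : 0 <= Num.max A 0 by rewrite le_max lexx orbT.
apply: (@le_trans _ _ (Num.max A 0)); first by rewrite le_max lexx.
have xM : (Num.max A 0) `^ r^-1 <= x by near: x; exact: nbhs_pinfty_ge.
have := @ge0_ler_powR R r (ltW r0) ((Num.max A 0) `^ r^-1) x.
rewrite !nnegrE powR_ge0 => /(_ isT (le_trans (powR_ge0 _ _) xM) xM).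
by rewrite -powRrM mulVf ?gt_eqF// powRr1.
Unshelve. all: by end_near. Qed.

Lemma integral_expR_tail (v z : R) : 0 < z ->
  (\int[mu]_(a in `[v, +oo[) (expR (- (a * z)))%:E = (expR (- (v * z)) / z)%:E)%E.
Proof.
move=> z0.
have d (x : R) : is_derive x 1 (fun a : R => - (expR (- (a * z)) / z)) (expR (- (x * z))).
  apply: is_derive_eq.
  by rewrite !scaler0 !add0r /GRing.scale/=; field; rewrite gt_eqF.
rewrite (@ge0_continuous_FTC2y R (fun a => expR (- (a * z)))
  (fun a => - (expR (- (a * z)) / z)) v 0).
- by rewrite -EFinB sub0r opprK.
- by move=> x _; exact: expR_ge0.
- apply: continuous_within_itvcy => x _.
  apply: continuous_comp; last exact: continuous_expR.
  by apply: continuousN; apply: continuousM; [exact: cvg_id|exact: cvg_cst].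
- rewrite -[X in _ --> X]oppr0; apply: cvgN.
  rewrite -[X in _ --> X](mul0r z^-1); apply: cvgM; last exact: cvg_cst.
  apply: cvg_expRN_comp.
  by apply: gt0_cvgMly => //; exact: cvg_id.
- by move=> x _; exact: ex_derive.
- by apply: cvg_at_right_filter; exact: (is_derive_continuous (d v)).
- by move=> x _; rewrite derive1E; exact: derive_val.
Qed.

Lemma is_derive_powR (x r : R) : 0 < x ->
  is_derive x 1 (fun y => y `^ r) (r * x `^ (r - 1)).
Proof.
move=> x0; apply: DeriveDef.
  by apply: derivable_powR; rewrite in_itv/= x0.
by rewrite -derive1E powR_derive1// in_itv/= x0.
Qed.

(** The integrand is an exact derivative. Starting at [v > 0] avoids the singularity at 0 of the
    power when [al < 1]. *)
Lemma integral_expR_powR_tail (al c v : R) : 0 < al -> 0 < c -> 0 < v ->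
  (\int[mu]_(a in `[v, +oo[) (al * a `^ (al - 1) * expR (- (c * a `^ al)))%:E =
   (expR (- (c * v `^ al)) / c)%:E)%E.
Proof.
move=> al0 c0 v0.
have d (x : R) : 0 < x -> is_derive x 1 (fun a : R => - (expR (- (c * a `^ al)) / c))
    (al * x `^ (al - 1) * expR (- (c * x `^ al))).
  move=> x0; have := is_derive_powR al x0 => h.
  apply: is_derive_eq.
  by rewrite scaler0 add0r /GRing.scale/=; field; rewrite gt_eqF.
rewrite (@ge0_continuous_FTC2y R _ (fun a => - (expR (- (c * a `^ al)) / c)) v 0).
- by rewrite -EFinB sub0r opprK.
- by move=> x _; rewrite !mulr_ge0 ?expR_ge0 ?powR_ge0// ltW.
- apply: continuous_within_itvcy => x vx.
  have x0 : 0 < x by exact: lt_le_trans vx.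
  have cp r : {for x, continuous (fun y : R => y `^ r)}.
    exact: (is_derive_continuous (is_derive_powR r x0)).
  apply: continuousM; first by apply: continuousM; [exact: cvg_cst|exact: cp].
  apply: continuous_comp; last exact: continuous_expR.
  by apply: continuousN; apply: continuousM; [exact: cvg_cst|exact: cp].
- rewrite -[X in _ --> X]oppr0; apply: cvgN.
  rewrite -[X in _ --> X](mul0r c^-1); apply: cvgM; last exact: cvg_cst.
  apply: cvg_expRN_comp.
  apply: gt0_cvgMry => //.
  exact: cvgr_powRy.
- by move=> x vx; have := d x (lt_trans v0 vx) => h; exact: ex_derive.
- by apply: cvg_at_right_filter; exact: (is_derive_continuous (d v v0)).
- move=> x; rewrite in_itv/= andbT => vx; rewrite derive1E.
  by have := d x (lt_trans v0 vx) => h; exact: derive_val.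
Qed.

(** The compact intervals [1 / (n + 1), n + 1] exhaust the half-line, and their images under the
    decreasing [F] exhaust [i], since [F] maps onto it. On each of them the substitution rule for
    continuous functions applies. *)
Lemma ge0_substitution_decreasing (F F' G : R -> R) (i : interval R) :
  (forall x : R, 0 < x -> is_derive x 1 F (F' x)) ->
  (forall x : R, 0 < x -> F' x <= 0) ->
  (forall x : R, 0 < x -> {for x, continuous F'}) ->
  (forall x y : R, 0 < x -> x < y -> F y < F x) ->
  (forall x : R, 0 < x -> F x \in i) ->
  (forall y : R, y \in i -> exists2 x : R, 0 < x & F x = y) ->
  (forall y : R, y \in i -> {for y, continuous G}) ->
  (forall y : R, y \in i -> 0 <= G y) ->
  (\int[mu]_(y in [set` i]) (G y)%:E =
   \int[mu]_(x in `]0%R, +oo[) (G (F x) * - F' x)%:E)%E.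
Proof.
move=> dF F'0 cF' Fdecr Fi iF cG G0.
pose a (n : nat) : R := n.+1%:R^-1.
pose b (n : nat) : R := n.+1%:R.
have a0 n : 0 < a n by rewrite invr_gt0.
have ab n : a n <= b n.
  by rewrite (@le_trans _ _ 1)// ?invf_le1// ler1n.
have andn m n : (m <= n)%N -> a n <= a m.
  by move=> mn; rewrite lef_pV2 ?posrE// ler_nat ltnS.
have bnd m n : (m <= n)%N -> b m <= b n by move=> mn; rewrite ler_nat ltnS.
have Fle (x y : R) : 0 < x -> x <= y -> F y <= F x.
  by move=> x0; rewrite le_eqVlt => /predU1P[->//|xy]; apply/ltW/Fdecr.
have cF (x : R) : 0 < x -> {for x, continuous F}.
  by move=> x0; exact: (is_derive_continuous (dF x x0)).
have iconv n y : F (b n) <= y <= F (a n) -> y \in i.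
  move=> /andP[h1 h2].
  have b0 : 0 < b n by exact: lt_le_trans (ab n).
  have := @interval_is_interval _ i (F (b n)) (F (a n)) (Fi _ b0) (Fi _ (a0 n)) y.
  by apply; rewrite h1 h2.
have seti : [set` i] = \bigcup_n `[F (b n), F (a n)]%classic.
  apply/seteqP; split => y /=; last first.
    by move=> [n _ /=]; rewrite in_itv/=; exact: iconv.
  move=> /iF[x x0 <-].
  (* This makes [b n] larger than both [x] and its inverse, so that [x] lies between [a n] and
     [b n]. *)
  pose n := (Num.truncn (x + x^-1)); exists n => //=.
  have h : x + x^-1 < b n by exact: truncnS_gt.
  have x10 : 0 < x^-1 by rewrite invr_gt0.
  rewrite in_itv/= !Fle//.
  - by rewrite -[x]invrK lef_pV2 ?posrE//; rewrite /b in h; lra.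
  - by rewrite ltW//; move: h; lra.
have set0y : `]0, +oo[%classic = \bigcup_n `[a n, b n]%classic.
  apply/seteqP; split => x /=; last first.
    by move=> [n _ /=]; rewrite !in_itv/= andbT => /andP[+ _]; exact: lt_le_trans.
  rewrite in_itv/= andbT => x0.
  pose n := (Num.truncn (x + x^-1)); exists n => //=.
  have h : x + x^-1 < b n by exact: truncnS_gt.
  have x10 : 0 < x^-1 by rewrite invr_gt0.
  rewrite in_itv/=; apply/andP; split.
  - by rewrite -[x]invrK lef_pV2 ?posrE//; rewrite /b in h; lra.
  - by rewrite ltW//; move: h; lra.
have cH (x : R) : 0 < x -> {for x, continuous (fun x => G (F x) * - F' x)}.
  move=> x0; apply: continuousM; last by apply: continuousN; exact: cF'.
  by apply: continuous_comp; [exact: cF|exact/cG/Fi].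
have cw (f : R -> R) (l r : R) : (forall y, l <= y <= r -> {for y, continuous f}) ->
    {within `[l, r], continuous f}.
  move=> cf; apply/continuous_in_subspaceT => y; rewrite inE/= in_itv/=.
  exact: cf.
rewrite seti set0y; apply: ge0_exhaustion_eq.
- move=> m n mn; rewrite subsetEset; apply: subset_itv; rewrite bnd_simp Fle//.
    exact: bnd.
  exact: andn.
- move=> m n mn; rewrite subsetEset; apply: subset_itv; rewrite bnd_simp.
    exact: andn.
  exact: bnd.
- by [].
- by [].
- move=> n; apply: subspace_continuous_measurable_fun => //.
  by apply: cw => y /iconv; exact: cG.
- move=> n; apply: subspace_continuous_measurable_fun => //.
  by apply: cw => y /andP[h _]; apply: cH; exact: lt_le_trans h.
- by move=> n x /=; rewrite in_itv/= => /iconv; exact: G0.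
- move=> n x /=; rewrite in_itv/= => /andP[ax xb].
  have x0 : 0 < x by exact: lt_le_trans ax.
  by rewrite mulr_ge0 ?G0 ?Fi// oppr_ge0 F'0.
- move=> n.
  have dF1 (x : R) : 0 < x -> derive1 F x = F' x.
    by move=> x0; rewrite derive1E; have := dF x x0 => h; exact: derive_val.
  have cF1 (x : R) : 0 < x -> derive1 F y @[y --> x] --> F' x.
    move=> x0; apply: cvg_trans (cF' x x0); apply: near_eq_cvg.
    by near=> y; rewrite dF1//; near: y; exact: lt_nbhsr.
  have b0 : 0 < b n by exact: lt_le_trans (ab n).
  rewrite (@integration_by_substitution_decreasing R F G (a n) (b n)) => //.
  + apply: eq_integral => x; rewrite inE/= in_itv/= => /andP[ax _].
    by rewrite /= !fctE dF1//; exact: lt_le_trans ax.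
  + move=> x y; rewrite !in_itv/= => /andP[ax _] /andP[ay _] xy; apply: Fdecr => //.
    exact: lt_le_trans ay.
  + move=> x; rewrite in_itv/= => /andP[ax _].
    by have x0 := lt_trans (a0 n) ax; rewrite /continuous_at dF1//; exact: cF1.
  + by apply/cvg_ex; exists (F' (a n)); apply: cvg_at_right_filter; exact: cF1.
  + by apply/cvg_ex; exists (F' (b n)); apply: cvg_at_left_filter; exact: cF1.
  + split.
    * move=> x; rewrite in_itv/= => /andP[ax _]; have x0 := lt_trans (a0 n) ax.
      by have := dF x x0 => h; exact: ex_derive.
    * exact/cvg_at_right_filter/cF.
    * exact/cvg_at_left_filter/cF.
  + by apply: cw => y /iconv; exact: cG.
Unshelve. all: by end_near. Qed.

(** Scaling is increasing, whereas the available substitution is decreasing. It is obtained from two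
    inversions, x -> c / x on one side and x -> 1 / x on the other, which lead to the same
    integral. *)
Lemma ge0_integral_scale (G : R -> R) (c : R) : 0 < c ->
  (forall x : R, 0 < x -> {for x, continuous G}) -> (forall x : R, 0 < x -> 0 <= G x) ->
  (\int[mu]_(x in `]0%R, +oo[) (G x)%:E =
   \int[mu]_(x in `]0%R, +oo[) (c * G (c * x))%:E)%E.
Proof.
move=> c0 cG G0.
have main (k : R) (H : R -> R) : 0 < k ->
    (forall x : R, 0 < x -> {for x, continuous H}) ->
    (forall x : R, 0 < x -> 0 <= H x) ->
    (\int[mu]_(x in `]0%R, +oo[) (H x)%:E =
     \int[mu]_(x in `]0%R, +oo[) (H (k / x) * - (- (k / x ^+ 2)))%:E)%E.
  move=> k0 cH H0.
  apply: (@ge0_substitution_decreasing (fun x => k / x) (fun x => - (k / x ^+ 2)) H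
    `]0%R, +oo[).
  - move=> x x0; have xn0 : x != 0 by rewrite gt_eqF.
    have := @is_derive_div_shift R k 0 x; rewrite addr0 => /(_ xn0).
    by under eq_fun do rewrite addr0.
  - by move=> x x0; rewrite oppr_le0 divr_ge0 ?exprn_ge0// ltW.
  - move=> x x0; apply: continuousN; apply: continuousM; first exact: cvg_cst.
    apply: continuousV; first by rewrite expf_neq0 ?gt_eqF.
    exact: exprn_continuous.
  - move=> x y x0 xy; rewrite ltr_pM2l// ltf_pV2 ?posrE//.
    exact: lt_trans xy.
  - by move=> x x0; rewrite in_itv/= andbT divr_gt0.
  - move=> y; rewrite in_itv/= andbT => y0; exists (k / y); first by rewrite divr_gt0.
    by field; rewrite !gt_eqF.
  - by move=> y; rewrite in_itv/= andbT; exact: cH.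
  - by move=> y; rewrite in_itv/= andbT; exact: H0.
rewrite (main c)// (main 1 (fun x => c * G (c * x)))//.
- apply: eq_integral => x; rewrite inE/= in_itv/= andbT => x0.
  congr EFin; rewrite !opprK mul1r mulrAC [RHS]mulrC mulrA mulrAC -mulrA.
  by congr (_ * _); rewrite mulrC mul1r.
- move=> x x0; apply: continuousM; first exact: cvg_cst.
  apply: continuous_comp; last by apply: cG; rewrite mulr_gt0.
  by apply: continuousM; [exact: cvg_cst|exact: cvg_id].
- by move=> x x0; rewrite mulr_ge0 ?(ltW c0)// G0// mulr_gt0.
Qed.

(** The integral of [Gamma] with values in the extended reals, so that Tonelli's theorem can be used
    before finiteness is known. *)
Definition gammaE (al : R) : \bar R :=
  (\int[mu]_(w in `]0%R, +oo[) (w `^ (al - 1) * expR (- w))%:E)%E.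

Let cpow (r x : R) : 0 < x -> {for x, continuous (fun y : R => y `^ r)}.
Proof. by move=> x0; exact: (is_derive_continuous (is_derive_powR r x0)). Qed.

Lemma gammaE_scale (al c : R) : 0 < c ->
  (\int[mu]_(w in `]0%R, +oo[) (w `^ (al - 1) * expR (- (c * w)))%:E =
   (c `^ (- al))%:E * gammaE al)%E.
Proof.
move=> c0; have cn0 : c != 0 by rewrite gt_eqF.
rewrite /gammaE -ge0_integralZl//.
- rewrite (@ge0_integral_scale (fun w => c `^ (- al) * (w `^ (al - 1) * expR (- w))) c)//.
  + apply: eq_integral => x; rewrite inE/= in_itv/= andbT => x0; congr EFin.
    rewrite powRM ?ltW// !mulrA -[X in X * _ * _ * _ `^ _](powRr1 (ltW c0)).
    rewrite -!powRD ?cn0 ?implybT//.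
    by rewrite (_ : 1 + - al + (al - 1) = 0) ?powRr0 ?mul1r//; ring.
  + move=> x x0; apply: continuousM; first exact: cvg_cst.
    apply: continuousM; first exact: cpow.
    by apply: continuous_comp; [exact: continuousN|exact: continuous_expR].
  + by move=> x x0; rewrite !mulr_ge0 ?powR_ge0 ?expR_ge0.
- apply/measurable_EFinP/measurable_funTS/measurable_funM.
    exact: measurable_powR.
  by apply: measurableT_comp.
- by move=> x _; rewrite lee_fin mulr_ge0 ?powR_ge0 ?expR_ge0.
- by rewrite lee_fin powR_ge0.
Qed.

(** On []0, 1[] the integrand is at least e^(-1), because a power with exponent al - 1 <= 0 is at
    least 1 there. *)
Lemma gammaE_gt0 (al : R) : al <= 1 -> (0 < gammaE al)%E.
Proof.
move=> al1.
apply: (@lt_le_trans _ _ (\int[mu]_(w in `]0%R, 1%R[) (expR (- 1))%:E)%E).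
  rewrite integral_cst//= lebesgue_measure_itv/= lte_fin ltr01 -EFinB subr0 mule1.
  by rewrite lte_fin expR_gt0.
rewrite /gammaE.
apply: (@le_trans _ _ (\int[mu]_(w in `]0%R, 1%R[) (w `^ (al - 1) * expR (- w))%:E)%E).
  apply: ge0_le_integral => //.
  - apply/measurable_EFinP/measurable_funTS/measurable_funM.
      exact: measurable_powR.
    by apply: measurableT_comp.
  - move=> x /=; rewrite in_itv/= => /andP[x0 x1]; rewrite lee_fin.
    apply: (@le_trans _ _ (1 * expR (- x))).
      by rewrite mul1r ler_expR lerN2 ltW.
    rewrite ler_wpM2r ?expR_ge0// -[leLHS](powRr0 x) ger_powR ?x0 ?(ltW x1)//.
    by rewrite subr_le0.
apply: ge0_subset_integral => //.
- apply/measurable_EFinP/measurable_funTS/measurable_funM.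
    exact: measurable_powR.
  by apply: measurableT_comp.
- by move=> x _; rewrite lee_fin mulr_ge0 ?powR_ge0 ?expR_ge0.
- by apply: subset_itvl.
Qed.

(** Since w^al <= 1 + w, one has e^(-w) <= e e^(- w^al). The resulting majorant [f] has an explicit
    antiderivative, and its integral over the half-line is at most e / al. *)
Lemma gammaE_lty (al : R) : 0 < al -> al <= 1 -> (gammaE al < +oo)%E.
Proof.
move=> al0 al1.
pose f (w : R) := expR 1 / al * (al * w `^ (al - 1) * expR (- (1 * w `^ al))).
have mf : measurable_fun setT f.
  apply: measurable_funM => //; apply: measurable_funM.
    by apply: measurable_funM => //; exact: measurable_powR.
  apply: measurableT_comp => //; apply: measurableT_comp => //.
  by apply: measurable_funM => //; exact: measurable_powR.
have f0 w : 0 <= f w.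
  by rewrite !mulr_ge0 ?expR_ge0 ?powR_ge0 ?invr_ge0 ?ltW.
apply: (@le_lt_trans _ _ (\int[mu]_(w in `]0%R, +oo[) (f w)%:E)%E).
  apply: ge0_le_integral => //.
  - by move=> x _; rewrite lee_fin mulr_ge0 ?powR_ge0 ?expR_ge0.
  - apply/measurable_EFinP/measurable_funTS/measurable_funM.
      exact: measurable_powR.
    by apply: measurableT_comp.
  - exact/measurable_EFinP/measurable_funTS.
  - move=> x /=; rewrite in_itv/= andbT => x0; rewrite lee_fin /f.
    rewrite (_ : _ / _ * _ = x `^ (al - 1) * (expR 1 * expR (- x `^ al))); last first.
      by rewrite mul1r; field; rewrite gt_eqF.
    rewrite ler_wpM2l ?powR_ge0// -expRD ler_expR.
    suff : x `^ al <= 1 + x by lra.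
    have [x1|x1] := leP x 1.
      apply: (@le_trans _ _ 1); last by rewrite lerDl ltW.
      by rewrite -(powRr0 x) ger_powR ?x0// ltW.
    by apply: (le_trans (ler1_powR (ltW x1) al1)); rewrite lerDr.
have -> : `]0%R, +oo[%classic = \bigcup_n `[(n.+1%:R^-1 : R)%R, +oo[%classic.
  apply/seteqP; split => x /=; last first.
    move=> [n _ /=]; rewrite !in_itv/= !andbT; apply: lt_le_trans.
    by rewrite invr_gt0.
  rewrite in_itv/= andbT => x0; exists (Num.truncn x^-1) => //=.
  rewrite in_itv/= andbT -[leRHS]invrK lef_pV2 ?posrE ?invr_gt0//.
  exact/ltW/truncnS_gt.
apply: (@le_lt_trans _ _ (expR 1 / al)%:E); last exact: ltry.
have /cvg_lim <- // : (\int[mu]_(w in `[(n.+1%:R^-1 : R)%R, +oo[) (f w)%:E)%E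
    @[n --> \oo] -->
    (\int[mu]_(w in \bigcup_n `[(n.+1%:R^-1 : R)%R, +oo[%classic) (f w)%:E)%E.
  apply: ge0_nondecreasing_set_cvg_integral => //.
  - move=> m n mn; rewrite subsetEset; apply: subset_itvr; rewrite bnd_simp.
    by rewrite lef_pV2 ?posrE// ler_nat ltnS.
  - by move=> n; exact/measurable_EFinP/measurable_funTS.
  - by move=> n x _; rewrite lee_fin.
apply: lime_le.
  apply: ereal_nondecreasing_is_cvgn => m n mn; apply: ge0_subset_integral => //.
  - exact/measurable_EFinP/measurable_funTS.
  - by move=> x _; rewrite lee_fin.
  - apply: subset_itvr; rewrite bnd_simp.
    by rewrite lef_pV2 ?posrE// ler_nat ltnS.
apply: nearW => n.
rewrite /f; under eq_integral do rewrite EFinM.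
rewrite ge0_integralZl//; last 3 first.
- apply/measurable_EFinP/measurable_funTS/measurable_funM.
    by apply: measurable_funM => //; exact: measurable_powR.
  apply: measurableT_comp => //; apply: measurableT_comp => //.
  by apply: measurable_funM => //; exact: measurable_powR.
- by move=> x _; rewrite lee_fin !mulr_ge0 ?powR_ge0 ?expR_ge0// ltW.
- by rewrite lee_fin mulr_ge0 ?expR_ge0// invr_ge0 ltW.
rewrite integral_expR_powR_tail// ?invr_gt0// -EFinM lee_fin divr1 ler_piMr//.
  by rewrite mulr_ge0 ?expR_ge0// invr_ge0 ltW.
Qed.

End power_integrals.

(** * The convolution identity for a stable variable *)

Lemma tonelli_on (R : realType) d1 d2 (T1 : measurableType d1) (T2 : measurableType d2)
    (m1 : {sigma_finite_measure set T1 -> \bar R})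
    (m2 : {sigma_finite_measure set T2 -> \bar R})
    (D1 : set T1) (D2 : set T2) (f : T1 -> T2 -> R) :
  measurable D1 -> measurable D2 ->
  measurable_fun setT (fun z : T1 * T2 => f z.1 z.2) ->
  (forall x y, D1 x -> D2 y -> 0 <= f x y) ->
  (\int[m1]_(x in D1) \int[m2]_(y in D2) (f x y)%:E =
   \int[m2]_(y in D2) \int[m1]_(x in D1) (f x y)%:E)%E.
Proof.
move=> mD1 mD2 mf f0.
pose g (z : T1 * T2) : R := \1_D1 z.1 * \1_D2 z.2 * f z.1 z.2.
have mg : measurable_fun setT (fun z => (g z)%:E).
  apply/measurable_EFinP; apply: measurable_funM => //; apply: measurable_funM.
    exact: measurableT_comp.
  exact: measurableT_comp.
have g0 z : (0 <= (g z)%:E)%E.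
  rewrite lee_fin /g !indicE.
  have [/set_mem z1|] := boolP (z.1 \in D1); last by rewrite !mul0r.
  have [/set_mem z2|] := boolP (z.2 \in D2); last by rewrite mulr0 mul0r.
  by rewrite !mul1r f0.
have := @fubini_tonelli _ _ _ _ _ m1 m2 _ mg g0.
have E1 (x : T1) : ((fun x => \int[m2]_(y in D2) (f x y)%:E) \_ D1)%E x =
    (\int[m2]_y (g (x, y))%:E)%E.
  rewrite patchE /g/=; case: ifPn => xD1.
    rewrite integral_mkcond; apply: eq_integral => y _; rewrite patchE !indicE xD1.
    by case: ifPn => yD2; rewrite ?mul1r ?mul0r.
  rewrite integral0_eq// => y _; by rewrite indicE (negbTE xD1) !mul0r.
have E2 (y : T2) : ((fun y => \int[m1]_(x in D1) (f x y)%:E) \_ D2)%E y =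
    (\int[m1]_x (g (x, y))%:E)%E.
  rewrite patchE /g/=; case: ifPn => yD2.
    rewrite integral_mkcond; apply: eq_integral => x _; rewrite patchE !indicE yD2.
    by case: ifPn => xD1; rewrite ?mulr1 ?mul1r ?mul0r.
  rewrite integral0_eq// => x _; by rewrite !indicE (negbTE yD2) mulr0 mul0r.
rewrite [in X in _ -> X](integral_mkcond D1) [in X in _ -> _ = X](integral_mkcond D2).
move=> h; transitivity (\int[m1]_x \int[m2]_y (g (x, y))%:E)%E.
  by apply: eq_integral => x _; rewrite E1.
by rewrite h; apply: eq_integral => y _; rewrite E2.
Qed.

Section key_identity.
Context (R : realType) (nu : R).
Hypotheses (nu0 : 0 < nu) (nu1 : nu < 1).
Local Notation mu := (@lebesgue_measure R).

Let powRV_ (x r : R) : 0 < x -> (x^-1) `^ r = (x `^ r)^-1.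
Proof. by move=> x0; rewrite -(powR_inv1 (ltW x0)) -powRrM mulN1r powRN. Qed.

Let powRB1_ (x r : R) : 0 < x -> x `^ (r - 1) = x `^ r / x.
Proof.
move=> x0; have xn0 : x != 0 by rewrite gt_eqF.
by rewrite powRB ?xn0 ?implybT// powRr1// ltW.
Qed.

(* Substituting [tau = y / (w + y / t)] turns the kernel into a function of
   [w + y / t] times [w^(-nu)], and [e^(-v s) / s] is the integral of [e^(-a s)] over [a >= v]. *)
Lemma integral_kernel_expR (y v t : R) : 0 < y -> 0 < v -> 0 < t ->
  (\int[mu]_(tau in `]0%R, t[) (tau `^ (nu - 1) * (t - tau) `^ (- nu) *
      (y `^ (- nu) * expR (- (v * (y / tau)))))%:E =
   \int[mu]_(a in `[v, +oo[)
     ((t `^ (- nu) * (a `^ (nu - 1) * expR (- (a * (y / t)))))%:E * gammaE (1 - nu)))%E.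
Proof.
move=> y0 v0 t0.
have c0 : 0 < y / t by rewrite divr_gt0.
have sc (w : R) : 0 < w -> 0 < w + y / t by move=> w0; rewrite addr_gt0.
pose G tau : R := tau `^ (nu - 1) * (t - tau) `^ (- nu) *
  (y `^ (- nu) * expR (- (v * (y / tau)))).
transitivity (\int[mu]_(w in `]0%R, +oo[)
    (G (y / (w + y / t)) * - (- (y / (w + y / t) ^+ 2)))%:E)%E.
  apply: (@ge0_substitution_decreasing R (fun w => y / (w + y / t))
    (fun w => - (y / (w + y / t) ^+ 2)) G `]0%R, t[).
  - by move=> w w0; apply: is_derive_div_shift; rewrite gt_eqF ?sc.
  - by move=> w w0; rewrite oppr_le0 divr_ge0 ?exprn_ge0// ltW ?sc.
  - move=> w w0; apply: continuousN; apply: continuousM; first exact: cvg_cst.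
    apply: continuousV; first by rewrite expf_neq0 ?gt_eqF ?sc.
    apply: (continuous_comp (f := fun w => w + y / t) (g := fun z => z ^+ 2)).
      by apply: continuousD; [exact: cvg_id|exact: cvg_cst].
    exact: exprn_continuous.
  - move=> w w' w0 ww'; rewrite ltr_pM2l// ltf_pV2 ?posrE ?sc ?ltrD2r//.
    exact: lt_trans ww'.
  - move=> w w0; rewrite in_itv/= divr_gt0 ?sc//= ltr_pdivrMr ?sc//.
    by rewrite mulrDr mulrCA divff ?gt_eqF// mulr1 ltrDr mulr_gt0.
  - move=> tau; rewrite in_itv/= => /andP[tau0 taut].
    exists (y / tau - y / t); last first.
      by rewrite subrK invf_div mulrCA divff ?gt_eqF// mulr1.
    by rewrite subr_gt0 ltr_pM2l// ltf_pV2 ?posrE.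
  - move=> tau; rewrite in_itv/= => /andP[tau0 taut].
    apply: continuousM.
      apply: continuousM; first exact: (is_derive_continuous (is_derive_powR _ tau0)).
      apply: (continuous_comp (f := fun x => t - x) (g := fun x => x `^ (- nu))).
        by apply: continuousB; [exact: cvg_cst|exact: cvg_id].
      by apply: (is_derive_continuous (is_derive_powR _ _)); rewrite subr_gt0.
    apply: continuousM; first exact: cvg_cst.
    apply: continuous_comp; last exact: continuous_expR.
    apply: continuousN; apply: continuousM; first exact: cvg_cst.
    apply: continuousM; first exact: cvg_cst.
    by apply: continuousV; [rewrite gt_eqF|exact: cvg_id].
  - by move=> tau _; rewrite !mulr_ge0 ?powR_ge0 ?expR_ge0.
transitivity (\int[mu]_(w in `]0%R, +oo[) \int[mu]_(a in `[v, +oo[)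
   (t `^ (- nu) * (w `^ (- nu) * expR (- (a * (w + y / t)))))%:E)%E.
  apply: eq_integral => w; rewrite inE/= in_itv/= andbT => w0.
  have s0 := sc _ w0.
  under [RHS]eq_integral do rewrite mulrA EFinM.
  rewrite ge0_integralZl//; last 2 first.
  - apply/measurable_EFinP/measurable_funTS; apply: measurableT_comp => //.
    by apply: measurableT_comp => //; exact: measurable_funM.
  - by rewrite lee_fin mulr_ge0 ?powR_ge0.
  rewrite integral_expR_tail// -EFinM; congr EFin.
  rewrite /G; set s := w + y / t.
  have -> : t - y / s = t * w * s^-1.
    by rewrite /s; field; rewrite !gt_eqF//= addr_gt0// mulr_gt0.
  have sy : y / (y / s) = s by field; rewrite !gt_eqF.
  rewrite sy powRB1_ ?divr_gt0// !powRM ?mulr_ge0 ?invr_ge0 ?ltW//.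
  rewrite !powRV_// !powRN.
  have := powR_gt0 nu y0; have := powR_gt0 nu s0; have := powR_gt0 nu t0.
  have := powR_gt0 nu w0; set A := y `^ nu; set B := s `^ nu; set C := t `^ nu.
  by set E := w `^ nu => E0 C0 B0 A0; field; rewrite !gt_eqF.
rewrite tonelli_on//; last 2 first.
- apply: measurable_funM => //; apply: measurable_funM.
    by apply: (measurableT_comp (measurable_powR _)); exact: measurable_fst.
  apply: measurableT_comp => //; apply: measurableT_comp => //.
  by apply: measurable_funM => //; exact: measurable_funD.
- by move=> x z _ _; rewrite !mulr_ge0 ?powR_ge0 ?expR_ge0.
apply: eq_integral => a; rewrite inE/= in_itv/= andbT => va.
have a0 : 0 < a by exact: lt_le_trans va.
transitivity (\int[mu]_(w in `]0%R, +oo[)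
  ((t `^ (- nu) * expR (- (a * (y / t))))%:E *
   (w `^ ((1 - nu) - 1) * expR (- (a * w)))%:E))%E.
  apply: eq_integral => w _; rewrite -EFinM; congr EFin.
  rewrite (_ : 1 - nu - 1 = - nu); last by ring.
  by rewrite mulrDr opprD expRD; ring.
rewrite ge0_integralZl; last 4 first.
- by [].
- apply/measurable_EFinP/measurable_funTS; apply: measurable_funM.
    exact: measurable_powR.
  by apply: measurableT_comp => //; apply: measurableT_comp.
- by move=> x _; rewrite lee_fin mulr_ge0 ?powR_ge0 ?expR_ge0.
- by rewrite lee_fin mulr_ge0 ?powR_ge0 ?expR_ge0.
rewrite gammaE_scale// muleA; congr (_ * _)%E.
by rewrite -EFinM (_ : - (1 - nu) = nu - 1); [congr EFin; ring|ring].
Qed.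

(** * A variable with Laplace transform exp(- v^nu) *)

Context d (T : measurableType d) (P : probability T R) (Y : T -> R).
Hypotheses (mY : measurable_fun setT Y) (Y0 : forall w, 0 <= Y w).
Hypothesis lapY : forall v, 0 < v ->
  (\int[P]_w (expR (- (v * Y w)))%:E = (expR (- v `^ nu))%:E)%E.

(** P(Y = 0) is at most E[e^(-v Y)] = exp(- v^nu) for every v > 0. The choice v = n^(1/nu) gives the
    bound e^(-n). *)
Lemma stable_gt0 : P (Y @^-1` [set 0]) = 0%E.
Proof.
have mA : measurable (Y @^-1` [set 0]).
  by rewrite -[X in measurable X]setTI; exact: mY.
apply/eqP; rewrite -measure_le0.
have h n : (P (Y @^-1` [set 0%R]) <= (expR (- n%:R))%:E)%E.
  have [->|n0] := eqVneq n 0%N; first by rewrite oppr0 expR0 probability_le1.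
  have v0 : 0 < (n%:R `^ nu^-1 : R) by rewrite powR_gt0// ltr0n lt0n.
  have := lapY v0; rewrite -powRrM mulVf ?gt_eqF// powRr1// => <-.
  rewrite -[X in P X]setIT -integral_indic//; apply: ge0_le_integral => //.
  - by apply/measurable_EFinP.
  - apply/measurable_EFinP; apply: measurableT_comp => //.
    by apply: measurableT_comp => //; exact: measurable_funM.
  - move=> w _; rewrite lee_fin indicE.
    have [/set_mem/= ->|_] := boolP (w \in _); last exact: expR_ge0.
    by rewrite mulr0 oppr0 expR0.
apply/lee_addgt0Pr => e e0; rewrite add0e.
have /cvgrPdist_lt/(_ _ e0)[N _ hN] := @cvgn_expR R.
apply: (le_trans (h N)); rewrite lee_fin.
have := hN N (leqnn N); rewrite sub0r normrN ger0_norm ?expR_ge0//.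
exact: ltW.
Qed.

(** Density on the product space that turns the iterated integral of [key_identity] into a single
    weighted one, as [weighted_laplace_unique] requires. The indicator cuts tau down to []0, t[]. *)
Definition kernel_weight (t : R) (z : R * T) : R :=
  \1_`]0, t[%classic z.1 * (nu * (z.1 `^ (nu - 1) * (t - z.1) `^ (- nu) * (Y z.2) `^ (- nu))).

Lemma measurable_kernel_weight t : measurable_fun setT (kernel_weight t).
Proof.
apply: measurable_funM; first by apply: measurableT_comp.
apply: measurable_funM => //; apply: measurable_funM.
  apply: measurable_funM.
    by apply: (measurableT_comp (measurable_powR _)); exact: measurable_fst.
  apply: (measurableT_comp (measurable_powR _)).
  by apply: measurable_funB => //; exact: measurable_fst.
apply: (measurableT_comp (measurable_powR _)).
by apply: measurableT_comp => //; exact: measurable_snd.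
Qed.

Lemma kernel_weight_ge0 t z : 0 <= kernel_weight t z.
Proof. by rewrite /kernel_weight !mulr_ge0 ?powR_ge0 ?(ltW nu0)// indicE. Qed.

Lemma integral_kernel_weight (t : R) (g : R * T -> R) :
  measurable_fun setT g -> (forall z, 0 <= g z) ->
  (\int[mu \x P]_z (kernel_weight t z * g z)%:E =
   \int[mu]_(tau in `]0%R, t[) \int[P]_w (nu * (tau `^ (nu - 1) * (t - tau) `^ (- nu) *
      (Y w `^ (- nu) * g (tau, w))))%:E)%E.
Proof.
move=> mg g0.
rewrite fubini_tonelli1/=; last 2 first.
- by apply/measurable_EFinP/measurable_funM => //; exact: measurable_kernel_weight.
- by move=> z; rewrite lee_fin mulr_ge0 ?kernel_weight_ge0.
rewrite [RHS]integral_mkcond; apply: eq_integral => tau _.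
rewrite patchE /fubini_F /kernel_weight/=; case: ifPn => ht.
  by apply: eq_integral => w _; rewrite indicE ht mul1r; congr EFin; ring.
by rewrite integral0_eq// => w _; rewrite indicE (negbTE ht) !mul0r.
Qed.

Let G : R := fine (gammaE (1 - nu)).

Let GE : gammaE (1 - nu) = G%:E.
Proof.
have nu_le1 : 1 - nu <= 1 by rewrite lerBlDr lerDl ltW.
rewrite /G fineK// ge0_fin_numE; last exact/ltW/gammaE_gt0.
by apply: gammaE_lty => //; rewrite subr_gt0.
Qed.

Lemma fine_gammaE_gt0 : 0 < G.
Proof. by rewrite -lte_fin -GE; apply: gammaE_gt0; rewrite lerBlDr lerDl ltW. Qed.

(** After [integral_kernel_expR], only e^(-a Y / t) remains random, with a >= v. Its expectation is
    exp(- (a / t)^nu), and multiplied by nu a^(nu - 1) t^(-nu) this is an exact derivative in a. The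
    quotient Y / tau is written with the power -1 of |tau| so that it is nonnegative for all real
    tau. *)
Lemma kernel_laplace (t v : R) : 0 < t -> 0 < v ->
  (\int[mu \x P]_z (kernel_weight t z * expR (- (v * (Y z.2 * `|z.1| `^ (-1)))))%:E =
   (G * expR (- (v / t) `^ nu))%:E)%E.
Proof.
move=> t0 v0.
(* The substitution in tau needs Y > 0. Outside [D2] the integrand vanishes, because the power -nu
   of 0 is 0 by convention; later, [stable_gt0] allows the return to the full expectation. *)
pose D2 := Y @^-1` `]0, +oo[%classic.
have mD2 : measurable D2 by rewrite -[X in measurable X]setTI; exact: mY.
have mtau (z : R * T -> R) : measurable_fun setT z ->
    measurable_fun setT (fun x => `|z x| `^ (-1)).
  move=> mz; apply: (measurableT_comp (measurable_powR _)).
  exact: measurableT_comp.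
rewrite integral_kernel_weight; last 2 first.
- apply: measurableT_comp => //; apply: measurableT_comp => //.
  apply: measurable_funM => //; apply: measurable_funM.
    by apply: measurableT_comp => //; exact: measurable_snd.
  by apply: mtau; exact: measurable_fst.
- by move=> z; exact: expR_ge0.
pose f tau w : R := nu * (tau `^ (nu - 1) * (t - tau) `^ (- nu) *
  (Y w `^ (- nu) * expR (- (v * (Y w * `|tau| `^ (-1)))))).
transitivity (\int[mu]_(tau in `]0%R, t[) \int[P]_(w in D2) (f tau w)%:E)%E.
  apply: eq_integral => tau _; rewrite [RHS]integral_mkcond.
  apply: eq_integral => w _; rewrite patchE; case: ifPn => // wD2.
  have -> : Y w = 0.
    apply/eqP; rewrite eq_le Y0 andbT leNgt; apply: contra wD2 => Yw.
    by rewrite inE /D2/= in_itv/= Yw.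
  by rewrite powR0 ?mul0r ?mulr0// oppr_eq0 gt_eqF.
rewrite tonelli_on//; last 2 first.
- apply: measurable_funM => //; apply: measurable_funM.
    apply: measurable_funM.
      by apply: (measurableT_comp (measurable_powR _)); exact: measurable_fst.
    apply: (measurableT_comp (measurable_powR _)).
    by apply: measurable_funB => //; exact: measurable_fst.
  have mY2 : measurable_fun setT (fun z : R * T => Y z.2).
    by apply: measurableT_comp => //; exact: measurable_snd.
  apply: measurable_funM; first exact: (measurableT_comp (measurable_powR _)).
  apply: measurableT_comp => //; apply: measurableT_comp => //.
  apply: measurable_funM => //; apply: measurable_funM => //.
  by apply: mtau; exact: measurable_fst.
- by move=> tau w _ _; rewrite !mulr_ge0 ?powR_ge0 ?expR_ge0// ltW.
transitivity (\int[P]_(w in D2) \int[mu]_(a in `[v, +oo[)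
   (nu * G * (t `^ (- nu) * (a `^ (nu - 1) * expR (- (a * (Y w / t))))))%:E)%E.
  apply: eq_integral => w; rewrite inE/= /D2/= in_itv/= andbT => Yw.
  transitivity (nu%:E * \int[mu]_(tau in `]0%R, t[)
     (tau `^ (nu - 1) * (t - tau) `^ (- nu) *
      (Y w `^ (- nu) * expR (- (v * (Y w / tau)))))%:E)%E.
    transitivity (nu%:E * \int[mu]_(tau in `]0%R, t[)
       (tau `^ (nu - 1) * (t - tau) `^ (- nu) *
        (Y w `^ (- nu) * expR (- (v * (Y w * `|tau| `^ (-1))))))%:E)%E; last first.
      congr (_ * _)%E; apply: eq_integral => tau; rewrite inE/= in_itv/= => /andP[tau0 _].
      by rewrite ger0_norm ?ltW// powR_inv1// ltW.
    rewrite -ge0_integralZl//.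
    - apply/measurable_EFinP/measurable_funTS/measurable_funM.
        apply: measurable_funM; first exact: measurable_powR.
        apply: (measurableT_comp (measurable_powR _)).
        exact: measurable_funB.
      apply: measurable_funM => //; apply: measurableT_comp => //.
      apply: measurableT_comp => //; apply: measurable_funM => //.
      by apply: measurable_funM => //; apply: (measurableT_comp (measurable_powR _)).
    - by move=> tau _; rewrite lee_fin !mulr_ge0 ?powR_ge0 ?expR_ge0.
    - by rewrite lee_fin ltW.
  rewrite integral_kernel_expR//; under eq_integral do rewrite GE -EFinM.
  rewrite -ge0_integralZl//.
  - by apply: eq_integral => a _; rewrite -!EFinM; congr EFin; ring.
  - apply/measurable_EFinP/measurable_funTS/measurable_funM => //.
    apply: measurable_funM => //; apply: measurable_funM; first exact: measurable_powR.
    by apply: measurableT_comp => //; apply: measurableT_comp => //; exact: measurable_funM.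
  - move=> a _; rewrite lee_fin !mulr_ge0 ?powR_ge0 ?expR_ge0//.
    exact/ltW/fine_gammaE_gt0.
  - by rewrite lee_fin ltW.
rewrite tonelli_on//; last 2 first.
- apply: measurable_funM => //; apply: measurable_funM => //.
  apply: measurable_funM.
    by apply: (measurableT_comp (measurable_powR _)); exact: measurable_snd.
  apply: measurableT_comp => //; apply: measurableT_comp => //.
  apply: measurable_funM; first exact: measurable_snd.
  by apply: measurable_funM => //; apply: measurableT_comp => //; exact: measurable_fst.
- by move=> w a _ _; rewrite !mulr_ge0 ?powR_ge0 ?expR_ge0// ltW// fine_gammaE_gt0.
have lapD2 a : 0 < a -> (\int[P]_(w in D2) (expR (- (a * (Y w / t))))%:E =
    (expR (- (t `^ (- nu) * a `^ nu)))%:E)%E.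
  move=> a0; have at0 : 0 < a / t by rewrite divr_gt0.
  have me : measurable_fun setT (fun w => (expR (- (a / t * Y w)))%:E).
    apply/measurable_EFinP; apply: measurableT_comp => //.
    by apply: measurableT_comp => //; exact: measurable_funM.
  under eq_integral do rewrite mulrCA mulrC.
  have -> : D2 = setT `\` Y @^-1` [set 0].
    apply/seteqP; split => w; rewrite /D2 /= in_itv/= andbT.
      by move=> Yw; split => // Yw0; rewrite Yw0 ltxx in Yw.
    by move=> [_ /eqP Yw]; rewrite lt_neqAle eq_sym Yw Y0.
  rewrite -ge0_negligible_integral//; last 2 first.
  - by rewrite -[X in measurable X]setTI; exact: mY.
  - exact: stable_gt0.
  rewrite lapY//; congr (expR (- _))%:E.
  by rewrite powRM ?invr_ge0 ?ltW// powRV_// powRN mulrC.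
transitivity (\int[mu]_(a in `[v, +oo[) ((G * t `^ (- nu))%:E *
   (nu * a `^ (nu - 1) * expR (- (t `^ (- nu) * a `^ nu)))%:E))%E.
  apply: eq_integral => a; rewrite inE/= in_itv/= andbT => va.
  have a0 : 0 < a by exact: lt_le_trans va.
  transitivity (((nu * G * (t `^ (- nu) * (a `^ (nu - 1))))%:E *
    \int[P]_(w in D2) (expR (- (a * (Y w / t))))%:E))%E.
    rewrite -ge0_integralZl//.
    - by apply: eq_integral => w _; rewrite -EFinM; congr EFin; ring.
    - apply/measurable_EFinP/measurable_funTS; apply: measurableT_comp => //.
      by apply: measurableT_comp => //; apply: measurable_funM => //; exact: measurable_funM.
    - by rewrite lee_fin !mulr_ge0 ?powR_ge0// ltW// fine_gammaE_gt0.
  by rewrite lapD2// -!EFinM; congr EFin; ring.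
rewrite ge0_integralZl//; last 3 first.
- apply/measurable_EFinP/measurable_funTS/measurable_funM.
    by apply: measurable_funM => //; exact: measurable_powR.
  apply: measurableT_comp => //; apply: measurableT_comp => //.
  by apply: measurable_funM => //; exact: measurable_powR.
- by move=> a _; rewrite lee_fin !mulr_ge0 ?powR_ge0 ?expR_ge0// ltW.
- by rewrite lee_fin !mulr_ge0 ?powR_ge0// ltW// fine_gammaE_gt0.
have c0 : 0 < t `^ (- nu) by rewrite powR_gt0.
rewrite integral_expR_powR_tail// -EFinM; congr EFin.
have -> : (v / t) `^ nu = t `^ (- nu) * v `^ nu.
  by rewrite powRM ?invr_ge0 ?ltW// powRV_// powRN mulrC.
by field; rewrite gt_eqF.
Qed.

Lemma key_identity (t : R) (g : R -> R) : 0 < t ->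
  measurable_fun setT g -> (forall z, 0 <= g z) ->
  (\int[mu]_(tau in `]0%R, t[) \int[P]_w (nu * (tau `^ (nu - 1) * (t - tau) `^ (- nu) *
      (Y w `^ (- nu) * g (Y w / tau))))%:E = \int[P]_w (G * g (Y w / t))%:E)%E.
Proof.
move=> t0 mg g0.
have mY2 : measurable_fun setT (fun z : R * T => Y z.2).
  by apply: measurableT_comp => //; exact: measurable_snd.
have mZ2 : measurable_fun setT (fun z : R * T => Y z.2 * `|z.1| `^ (-1)).
  apply: measurable_funM => //; apply: (measurableT_comp (measurable_powR _)).
  by apply: measurableT_comp => //; exact: measurable_fst.
have lap1 v : 0 < v -> (\int[P]_w (G * expR (- (v * (Y w / t))))%:E =
    (G * expR (- (v / t) `^ nu))%:E)%E.
  move=> v0; rewrite EFinM -(lapY (divr_gt0 v0 t0)) -ge0_integralZl.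
  - by apply: eq_integral => w _; rewrite -EFinM; congr (_ * expR _)%:E; ring.
  - by [].
  - apply/measurable_EFinP; apply: measurableT_comp => //.
    by apply: measurableT_comp => //; exact: measurable_funM.
  - by move=> w _; rewrite lee_fin expR_ge0.
  - by rewrite lee_fin ltW// fine_gammaE_gt0.
have lap2 n : (\int[P]_w (cst G w * expR (- (n.+1%:R * (Y w / t))))%:E =
    \int[mu \x P]_z (kernel_weight t z * expR (- (n.+1%:R * (Y z.2 * `|z.1| `^ (-1)))))%:E)%E.
  by rewrite lap1// kernel_laplace.
have fin : (\int[P]_w (cst G w * expR (- (Y w / t)))%:E < +oo)%E.
  move: (lap1 1 ltr01); under [X in X = _ -> _]eq_integral do rewrite mul1r.
  by move=> ->; exact: ltry.
have Z10 w : 0 <= Y w / t by rewrite divr_ge0// ltW.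
have Z20 (z : R * T) : 0 <= Y z.2 * `|z.1| `^ (-1) by rewrite mulr_ge0 ?powR_ge0.
have G0 (w : T) : 0 <= cst G w by rewrite ltW// fine_gammaE_gt0.
have mZ1 : measurable_fun setT (fun w => Y w / t) by exact: measurable_funM.
rewrite (@weighted_laplace_unique R _ _ _ _ P (mu \x P)%E (cst G) (fun w => Y w / t)
  (kernel_weight t) (fun z => Y z.2 * `|z.1| `^ (-1)) (measurable_cst G) G0 mZ1 Z10
  (measurable_kernel_weight t) (kernel_weight_ge0 t) mZ2 Z20 fin lap2 _ mg g0).
rewrite integral_kernel_weight; [|exact: measurableT_comp|by move=> z; exact: g0].
apply: eq_integral => tau; rewrite inE/= in_itv/= => /andP[tau0 _].
by rewrite ger0_norm ?powR_inv1// ltW.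
Qed.

(** Take g = 1 and t = 1 in [key_identity]: the left side is E[Y^(-nu)] times the integral of [c],
    the right side is the finite number [G]. As [c] is at least [nu] on []0, 1[], nu E[Y^(-nu)] <=
    G. *)
Lemma stable_neg_moment_lty : (\int[P]_w (Y w `^ (- nu))%:E < +oo)%E.
Proof.
have := @key_identity 1 (cst 1) ltr01 (measurable_cst _) (fun=> ler01).
set E := (\int[P]_w (Y w `^ (- nu))%:E)%E.
have mYn : measurable_fun setT (fun w => (Y w `^ (- nu))%:E).
  by apply/measurable_EFinP; exact: (measurableT_comp (measurable_powR _)).
have -> : (\int[P]_w (G * cst 1 (Y w / 1))%:E = G%:E)%E.
  rewrite -[RHS]mule1 -(@probability_setT _ _ _ P) -integral_cst//.
  by apply: eq_integral => w _; rewrite mulr1.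
pose c (tau : R) : R := nu * (tau `^ (nu - 1) * (1 - tau) `^ (- nu)).
have c0 tau : 0 <= c tau by rewrite !mulr_ge0 ?powR_ge0// ltW.
have E0 : (0 <= E)%E by apply: integral_ge0 => w _; rewrite lee_fin powR_ge0.
have inner tau : (\int[P]_w (nu * (tau `^ (nu - 1) * (1 - tau) `^ (- nu) *
    (Y w `^ (- nu) * cst 1 (Y w / tau))))%:E = (c tau)%:E * E)%E.
  rewrite -ge0_integralZl//.
  - by apply: eq_integral => w _; rewrite -EFinM /c mulr1 !mulrA.
  - by move=> w _; rewrite lee_fin powR_ge0.
  - by rewrite lee_fin.
under eq_integral do rewrite inner; move=> h.
have : (nu%:E * E <= G%:E)%E.
  rewrite -h.
  apply: (@le_trans _ _ (\int[mu]_(tau in `]0%R, 1%R[) (nu%:E * E))%E).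
    rewrite integral_cst//= lebesgue_measure_itv/= lte_fin ltr01.
    by rewrite -EFinB subr0 mule1.
  apply: ge0_le_integral => //.
  - by move=> x _; rewrite mule_ge0 ?lee_fin// ltW.
  - apply: emeasurable_funM => //.
    apply/measurable_EFinP/measurable_funTS/measurable_funM => //.
    apply: measurable_funM; first exact: measurable_powR.
    by apply: (measurableT_comp (measurable_powR _)); exact: measurable_funB.
  - move=> tau /=; rewrite in_itv/= => /andP[tau0 tau1].
    rewrite lee_wpmul2r// lee_fin /c -[leLHS]mulr1 ler_wpM2l ?(ltW nu0)//.
    rewrite -[leLHS]mulr1 ler_pM//.
    + rewrite -[leLHS](powRr0 tau) ger_powR ?tau0 ?(ltW tau1)//.
      by rewrite subr_le0 ltW.
    + rewrite -[leLHS](powRr0 (1 - tau)) ger_powR ?subr_gt0 ?tau1/=//.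
        by rewrite lerBlDr lerDl ltW.
      by rewrite oppr_le0 ltW.
rewrite ltey; apply: contraTN => /eqP ->.
by rewrite gt0_muley ?lte_fin// -ltNge ltry.
Qed.

End key_identity.

(* Only from here on: [finmap] redefines [inE]. *)
From mathcomp Require Import finmap.

(** * Forward equation of a chain with bounded rates *)

Section esum_bounds.
Context (R : realType) (S : choiceType).
Implicit Types (a b : S -> R) (F : {fset S}).

Lemma ge_esum_fset a F : (forall z, 0 <= a z) ->
  ((\sum_(z <- F) a z)%:E <= \esum_(z in [set: S]) (a z)%:E)%E.
Proof.
move=> a0; apply: esum_ge; exists [set` F]; first by split.
by rewrite fsbig_finite//= set_fsetK sumEFin.
Qed.

(** Since [a] has total mass 1, the mass left outside [F] is known. This is what allows the
    Chapman-Kolmogorov sum to be truncated to finitely many intermediate states. *)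
Lemma esum_le_tail a b F (c : R) :
  (forall z, 0 <= a z) -> (forall z, 0 <= b z) -> 0 <= c ->
  (forall z, z \notin F -> b z <= c) ->
  \esum_(z in [set: S]) (a z)%:E = 1%E ->
  (\esum_(z in [set: S]) (a z * b z)%:E <=
   (\sum_(z <- F) a z * b z + c * (1 - \sum_(z <- F) a z))%:E)%E.
Proof.
move=> a0 b0 c0 bc a1.
have EF (f : S -> R) : (forall z, 0 <= f z) ->
    (\esum_(z in [set` F]) (f z)%:E = (\sum_(z <- F) f z)%:E)%E.
  move=> f0; rewrite esum_fset//; last by move=> z _; rewrite lee_fin.
  by rewrite fsbig_finite//= set_fsetK sumEFin.
have compl : (\esum_(z in ~` [set` F]) (a z)%:E = (1 - \sum_(z <- F) a z)%:E)%E.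
  move: a1; rewrite (esumID [set` F]); last by move=> z _; rewrite lee_fin.
  rewrite !setTI EF//.
  case: (\esum_(z in _) _)%E => [r|//|//].
  by rewrite -EFinD => -[<-]; rewrite addrAC subrr add0r.
rewrite (esumID [set` F]); last by move=> z _; rewrite lee_fin mulr_ge0.
rewrite !setTI EF; last by move=> z; rewrite mulr_ge0.
rewrite EFinD leeD2l// EFinM -compl.
apply: (@le_trans _ _ (\esum_(z in ~` [set` F]) (c%:E * (a z)%:E))%E).
  apply: le_esum => z zF; rewrite -EFinM lee_fin mulrC ler_wpM2r// bc//.
  exact/negP.
apply: ge_ereal_sup => _ [X XD <-].
rewrite -ge0_mule_fsumr; last by move=> z; rewrite lee_fin.
by rewrite lee_wpmul2l ?lee_fin//; apply: ereal_sup_ubound; exists X.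
Qed.

Lemma esum1_approx a (F0 : {fset S}) (e : R) : (forall z, 0 <= a z) ->
  \esum_(z in [set: S]) (a z)%:E = 1%E -> 0 < e ->
  exists2 F : {fset S}, (F0 `<=` F)%fset & 1 - e < \sum_(z <- F) a z.
Proof.
move=> a0 a1 e0.
have : ((1 - e)%:E < \esum_(z in [set: S]) (a z)%:E)%E.
  by rewrite a1 lte_fin ltrBlDr ltrDl.
move=> /ereal_sup_gt[_ [X [finX _] <-]].
rewrite fsbig_finite//= sumEFin lte_fin => hX.
exists (F0 `|` fset_set X)%fset; first exact: fsubsetUl.
apply: (lt_le_trans hX).
rewrite [leRHS](big_fsetID _ (fun z => z \in fset_set X))/=.
rewrite (_ : [fset z in _ | _]%fset = fset_set X); last first.
  by apply/fsetP => z; rewrite !inE; case: (z \in fset_set X); rewrite ?orbT ?andbF.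
by rewrite lerDl sumr_ge0.
Qed.

End esum_bounds.

Lemma cvgr_sum (R : realType) (T I : Type) (Fl : set_system T) {FF : Filter Fl}
    (r : seq I) (f : I -> T -> R) (l : I -> R) :
  (forall i, f i x @[x --> Fl] --> l i) ->
  \sum_(i <- r) f i x @[x --> Fl] --> \sum_(i <- r) l i.
Proof.
move=> fl; elim: r => [|i r ih].
  by rewrite big_nil; under eq_fun do rewrite big_nil; exact: cvg_cst.
rewrite big_cons; under eq_fun do rewrite big_cons.
by apply: cvgD => //; exact: fl.
Qed.

Section forward_equation.
Context (R : realType) (S : countType).
Variables (p : R -> S -> S -> R) (q : S -> S -> R) (theta : R).
Hypotheses (tp : transition_function p) (hr : has_rates p q).
Hypothesis theta_max : forall x, - generator q x x <= theta.

Lemma transition_le1 (t : R) x y : 0 <= t -> p t x y <= 1.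
Proof.
move=> t0; have p0 z : 0 <= p t x z by exact: transition_ge0.
have := @ge_esum_fset R S (p t x) [fset y]%fset p0.
by rewrite (transition_sum1 tp)// big_seq_fset1 lee_fin.
Qed.

Lemma transitionD_ge (s t : R) x y z : 0 <= s -> 0 <= t ->
  p s x z * p t z y <= p (s + t) x y.
Proof.
move=> s0 t0; have p0 u : 0 <= p s x u * p t u y.
  by rewrite mulr_ge0// transition_ge0.
have := @ge_esum_fset R S (fun u => p s x u * p t u y) [fset z]%fset p0.
by rewrite -(transitionD tp)// big_seq_fset1 lee_fin.
Qed.

Lemma transition_diag_expn (t : R) x n : 0 <= t -> p t x x ^+ n <= p (n%:R * t) x x.
Proof.
move=> t0; elim: n => [|n ih]; first by rewrite expr0 mul0r (transition0 tp) eqxx.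
rewrite exprSr -natr1 mulrDl mul1r.
apply: (le_trans _ (transitionD_ge x x x _ t0)); last by rewrite mulr_ge0.
by rewrite ler_wpM2r// transition_ge0.
Qed.

(** Staying in [x] at n intermediate times gives p_h(x, x) >= p_(h/n)(x, x)^n, so by Bernoulli 1 -
    p_h(x, x) <= n (1 - p_(h/n)(x, x)). The right side tends to h times the exit rate of [x]. *)
Lemma transition_diag_ge (h : R) x : 0 <= h -> 1 - p h x x <= theta * h.
Proof.
rewrite le_eqVlt => /predU1P[<-|h0].
  by rewrite (transition0 tp) eqxx subrr mulr0.
have hn0 n : 0 < h / n.+1%:R by rewrite divr_gt0.
have le n : 1 - p h x x <= - ((p (h / n.+1%:R) x x - p 0 x x) / (h / n.+1%:R)) * h.
  have -> : - ((p (h / n.+1%:R) x x - p 0 x x) / (h / n.+1%:R)) * h =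
      n.+1%:R * (1 - p (h / n.+1%:R) x x).
    have N0 : n.+1%:R != 0 :> R by rewrite pnatr_eq0.
    rewrite (transition0 tp) eqxx (_ : true%:R = 1 :> R)//; move: N0; set N := n.+1%:R => N0.
    by field; apply/andP; split => //; rewrite gt_eqF.
  have p01 : 0 <= 1 - p (h / n.+1%:R) x x <= 1.
    have p1 := transition_le1 x x (ltW (hn0 n)).
    have p0 := transition_ge0 tp x x (ltW (hn0 n)).
    by apply/andP; split; lra.
  have := transition_diag_expn x n.+1 (ltW (hn0 n)).
  rewrite mulrCA divff ?pnatr_eq0// mulr1 => hp.
  have := bernoulli_ineq n.+1 p01; rewrite subKr; lra.
have cv : - ((p (h / n.+1%:R) x x - p 0 x x) / (h / n.+1%:R)) * h @[n --> \oo] -->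
    - generator q x x * h.
  apply: cvgM; last exact: cvg_cst.
  apply: cvgN.
  have hrx : (p u x x - p 0 x x) / u @[u --> 0^'+] --> generator q x x.
    exact: hr.
  move/cvg_at_rightP : hrx; apply; split => //.
  rewrite -[X in _ --> X](mulr0 h); apply: cvgM; first exact: cvg_cst.
  exact: cvg_harmonic.
apply: (@le_trans _ _ (- generator q x x * h)); last by rewrite ler_wpM2r// ltW.
rewrite -(cvg_lim _ cv)//; apply: limr_ge; first by apply/cvg_ex; eexists; exact: cv.
exact: nearW.
Qed.

Lemma theta_ge0 (x : S) : 0 <= theta.
Proof.
have := transition_diag_ge x ler01; rewrite mulr1; apply: le_trans.
by rewrite subr_ge0 transition_le1.
Qed.

Lemma transition_offdiag_le (h : R) x y : 0 <= h -> x != y -> p h x y <= theta * h.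
Proof.
move=> h0 xy; apply: le_trans (transition_diag_ge x h0).
have := @ge_esum_fset R S (p h x) [fset x; y]%fset (fun z => transition_ge0 tp x z h0).
rewrite (transition_sum1 tp)// big_fsetU1/= ?inE// big_seq_fset1 lee_fin.
lra.
Qed.

(** A state outside [F] differs from [y], so it reaches [y] within time h with probability at most
    theta h. *)
Lemma transitionD_fset (s h : R) x y (F : {fset S}) : 0 <= s -> 0 <= h -> y \in F ->
  0 <= p (s + h) x y - \sum_(z <- F) p s x z * p h z y <=
    theta * h * (1 - \sum_(z <- F) p s x z).
Proof.
move=> s0 h0 yF.
have a0 z : 0 <= p s x z by exact: transition_ge0.
have b0 z : 0 <= p h z y by exact: transition_ge0.
apply/andP; split.
  rewrite subr_ge0 -lee_fin (transitionD tp)//; apply: ge_esum_fset => z.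
  exact: mulr_ge0.
rewrite lerBlDl -lee_fin (transitionD tp)//; apply: esum_le_tail => //.
- by rewrite mulr_ge0// (theta_ge0 x).
- move=> z zF; apply: transition_offdiag_le => //.
  by apply: contraNneq zF => ->.
- exact: (transition_sum1 tp).
Qed.

(** With [F] reduced to [y], the gain from other states is at most theta h (1 - p_s(x, y)) and the
    loss at most theta h p_s(x, y). *)
Lemma transition_lipschitz (s h : R) x y : 0 <= s -> 0 <= h ->
  `|p (s + h) x y - p s x y| <= theta * h.
Proof.
move=> s0 h0; have := @transitionD_fset s h x y [fset y]%fset s0 h0.
rewrite !inE eqxx !big_seq_fset1 => /(_ isT) /andP[h1 h2].
have := transition_diag_ge y h0.
have := transition_ge0 tp x y s0; have := transition_le1 x y s0.
have := transition_ge0 tp y y h0; have := transition_le1 y y h0.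
have := mulr_ge0 (theta_ge0 x) h0.
set a := p s x y in h1 h2 *; set b := p h y y in h1 h2 *; set c := theta * h in h2 *.
by move=> *; rewrite ler_norml; apply/andP; split; nra.
Qed.

(** * A target state with finitely many predecessors *)

Section column.
Variables (x y : S) (F0 : {fset S}).
Hypotheses (yF0 : y \in F0) (col : forall z, z \notin F0 -> generator q z y = 0).

Let D (t : R) : R := \sum_(z <- F0) p t x z * generator q z y.

(** Uniformity in [s] near [t] yields both one-sided derivatives: a left quotient at [t] is the
    right quotient at [s = t - k]. *)
Lemma forward_quotient (t e : R) : 0 <= t -> 0 < e ->
  \forall k \near 0^'+, forall s : R, 0 <= s -> `|s - t| <= k ->
    `|(p (s + k) x y - p s x y) / k - D t| <= e.
Proof.
move=> t0 e0.
have th0 : 0 <= theta := theta_ge0 x.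
(* Allowed missing mass: multiplied by theta it costs at most e / 4. The set [F] below enlarges [F0]
   to reach it; rates into [y] vanish outside [F0], so [D t] is unchanged. *)
have e40 : 0 < e / (4 * (theta + 1)) by rewrite divr_gt0// mulr_gt0// ltr_wpDl.
have [F F0F hF] := @esum1_approx R S (p t x) F0 _
  (fun z => transition_ge0 tp x z t0) (transition_sum1 tp x t0) e40.
have yF : y \in F by exact: (fsubsetP F0F).
pose r k z := (p k z y - p 0 z y) / k.
pose n : R := (size F)%:R.
have hsum : \forall k \near 0^'+, \sum_(z <- F) `|r k z - generator q z y| < e / 4.
  have : \sum_(z <- F) `|r k z - generator q z y| @[k --> 0^'+] --> (0 : R).
    rewrite -[X in _ --> X](_ : \sum_(z <- F) `|generator q z y - generator q z y| = 0); last first.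
      by rewrite big1// => z _; rewrite subrr normr0.
    apply: cvgr_sum => z; apply: cvg_norm; apply: cvgB; last exact: cvg_cst.
    exact: hr.
  move=> /cvgrPdist_lt/(_ (e / 4)); rewrite divr_gt0// => /(_ isT).
  apply: filterS => k; rewrite sub0r normrN ger0_norm//.
  by apply: sumr_ge0 => z _.
have DE : D t = \sum_(z <- F) p t x z * generator q z y.
  rewrite /D [RHS](big_fsetID _ (fun z => z \in F0))/=.
  rewrite [X in _ + X]big1_fset ?addr0; last first.
    by move=> z; rewrite !inE => /andP[_ zF0] _; rewrite col ?mulr0.
  apply: eq_fbigl => z; rewrite !inE andbC.
  by case: (boolP (z \in F0)) => //= zF0; rewrite (fsubsetP F0F).
near=> k => s s0 st.
have k0 : 0 < k by near: k; exact: nbhs_right_gt.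
(* The term n theta^2 k occurs twice in the final estimate and may cost e / 8 each time. *)
have kb : k < e / (8 * (n * theta ^+ 2 + 1)).
  near: k; apply: nbhs_right_lt; rewrite divr_gt0// mulr_gt0//.
  by rewrite ltr_wpDl// mulr_ge0// exprn_ge0.
have hk : \sum_(z <- F) `|r k z - generator q z y| < e / 4 by near: k.
have rb z : `|r k z| <= theta.
  rewrite /r normrM normfV (gtr0_norm k0) ler_pdivrMr//.
  by have := transition_lipschitz z y (lexx 0) (ltW k0); rewrite add0r.
have ab z : `|p s x z - p t x z| <= theta * k.
  have [ts|ts] := leP t s.
    have := transition_lipschitz x z t0 (_ : 0 <= s - t); rewrite subrKC subr_ge0 => /(_ ts).
    move=> /le_trans; apply; rewrite ler_wpM2l//.
    by rewrite (le_trans _ st)// ler_norm.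
  have := transition_lipschitz x z s0 (_ : 0 <= t - s); rewrite subrKC subr_ge0 => /(_ (ltW ts)).
  rewrite distrC => /le_trans; apply; rewrite ler_wpM2l//.
  by rewrite (le_trans _ st)// distrC ler_norm.
have sumle (f : S -> R) (c : R) : (forall z, `|f z| <= c) ->
    `|\sum_(z <- F) f z| <= n * c.
  move=> fc; apply: (le_trans (ler_norm_sum _ _ _)).
  apply: (@le_trans _ _ (\sum_(z <- F) c)); first exact: ler_sum.
  by rewrite big_const_seq count_predT iter_addr addr0 /n mulr_natl.
have psE : p s x y = \sum_(z <- F) p s x z * p 0 z y.
  rewrite (big_fsetD1 y)//= (transition0 tp) eqxx mulr1 big1_fset ?addr0// => z.
  by rewrite !inE => /andP[zy _] _; rewrite (transition0 tp) (negbTE zy) mulr0.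
have /andP[h1 h2] := transitionD_fset x s0 (ltW k0) yF.
(* Three errors: truncating the intermediate states to [F], replacing time [s] by [t], and replacing
   difference quotients at 0 by rates. *)
have E1 : (p (s + k) x y - p s x y) / k - D t =
    (p (s + k) x y - \sum_(z <- F) p s x z * p k z y) / k +
    \sum_(z <- F) (p s x z - p t x z) * r k z +
    \sum_(z <- F) p t x z * (r k z - generator q z y).
  have -> : \sum_(z <- F) (p s x z - p t x z) * r k z =
      (\sum_(z <- F) p s x z * p k z y - \sum_(z <- F) p s x z * p 0 z y) / k -
      \sum_(z <- F) p t x z * r k z.
    rewrite -sumrB mulr_suml -sumrB; apply: eq_bigr => z _.
    by rewrite /r; field; rewrite gt_eqF.
  have -> : \sum_(z <- F) p t x z * (r k z - generator q z y) =
      \sum_(z <- F) p t x z * r k z - D t.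
    by rewrite DE -sumrB; apply: eq_bigr => z _; rewrite mulrBr.
  by rewrite -psE; field; rewrite gt_eqF.
have B1 : `|(p (s + k) x y - \sum_(z <- F) p s x z * p k z y) / k| <=
    theta * (e / (4 * (theta + 1)) + n * (theta * k)).
  rewrite ger0_norm ?divr_ge0 ?(ltW k0)// ler_pdivrMr//.
  apply: (le_trans h2); rewrite -!mulrA ler_wpM2l// mulrC ler_wpM2r ?(ltW k0)//.
  have : `|\sum_(z <- F) (p s x z - p t x z)| <= n * (theta * k) by exact: sumle.
  rewrite sumrB ler_norml => /andP[h3 _].
  by move: hF h3; lra.
have B2 : `|\sum_(z <- F) (p s x z - p t x z) * r k z| <= n * (theta * k * theta).
  by apply: sumle => z; rewrite normrM ler_pM.
have B3 : `|\sum_(z <- F) p t x z * (r k z - generator q z y)| <= e / 4.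
  apply: (le_trans (ler_norm_sum _ _ _)); apply: le_trans (ltW hk).
  apply: ler_sum => z _; rewrite normrM ger0_norm ?transition_ge0//.
  by rewrite ler_piMl ?transition_le1.
rewrite E1 (le_trans (ler_normD _ _))// (le_trans (lerD (le_trans (ler_normD _ _) (lerD B1 B2)) B3))//.
have C1 : theta * (e / (4 * (theta + 1))) <= e / 4.
  rewrite mulrA ler_pdivrMr ?mulr_gt0 ?ltr_wpDl//.
  by have h5 := mulr_ge0 th0 (ltW e0); lra.
have C2 : n * theta ^+ 2 * k <= e / 8.
  have n0 : 0 <= n * theta ^+ 2 by rewrite mulr_ge0// exprn_ge0.
  move: kb; rewrite ltr_pdivlMr ?mulr_gt0 ?ltr_wpDl// => kb.
  by rewrite ler_pdivlMr//; move: k0 kb; set A := n * theta ^+ 2; nra.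
have -> : theta * (e / (4 * (theta + 1)) + n * (theta * k)) + n * (theta * k * theta) =
    theta * (e / (4 * (theta + 1))) + 2 * (n * theta ^+ 2 * k) by ring.
by lra.
Unshelve. all: by end_near. Qed.

Lemma forward_derive (t : R) : 0 < t -> is_derive t 1 (fun s => p s x y) (D t).
Proof.
move=> t0.
have cv : h^-1 *: (p (h + t) x y - p t x y) @[h --> 0^'] --> D t.
  apply/cvgrPdist_le => e e0.
  have := forward_quotient (ltW t0) e0.
  rewrite /at_right near_withinE => H.
  have N : `|h| @[h --> (0 : R)] --> (0 : R).
    by rewrite -[X in _ --> X](normr0 R); exact: cvg_norm.
  have {N}H := N _ H.
  have tn : \forall h \near (0 : R), `|h| < t.
    have : `|h| @[h --> (0 : R)] --> `|0 : R| by exact: cvg_norm.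
    by rewrite normr0 => /cvgr_lt; apply.
  near=> h.
  have h0 : h != 0 by near: h; exact: nbhs_dnbhs_neq.
  have ht : `|h| < t by near: h; exact: nbhs_dnbhs.
  have Hh : 0 < `|h| -> forall s : R, 0 <= s -> `|s - t| <= `|h| ->
      `|(p (s + `|h|) x y - p s x y) / `|h| - D t| <= e.
    by near: h; exact: nbhs_dnbhs.
  have {}Hh := Hh (_ : 0 < `|h|); rewrite normr_gt0 in Hh; have {}Hh := Hh h0.
  rewrite distrC /GRing.scale/= mulrC.
  have [hp|hn] := leP 0 h.
    have := Hh t (ltW t0); rewrite subrr normr0 normr_ge0 => /(_ isT).
    by rewrite (ger0_norm hp) [h + t]addrC.
  have := Hh (t + h); rewrite [t + h - t]addrC addKr lexx => /(_ _ isT).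
  rewrite (ltr0_norm hn) in ht *; rewrite addrK.
  rewrite invrN mulrN -mulNr opprB [t + h]addrC; apply.
  by move: ht; lra.
have cv1 : h^-1 *: (((fun s => p s x y) \o shift t) (h *: 1) - p t x y)
    @[h --> 0^'] --> D t.
  by under eq_fun do rewrite /= scaler1.
apply: DeriveDef; last exact/cvg_lim.
by apply/cvg_ex; exists (D t).
Unshelve. all: by end_near. Qed.

End column.

End forward_equation.

(** * Law of the inverse stable subordinator *)

(* [n.+2] rather than [n.+1] keeps the first term positive, as [sigma_scaling] requires. *)
Definition approx_below (R : realType) (s : R) (n : nat) : R := s * (1 - n.+2%:R^-1).

Section approx_below.
Context (R : realType) (s : R).
Hypothesis s0 : 0 < s.

Let inv01 n : 0 < (n.+2%:R^-1 : R) < 1.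
Proof. by rewrite invr_gt0 ltr0n/= invf_lt1// ltr1n. Qed.

Lemma approx_below_gt0 n : 0 < approx_below s n.
Proof. by rewrite mulr_gt0// subr_gt0; have /andP[] := inv01 n. Qed.

Lemma approx_below_lt n : approx_below s n < s.
Proof.
by rewrite -[ltRHS]mulr1 ltr_pM2l// ltrBlDr ltrDl; have /andP[] := inv01 n.
Qed.

Lemma approx_below_nondecreasing m n : (m <= n)%N -> approx_below s m <= approx_below s n.
Proof.
move=> mn; rewrite ler_pM2l// lerD2l lerN2 lef_pV2 ?posrE ?ltr0n//.
by rewrite ler_nat !ltnS.
Qed.

Lemma approx_below_ge u : u < s -> exists n, u <= approx_below s n.
Proof.
move=> us; exists (Num.truncn (s / (s - u))).
have su : 0 < s - u by rewrite subr_gt0.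
have := truncnS_gt (s / (s - u)); set N := Num.truncn _ => h.
have N0 : 0 < (N.+2%:R : R) by rewrite ltr0n.
rewrite /approx_below mulrBr mulr1 lerBrDr -lerBrDl ler_pdivrMr//.
rewrite mulrC -ler_pdivrMr//; apply: (le_trans (ltW h)).
by rewrite ler_nat.
Qed.

End approx_below.

Section stable_subordinator.
Context (R : realType) d (T : measurableType d) (P : probability T R).
Context (nu : R) (sigma : R -> T -> R).
Hypotheses (nu0 : 0 < nu) (nu1 : nu < 1).
Hypothesis hs : stable_subordinator P nu sigma.
Local Notation Y := (sigma 1).
Local Notation L := (inverse_process sigma).

Let sub : subordinator P sigma := hs.1.

Lemma sigma_ge0 t w : 0 <= t -> 0 <= sigma t w.
Proof.
move=> t0; rewrite -(subordinator0 sub w).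
exact: (subordinator_nondecreasing sub).
Qed.

Lemma sigma_measurable t : 0 <= t -> measurable_fun setT (sigma t).
Proof. exact: (subordinator_measurable sub). Qed.

Lemma measurable_sigma_le t x : 0 <= t -> measurable [set w | sigma t w <= x].
Proof.
move=> t0; rewrite (_ : [set _ | _] = setT `&` sigma t @^-1` `]-oo, x]%classic).
  exact: sigma_measurable.
by rewrite setTI; apply/seteqP; split => w /=; rewrite in_itv.
Qed.

Lemma sigma_laplace t v : 0 <= t -> 0 < v ->
  (\int[P]_w (expR (- (v * sigma t w)))%:E = (expR (- (t * v `^ nu)))%:E)%E.
Proof.
move=> t0 v0; have := hs.2 t v t0 v0; rewrite unlock mulNr => <-.
by apply: eq_integral => w _; rewrite mulNr.
Qed.

Lemma sigma1_laplace v : 0 < v ->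
  (\int[P]_w (expR (- (v * Y w)))%:E = (expR (- v `^ nu))%:E)%E.
Proof. by move=> v0; rewrite sigma_laplace// mul1r. Qed.

Lemma sigma1_eq0 : P (Y @^-1` [set 0]) = 0%E.
Proof.
apply: (@stable_gt0 R nu nu0 _ _ P Y); last exact: sigma1_laplace.
exact: sigma_measurable.
Qed.

(** Self-similarity at a single time: both variables have the Laplace transform exp(- s v^nu), and
    [weighted_laplace_unique] is applied to an indicator. *)
Lemma sigma_scaling (s x : R) : 0 < s ->
  P [set w | sigma s w <= x] = P [set w | s `^ nu^-1 * Y w <= x].
Proof.
move=> s0; have mY := sigma_measurable (@ler01 R).
have msig := sigma_measurable (ltW s0).
have c0 : 0 < s `^ nu^-1 by rewrite powR_gt0.
have mZ2 : measurable_fun setT (fun w => s `^ nu^-1 * Y w) by exact: measurable_funM.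
have lap n : (\int[P]_w (cst 1 w * expR (- (n.+1%:R * sigma s w)))%:E =
    \int[P]_w (cst 1 w * expR (- (n.+1%:R * (s `^ nu^-1 * Y w))))%:E)%E.
  under eq_integral do rewrite mul1r; under [RHS]eq_integral do rewrite mul1r mulrA.
  rewrite sigma_laplace ?ltW// sigma1_laplace ?mulr_gt0//.
  rewrite (powRM _ (ler0n _ _) (powR_ge0 _ _)) -powRrM (mulVf (lt0r_neq0 nu0)).
  by rewrite (powRr1 (ltW s0)) mulrC.
have fin : (\int[P]_w (cst 1%R w * expR (- sigma s w))%:E < +oo)%E.
  have := sigma_laplace (ltW s0) (@ltr01 R).
  under [X in X = _ -> _]eq_integral do rewrite mul1r.
  by under [X in _ -> (X < _)%E]eq_integral do rewrite mul1r; move=> ->; exact: ltry.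
have mI : measurable_fun setT (\1_`]-oo, x]%classic : R -> R) by [].
have I0 (z : R) : 0 <= \1_`]-oo, x]%classic z :> R by rewrite indicE.
have := @weighted_laplace_unique R _ _ _ _ P P (cst 1) (sigma s) (cst 1)
  (fun w => s `^ nu^-1 * Y w) (measurable_cst _) (fun=> ler01) msig
  (fun w => sigma_ge0 w (ltW s0)) (measurable_cst _) (fun=> ler01) mZ2
  (fun w => mulr_ge0 (ltW c0) (sigma_ge0 w ler01)) fin lap _ mI I0.
have E (Z : T -> R) : measurable_fun setT Z ->
    (\int[P]_w (cst 1 w * \1_`]-oo, x]%classic (Z w))%:E)%E = P [set w | Z w <= x].
  move=> mZ; have -> : [set w | Z w <= x] = Z @^-1` `]-oo, x]%classic.
    by apply/seteqP; split => w /=; rewrite in_itv.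
  have mpre : measurable (Z @^-1` `]-oo, x]%classic).
    by rewrite -[X in measurable X]setTI; exact: mZ.
  rewrite -[X in P X]setIT -integral_indic//.
  by apply: eq_integral => w _; rewrite mul1r.
by rewrite !E.
Qed.

Lemma sigma_eq0 (s : R) : 0 < s -> P [set w | sigma s w <= 0] = 0%E.
Proof.
move=> s0; rewrite sigma_scaling// -[RHS]sigma1_eq0; congr (P _).
have c0 : 0 < s `^ nu^-1 by rewrite powR_gt0.
apply/seteqP; split => w /=; last by move=> ->; rewrite mulr0.
rewrite pmulr_rle0// => Y0; apply/eqP; rewrite eq_le Y0.
exact: sigma_ge0.
Qed.

(** Here the path never exceeds [t], and the infimum defining [L t] takes its default value 0. The
    inversion formula has to exclude this event. *)
Definition bounded_path (t : R) : set T := \bigcap_n [set w | sigma n%:R w <= t].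

Lemma measurable_bounded_path t : measurable (bounded_path t).
Proof. by apply: bigcapT_measurable => n; exact: measurable_sigma_le. Qed.

(** Markov's inequality: P(sigma(n) <= t) <= e^t E[e^(- sigma(n))] = e^(t - n). *)
Lemma bounded_path_eq0 t : P (bounded_path t) = 0%E.
Proof.
apply/eqP; rewrite -measure_le0.
have h n : (P (bounded_path t) <= (expR (t - n%:R))%:E)%E.
  apply: (@le_trans _ _ (P [set w | sigma n%:R w <= t])).
    apply: le_measure; rewrite ?inE.
    - by apply/mem_set; exact: measurable_bounded_path.
    - by apply/mem_set; exact: measurable_sigma_le.
    - by move=> w /(_ n); apply.
  have -> : (expR (t - n%:R))%:E =
      (\int[P]_w ((expR t)%:E * (expR (- (1 * sigma n%:R w)))%:E))%E.
    rewrite ge0_integralZl//.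
    - by rewrite sigma_laplace// powR1 mulr1 -EFinM -expRD.
    - apply/measurable_EFinP; apply: measurableT_comp => //; apply: measurableT_comp => //.
      by apply: measurable_funM => //; exact: sigma_measurable.
  rewrite -[X in P X]setIT -integral_indic//; last exact: measurable_sigma_le.
  apply: ge0_le_integral => //.
  - by apply/measurable_EFinP; exact: measurable_indic (measurable_sigma_le _ _).
  - apply: measurable_funeM; apply/measurable_EFinP; apply: measurableT_comp => //.
    apply: measurableT_comp => //.
    by apply: measurable_funM => //; exact: sigma_measurable.
  - move=> w _; rewrite -EFinM -expRD lee_fin indicE.
    have [/set_mem/= h|_] := boolP (w \in _); last exact: expR_ge0.
    by rewrite -[leLHS]expR0 ler_expR mul1r subr_ge0.
apply/lee_addgt0Pr => e e0; rewrite add0e.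
have e1 : 0 < e / expR t by rewrite divr_gt0 ?expR_gt0.
have /cvgrPdist_lt/(_ _ e1)[N _ hN] := @cvgn_expR R.
apply: (le_trans (h N)); rewrite lee_fin expRD.
have := hN N (leqnn N); rewrite sub0r normrN ger0_norm ?expR_ge0//.
by rewrite ltr_pdivlMr ?expR_gt0// mulrC => /ltW.
Qed.

Lemma inverse_process_ge0 t w : 0 <= L t w.
Proof.
rewrite /inverse_process; set A := [set _ | _].
have [A0|A0] := eqVneq A set0; first by rewrite A0 inf0.
by apply: lb_le_inf; [exact/set0P|move=> u []].
Qed.

(* For [s <= 0] the left-hand side holds everywhere. *)
Lemma inverse_process_geE (t s : R) : 0 < s ->
  [set w | s <= L t w] =
  \bigcap_n [set w | sigma (approx_below s n) w <= t] `\` bounded_path t.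
Proof.
move=> s0; apply/seteqP; split => w /=;
  pose A := [set v : R | 0 <= v /\ t < sigma v w];
  have -> : L t w = inf A by [].
  move=> sL.
  have lbA : has_lbound A by exists 0 => u [].
  split.
    move=> n _ /=; rewrite leNgt; apply/negP => tn.
    have An : A (approx_below s n) by split => //; exact/ltW/approx_below_gt0.
    have := ge_inf lbA An; apply/negP; rewrite -ltNge.
    exact: lt_le_trans (approx_below_lt s0 n) sL.
  have [A0|/set0P[u [u0 tu]]] := eqVneq A set0.
    by move: sL; rewrite A0 inf0 leNgt s0.
  move=> /(_ (Num.truncn u).+1 I) /=; apply/negP; rewrite -ltNge.
  apply: (lt_le_trans tu); apply: (subordinator_nondecreasing sub) => //.
  exact/ltW/truncnS_gt.
move=> [hn hb]; apply: lb_le_inf.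
  apply: contrapT => nA; apply: hb => n _ /=; rewrite leNgt; apply/negP => tn.
  by apply: nA; exists n%:R; split.
move=> u [u0 tu]; rewrite leNgt; apply/negP => us.
have [n un] := approx_below_ge us.
have := hn n I; apply/negP; rewrite -ltNge; apply: (lt_le_trans tu).
exact: (subordinator_nondecreasing sub).
Qed.

(** Measurability in [T] is not enough: independence is available only for events generated by
    [sigma]. *)
Lemma inverse_process_sigma_algebra (t s : R) : 0 < s ->
  process_sigma_algebra measurable sigma [set w | s <= L t w].
Proof.
move=> s0; rewrite inverse_process_geE//.
have basic (u : R) : 0 <= u -> process_sigma_algebra measurable sigma [set w | sigma u w <= t].
  move=> u0; apply: sub_sigma_algebra; exists u, `]-oo, t]%classic; split => //.
(* Reads the generated sigma-algebra as the measurable sets of a type, so that the closure lemmas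
   for [measurable] apply. *)
pose S : set (set (g_sigma_algebraType [set A | exists u B,
  [/\ 0 <= u, measurable B & A = sigma u @^-1` B]])) := measurable.
rewrite -[X in X _]/S; apply: measurableD.
  by apply: bigcapT_measurable => n; apply: basic; exact/ltW/approx_below_gt0.
by apply: bigcapT_measurable => n; exact: basic.
Qed.

Lemma measurable_inverse_process_ge (t s : R) : measurable [set w | s <= L t w].
Proof.
have [s0|s0] := leP s 0.
  rewrite (_ : [set _ | _] = setT)//; apply/seteqP; split => // w _ /=.
  exact: le_trans (inverse_process_ge0 _ _).
rewrite inverse_process_geE//; apply: measurableD; last exact: measurable_bounded_path.
apply: bigcapT_measurable => n; apply: measurable_sigma_le.
exact/ltW/approx_below_gt0.
Qed.

Lemma measurable_inverse_process t : measurable_fun setT (L t).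
Proof.
move=> mT; apply: (measurability _ (RGenCInfty.measurableE R)) => //.
move=> _ [_ [s ->] <-]; rewrite setTI.
rewrite (_ : _ @^-1` _ = [set w | s <= L t w]); first exact: measurable_inverse_process_ge.
by apply/seteqP; split => w /=; rewrite in_itv/= andbT.
Qed.

Let measureD_null (A B : set T) : measurable A -> measurable B -> P B = 0%E ->
  P (A `\` B) = P A.
Proof.
move=> mA mB PB; rewrite measureD//; last exact: le_lt_trans (probability_le1 P mA) (ltry _).
suff AB : P (A `&` B) = 0%E by rewrite [X in (_ - X)%E]AB sube0.
exact: (subset_measure0 (measurableI _ _ mA mB) mB (@subIsetr _ _ _)).
Qed.

Let measurable_scaled_le c t : measurable [set w | c * Y w <= t].
Proof.
rewrite (_ : [set _ | _] = setT `&` (fun w => c * Y w) @^-1` `]-oo, t]%classic).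
  by apply: (measurable_funM (measurable_cst _) (sigma_measurable ler01)).
by rewrite setTI; apply/seteqP; split => w /=; rewrite in_itv.
Qed.

Let powR_scale_le (c y t : R) : 0 < c -> 0 < y -> 0 < t ->
  (c `^ nu^-1 * y <= t) = (c <= t `^ nu * y `^ (- nu)).
Proof.
move=> c0 y0 t0; have yn : 0 < y `^ nu by rewrite powR_gt0.
rewrite powRN ler_pdivlMr//.
have -> : c * y `^ nu = (c `^ nu^-1 * y) `^ nu.
  by rewrite powRM ?powR_ge0 ?ltW// -powRrM mulVf ?gt_eqF// powRr1 ?ltW.
have a0 : 0 <= c `^ nu^-1 * y by rewrite mulr_ge0 ?powR_ge0 ?ltW.
apply/idP/idP => [|h].
  by apply: ge0_ler_powR; rewrite ?nnegrE// ltW.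
rewrite leNgt; apply/negP => /gt0_ltr_powR.
move=> /(_ _ nu0); rewrite !nnegrE => /(_ (ltW t0) a0).
by rewrite ltNge h.
Qed.

(** When L(t) = s the value sigma(s) may already exceed t, so the inversion uses times increasing to
    s. Scaling matches only the laws at single times; nested events [F n] and [F' n] with equal
    probabilities have intersections of equal probability. The null events that remain are a bounded
    path and Y = 0. *)
Lemma inverse_process_tail (t s : R) : 0 < t -> 0 < s ->
  P [set w | s <= L t w] = P [set w | s <= t `^ nu * Y w `^ (- nu)].
Proof.
move=> t0 s0; have mY := sigma_measurable (@ler01 R).
have sn0 n : 0 < approx_below s n by exact: approx_below_gt0.
pose F n := [set w | sigma (approx_below s n) w <= t].
pose F' n := [set w | approx_below s n `^ nu^-1 * Y w <= t].
have mF n : measurable (F n) by exact/measurable_sigma_le/ltW.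
have mF' n : measurable (F' n) by exact: measurable_scaled_le.
have FF' n : P (F n) = P (F' n) by exact: sigma_scaling.
have mcF : measurable (\bigcap_n F n) by exact: bigcapT_measurable.
have mcF' : measurable (\bigcap_n F' n) by exact: bigcapT_measurable.
have nF : nonincreasing_seq F.
  move=> m n mn; apply/subsetPset => w; apply: le_trans.
  apply: (subordinator_nondecreasing sub); first exact: ltW.
  exact: approx_below_nondecreasing.
have nF' : nonincreasing_seq F'.
  move=> m n mn; apply/subsetPset => w; apply: le_trans.
  apply: ler_wpM2r; first exact: sigma_ge0.
  apply: ge0_ler_powR; rewrite ?nnegrE ?invr_ge0; [exact: ltW|exact: ltW|exact: ltW|].
  exact: approx_below_nondecreasing.
have fin A : measurable A -> (P A < +oo)%E.
  by move=> mA; exact: le_lt_trans (probability_le1 P mA) (ltry _).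
have ePF : P (\bigcap_n F n) = P (\bigcap_n F' n).
  have /cvg_lim <- // := nonincreasing_cvg_mu (fin _ (mF 0%N)) mF mcF nF.
  have /cvg_lim <- // := nonincreasing_cvg_mu (fin _ (mF' 0%N)) mF' mcF' nF'.
  suff -> : P \o F = P \o F' by [].
  by apply/funext => n /=; exact: FF'.
rewrite inverse_process_geE// measureD_null//; last 2 first.
  exact: measurable_bounded_path.
  exact: bounded_path_eq0.
rewrite ePF -(measureD_null mcF' _ sigma1_eq0); last first.
  by rewrite -[X in measurable X]setTI; exact: mY.
congr (P _); apply/seteqP; split => w /=.
  move=> [hF Y0]; have {}Y0 : 0 < Y w by rewrite lt0r sigma_ge0// andbT; exact/eqP.
  rewrite leNgt; apply/negP => /midf_lt[h1 h2].
  have [n hn] := approx_below_ge h2.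
  have := hF n I; rewrite /F' /= powR_scale_le// => /(le_trans hn).
  by apply/negP; rewrite -ltNge.
move=> hs0; have Y0 : Y w != 0.
  apply/eqP => Y0; move: hs0; rewrite Y0 powR0 ?oppr_eq0 ?gt_eqF// mulr0.
  by rewrite leNgt s0.
split => [n _|]; last exact/eqP.
rewrite /F'/= powR_scale_le//; last by rewrite lt0r Y0 sigma_ge0.
exact: le_trans (ltW (approx_below_lt s0 n)) hs0.
Qed.

Lemma integral_inverse_process (t : R) (g : R -> R) : 0 < t ->
  measurable_fun setT g -> (forall z, 0 <= g z) ->
  (\int[P]_w (g (L t w))%:E = \int[P]_w (g (t `^ nu * Y w `^ (- nu))%R)%:E)%E.
Proof.
move=> t0 mg g0; pose Z2 w := t `^ nu * Y w `^ (- nu).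
have mZ1 := measurable_inverse_process t.
have mZ2 : measurable_fun setT Z2.
  apply: measurable_funM => //; apply: (measurableT_comp (measurable_powR _)).
  exact: sigma_measurable.
have one0 (w : T) : 0 <= cst 1 w :> R by exact: ler01.
have m1 : measurable_fun setT (cst 1 : T -> R) by exact: measurable_cst.
pose law (Z : T -> R) (mZ : measurable_fun setT Z) := weighted_measure P m1 one0 mZ.
have lawE Z mZ A : measurable A -> law Z mZ A = P (Z @^-1` A).
  move=> mA; rewrite /law/= /weighted_distribution.
  transitivity (\int[P]_(w in Z @^-1` A) cst 1%E w)%E; first by [].
  by rewrite integral_cst ?mul1e// -[X in measurable X]setTI; exact: mZ.
have intE Z mZ : (\int[law Z mZ]_z (g z)%:E = \int[P]_w (g (Z w))%:E)%E.
  rewrite ge0_integral_weighted_measure//.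
  by apply: eq_integral => w _; rewrite mul1r.
rewrite -(intE _ mZ1) -(intE _ mZ2).
apply: eq_measure_integral => A mA _.
have half (x : R) : P (L t @^-1` `[x, +oo[%classic) = P (Z2 @^-1` `[x, +oo[%classic).
  have pre (Z : T -> R) : Z @^-1` `[x, +oo[%classic = [set w | x <= Z w].
    by apply/seteqP; split => w /=; rewrite in_itv/= andbT.
  rewrite !pre; have [x0|x0] := leP x 0; last exact: inverse_process_tail.
  congr (P _); apply/seteqP; split => w _ /=; apply: (le_trans x0).
    by rewrite mulr_ge0 ?powR_ge0.
  exact: inverse_process_ge0.
apply: (measure_unique (@RGenCInfty.G R) (fun n => `[(- n%:R), +oo[%classic)) => //.
- exact: RGenCInfty.measurableE.
- move=> _ _ [x ->] [y ->]; exists (Num.max x y).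
  apply/seteqP; split => z /=; rewrite !in_itv/= !andbT ge_max.
    by move=> [-> ->].
  by move=> /andP.
- by move=> n; exists (- n%:R).
- apply/seteqP; split => // z _; exists (Num.truncn `|z|).+1 => //=.
  rewrite in_itv/= andbT; have := truncnS_gt `|z|.
  by rewrite ltr_norml => /andP[/ltW].
- by move=> _ [x ->]; rewrite !lawE//; exact: half.
- move=> n; rewrite lawE//; apply: le_lt_trans (ltry 1); apply: probability_le1.
  by rewrite -[X in measurable X]setTI; exact: mZ1.
Qed.

(** Almost surely [sigma] is positive at every time 1 / (n + 1), so the infimum defining [L 0] is at
    most each of these times. *)
Lemma inverse_process0 : {ae P, forall w, L 0 w = 0}.
Proof.
exists (\bigcup_n [set w | sigma (n.+1%:R^-1) w <= 0]); split.
- by apply: bigcupT_measurable => n; apply: measurable_sigma_le.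
- apply/negligibleP; first by apply: bigcupT_measurable => n; exact: measurable_sigma_le.
  apply: negligible_bigcup => n; apply/negligibleP; first exact: measurable_sigma_le.
  exact: sigma_eq0.
- move=> w /= Lw; apply: contrapT => nw; apply: Lw.
  have pos n : 0 < sigma (n.+1%:R^-1) w.
    by rewrite ltNge; apply/negP => h; apply: nw; exists n.
  apply/eqP; rewrite eq_le inverse_process_ge0 andbT.
  apply/ler_addgt0Pr => e e0; rewrite add0r.
  pose A := [set v : R | 0 <= v /\ 0 < sigma v w].
  have -> : L 0 w = inf A by [].
  have lbA : has_lbound A by exists 0 => u [].
  have An : A ((Num.truncn e^-1).+1%:R^-1) by split => //; rewrite invr_ge0.
  apply: (le_trans (ge_inf lbA An)).
  by rewrite -[leRHS]invrK lef_pV2 ?posrE ?invr_gt0//; exact/ltW/truncnS_gt.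
Qed.

End stable_subordinator.

(** * Markov chain at an independent random time *)

Section random_time.
Context (R : realType) d (T : measurableType d) (P : probability T R).
Context (S : countType) (X : R -> T -> S) (V : T -> R).
Hypothesis mX : forall (t : R) x, 0 <= t -> measurable (X t @^-1` [set x]).
Hypothesis rX : forall w (t : R), 0 <= t -> \forall u \near t^'+, X u w = X t w.
Hypotheses (mV : measurable_fun setT V) (V0 : forall w, 0 <= V w).

Definition grid_index n w := Num.truncn (n.+1%:R * V w).

(** The least multiple of 1 / (n + 1) strictly above [V w]. It lies strictly above because the paths
    of [X] are known to be constant only to the right of each time. *)
Definition upper_grid n w : R := (grid_index n w).+1%:R / n.+1%:R.

Let cell n j := [set w | grid_index n w = j].

Let cellE n j : cell n j = [set w | j%:R / n.+1%:R <= V w < j.+1%:R / n.+1%:R].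
Proof.
have n0 : 0 < (n.+1%:R : R) by rewrite ltr0n.
apply/seteqP; split => w; rewrite /cell/= /grid_index ler_pdivrMr// ltr_pdivlMr//.
  by move=> <-; rewrite mulrC; apply: truncn_itv; rewrite mulr_ge0.
by rewrite mulrC => h; apply/eqP; rewrite truncn_eq// mulr_ge0.
Qed.

Let measurable_cell n j : measurable (cell n j).
Proof.
rewrite cellE (_ : [set _ | _] = V @^-1` `[j%:R / n.+1%:R, j.+1%:R / n.+1%:R[%classic).
  by rewrite -[X in measurable X]setTI; exact: mV.
by apply/seteqP; split => w /=; rewrite in_itv.
Qed.

Let cell_cover n : \bigcup_j cell n j = setT.
Proof. by apply/seteqP; split => // w _; exists (grid_index n w). Qed.

Let cell_trivIset n (B : nat -> set T) : trivIset setT (fun j => cell n j `&` B j).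
Proof. by move=> i j _ _ [w [[/= <- _] [/= <-]]]. Qed.

Let node (n j : nat) : R := j.+1%:R / n.+1%:R.

Let node_ge0 n j : 0 <= node n j. Proof. by rewrite divr_ge0. Qed.

Lemma upper_grid_gt n w : V w < upper_grid n w.
Proof. by have : cell n (grid_index n w) w by []; rewrite cellE => /andP[]. Qed.

Lemma upper_grid_le n w : upper_grid n w <= V w + n.+1%:R^-1.
Proof.
have : cell n (grid_index n w) w by []; rewrite cellE => /= /andP[h _].
by rewrite /upper_grid -natr1 mulrDl mul1r lerD2r.
Qed.

Lemma upper_grid_cvg w : upper_grid n w @[n --> \oo] --> V w.
Proof.
apply: (@squeeze_cvgr _ _ _ _ (fun=> V w) (fun n => V w + n.+1%:R^-1)).
- by apply: nearW => n; rewrite upper_grid_le ltW// upper_grid_gt.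
- exact: cvg_cst.
- rewrite -[X in _ --> X]addr0; apply: cvgD; first exact: cvg_cst.
  exact: cvg_harmonic.
Qed.

Lemma near_upper_grid w (A : R -> Prop) : (\forall u \near (V w)^'+, A u) ->
  \forall n \near \oo, A (upper_grid n w).
Proof.
move=> h; have : \forall n \near \oo, V w < upper_grid n w -> A (upper_grid n w).
  exact: upper_grid_cvg h.
apply: filterS => n; apply.
exact: upper_grid_gt.
Qed.

Lemma measurable_upper_grid n : measurable_fun setT (upper_grid n).
Proof.
rewrite -(cell_cover n); apply/measurable_fun_bigcup => // j.
apply: (eq_measurable_fun (cst (node n j))); last exact: measurable_cst.
by move=> w /set_mem/= h; rewrite /upper_grid h.
Qed.

Let grid_setE n x : [set w | X (upper_grid n w) w = x] =
  \bigcup_j (cell n j `&` X (node n j) @^-1` [set x]).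
Proof.
apply/seteqP; split => w /=.
  by move=> h; exists (grid_index n w).
by move=> [j _ [/= jn h]]; rewrite /upper_grid jn.
Qed.

Let measurable_grid_set n x : measurable [set w | X (upper_grid n w) w = x].
Proof.
rewrite grid_setE; apply: bigcupT_measurable => j; apply: measurableI => //.
exact: mX.
Qed.

(** Along the grid times above [V w] the path eventually takes the value at [V w], so the event is a
    lower limit of events that involve countably many fixed times. *)
Lemma measurable_time_change x : measurable [set w | X (V w) w = x].
Proof.
rewrite (_ : [set _ | _] =
    \bigcup_N \bigcap_(n in [set n | (N <= n)%N]) [set w | X (upper_grid n w) w = x]).
  by apply: bigcupT_measurable => N; apply: bigcap_measurableType.
apply/seteqP; split => w /=.
  have [N _ hN] := near_upper_grid (rX w (V0 w)).
  by move=> <-; exists N => // n /= Nn; exact: hN.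
move=> [M _ hM]; have [N _ hN] := near_upper_grid (rX w (V0 w)).
by rewrite -(hN (maxn M N)) /= ?leq_maxr//; apply: hM; exact: leq_maxl.
Qed.

(** On each cell the grid time is a constant, so independence and the law at fixed times give the
    formula for [upper_grid n] after summing over cells. Dominated convergence on both sides does
    the rest. *)
Lemma random_time_law (B : set T) (x : S) (f : R -> R) (c : R) :
  measurable B -> continuous f -> (forall s, 0 <= f s <= 1) ->
  (forall s : R, 0 <= s -> P (B `&` X s @^-1` [set x]) = (c * f s)%:E) ->
  (forall a b s : R, 0 <= a -> a < b -> 0 <= s ->
     P ([set w | a <= V w < b] `&` (B `&` X s @^-1` [set x])) =
     (P [set w | (a <= V w < b)%R] * P (B `&` X s @^-1` [set x]))%E) ->
  P (B `&` [set w | X (V w) w = x]) = (c%:E * \int[P]_w (f (V w))%:E)%E.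
Proof.
move=> mB cf f01 law ind.
have mf : measurable_fun setT f by exact: continuous_measurable_fun.
have approx n : P (B `&` [set w | X (upper_grid n w) w = x]) =
    (c%:E * \int[P]_w (f (upper_grid n w))%:E)%E.
  have -> : B `&` [set w | X (upper_grid n w) w = x] =
      \bigcup_j (cell n j `&` (B `&` X (node n j) @^-1` [set x])).
    rewrite grid_setE setI_bigcupr; apply: eq_bigcupr => j _.
    by rewrite setICA.
  rewrite measure_bigcup; last 2 first.
    by move=> j _; apply: measurableI => //; apply: measurableI => //; exact: mX.
    exact: cell_trivIset.
  rewrite -(cell_cover n) ge0_integral_bigcup//; last 3 first.
  - apply/measurable_EFinP; apply: (measurable_funS measurableT) => //.
    exact: (measurableT_comp mf (measurable_upper_grid n)).
  - by move=> w _; rewrite lee_fin; case/andP: (f01 (upper_grid n w)).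
  - by have := @cell_trivIset n (fun=> setT); under eq_fun do rewrite setIT.
  rewrite -nneseriesZl//; last first.
    by move=> j _; apply: integral_ge0 => w _; rewrite lee_fin; case/andP: (f01 (upper_grid n w)).
  under eq_eseriesl do rewrite in_setT.
  apply: eq_eseriesr => j _.
  transitivity (P (cell n j) * P (B `&` X (node n j) @^-1` [set x]))%E.
    rewrite cellE; apply: ind => //.
    by rewrite ltr_pM2r ?invr_gt0// ltr_nat.
  rewrite law//; transitivity (c%:E * \int[P]_(w in cell n j) (cst (f (node n j))%:E w))%E.
    by rewrite integral_cst// EFinM muleC muleA.
  congr (_ * _)%E; apply: eq_integral => w /set_mem/= h.
  by rewrite /upper_grid h.
have lim1 : P (B `&` [set w | X (upper_grid n w) w = x]) @[n --> \oo] -->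
    P (B `&` [set w | X (V w) w = x]).
  have E (A : set T) : measurable A -> P (B `&` A) = (\int[P]_(w in B) (\1_A w)%:E)%E.
    by move=> mA; rewrite integral_indic// setIC.
  rewrite E; last exact: measurable_time_change.
  under eq_fun do rewrite E//.
  apply: (@dominated_cvg _ _ _ P B mB _ _ (cst 1%E)) => //.
  - by move=> n; apply/measurable_EFinP; exact: measurable_indic.
  - move=> w _; apply: cvg_near_cst.
    apply: filterS (near_upper_grid (rX w (V0 w))) => n h.
    congr EFin; rewrite !indicE; congr (_%:R); congr nat_of_bool.
    by apply/idP/idP => /set_mem/= hx; apply/mem_set => /=; congruence.
  - by apply: finite_measure_integrable_cst.
  - by move=> n w _; rewrite lee_fin indicE; case: (_ \in _); rewrite ?normr1 ?normr0.
have lim2 : (\int[P]_w (f (upper_grid n w))%:E)%E @[n --> \oo] --> (\int[P]_w (f (V w))%:E)%E.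
  apply: (@dominated_cvg _ _ _ P setT measurableT _ _ (cst 1%E)) => //.
  - move=> n; apply/measurable_EFinP.
    exact: (measurableT_comp mf (measurable_upper_grid n)).
  - move=> w _; apply: cvg_EFin; first exact: nearW.
    by apply: continuous_cvg; [exact: cf|exact: upper_grid_cvg].
  - by apply: finite_measure_integrable_cst.
  - by move=> n w _; rewrite lee_fin ger0_norm; case/andP: (f01 (upper_grid n w)).
have /cvg_lim <- // := lim1; apply/cvg_lim => //.
under eq_fun do rewrite approx.
by apply: cvgeZl.
Qed.

End random_time.

(** * Caputo derivative of a subordinated function *)

Section subordinated_caputo.
Context (R : realType) (nu : R).
Hypotheses (nu0 : 0 < nu) (nu1 : nu < 1).
Context d (T : measurableType d) (P : probability T R) (Y : T -> R).
Hypotheses (mY : measurable_fun setT Y) (Y0 : forall w, 0 <= Y w).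
Hypothesis lapY : forall v : R, 0 < v ->
  (\int[P]_w (expR (- (v * Y w)))%:E = (expR (- v `^ nu))%:E)%E.
Local Notation mu := (@lebesgue_measure R).
Local Notation G := (fine (gammaE (1 - nu))).

Let M w := Y w `^ (- nu).

Let M0 w : 0 <= M w. Proof. exact: powR_ge0. Qed.

Let mM : measurable_fun setT M.
Proof. exact: (measurableT_comp (measurable_powR _)). Qed.

Let bounded_integrable (f : T -> R) (C : R) : measurable_fun setT f ->
  (forall w, `|f w| <= C) -> P.-integrable setT (EFin \o f).
Proof.
move=> mf fC; apply: (finite_integrable_bounded _ mf fC).
by rewrite [X in (X < _)%E](@probability_setT _ _ _ P) ltry.
Qed.

Let intM : P.-integrable setT (EFin \o M).
Proof.
apply/integrableP; split; first exact/measurable_EFinP.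
under eq_integral do rewrite /= ger0_norm//.
have := stable_neg_moment_lty nu0 nu1 mY Y0 lapY.
by [].
Qed.

Let kernel t (tau : R) : R := nu * (tau `^ (nu - 1) * (t - tau) `^ (- nu)).

Let kernel_ge0 t tau : 0 <= kernel t tau.
Proof. by rewrite !mulr_ge0 ?powR_ge0// ltW. Qed.

Let measurable_kernel t : measurable_fun setT (kernel t).
Proof.
apply: measurable_funM => //; apply: measurable_funM; first exact: measurable_powR.
by apply: (measurableT_comp (measurable_powR _)); exact: measurable_funB.
Qed.

Section bounded_weight.
Context (g : R -> R) (C : R).
Hypotheses (mg : measurable_fun setT g) (g0 : forall s, 0 <= g s) (gC : forall s, g s <= C).

Let h (tau : R) : \bar R := (\int[P]_w (M w * g (tau `^ nu * M w))%:E)%E.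

Let mMg : measurable_fun setT (fun z : R * T => M z.2 * g (z.1 `^ nu * M z.2)).
Proof.
have mM2 : measurable_fun setT (fun z : R * T => M z.2).
  by apply: measurableT_comp => //; exact: measurable_snd.
apply: measurable_funM => //; apply: (measurableT_comp mg); apply: measurable_funM => //.
apply: (measurableT_comp (measurable_powR _)); exact: measurable_fst.
Qed.

Let mMg1 tau : measurable_fun setT (fun w => M w * g (tau `^ nu * M w)).
Proof.
by apply: measurable_funM => //; apply: (measurableT_comp mg); exact: measurable_funM.
Qed.

Lemma integrable_moment tau :
  P.-integrable setT (EFin \o (fun w => M w * g (tau `^ nu * M w))).
Proof.
have intCM : P.-integrable setT (fun w => (C%:E * (M w)%:E)%E).
    exact: (integrableZl measurableT C intM).
apply: (le_integrable measurableT _ _ intCM).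
  by apply/measurable_EFinP; exact: mMg1.
move=> w _ /=; rewrite lee_fin !ger0_norm ?mulr_ge0//; last exact: le_trans (g0 0) (gC 0).
by rewrite mulrC ler_wpM2r.
Qed.

Let hE tau : h tau = (\int[P]_w (M w * g (tau `^ nu * M w)))%:E.
Proof. by rewrite /Rintegral fineK//; exact: (integrable_fin_num _ (integrable_moment tau)). Qed.

Let measurable_h : measurable_fun setT h.
Proof.
apply: (@measurable_fun_fubini_tonelli_F _ _ _ _ _ P
  (fun z : R * T => (M z.2 * g (z.1 `^ nu * M z.2))%:E)).
  exact/measurable_EFinP.
by move=> z; rewrite lee_fin mulr_ge0.
Qed.

(** This is [key_identity] for the function y -> g(y^(-nu)), read in the reals. Finiteness of its
    right side provides the integrability. *)
Lemma integrable_kernel_moment (t : R) : 0 < t ->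
  mu.-integrable `]0, t[ (fun tau => (kernel t tau *
    \int[P]_w (M w * g (tau `^ nu * M w)))%:E) /\
  \int[mu]_(tau in `]0, t[) (kernel t tau * \int[P]_w (M w * g (tau `^ nu * M w))) =
    G * \int[P]_w g (t `^ nu * M w).
Proof.
move=> t0.
have mg' : measurable_fun setT (fun y => g (y `^ (- nu))).
  by apply: (measurableT_comp mg); exact: measurable_powR.
have div w (tau : R) : 0 < tau -> (Y w / tau) `^ (- nu) = tau `^ nu * M w.
  move=> tau0; rewrite powRM//; last by rewrite invr_ge0 ltW.
  rewrite mulrC; congr (_ * _).
  by rewrite -powR_inv1 ?ltW// -powRrM mulrNN mul1r.
have := key_identity nu0 nu1 mY Y0 lapY t0 mg' (fun z => g0 (z `^ (- nu))).
have -> : (\int[P]_w (G * g ((Y w / t) `^ (- nu)))%:E =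
    (G * \int[P]_w g (t `^ nu * M w))%:E)%E.
  have ig : P.-integrable setT (EFin \o (fun w => g (t `^ nu * M w))).
    apply: (@bounded_integrable _ C).
      by apply: (measurableT_comp mg); exact: measurable_funM.
    by move=> w; rewrite ger0_norm.
  rewrite EFinM /Rintegral [X in _ = (_ * X)%E]fineK; last exact: (integrable_fin_num _ ig).
  rewrite -integralZl//; apply: eq_integral => w _; rewrite div//.
set J := (\int[mu]_(tau in _) _)%E => JE.
have JE' : J = (\int[mu]_(tau in `]0%R, t[) (kernel t tau *
    \int[P]_w (M w * g (tau `^ nu * M w)))%:E)%E.
  apply: eq_integral => tau /set_mem/=; rewrite in_itv/= => /andP[tau0 _].
  rewrite EFinM -hE -ge0_integralZl//; last 3 first.
  - by apply/measurable_EFinP; exact: mMg1.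
  - by move=> w _; rewrite lee_fin mulr_ge0.
  - by rewrite lee_fin.
  by apply: eq_integral => w _; rewrite div// -EFinM /kernel !mulrA.
split; last by rewrite /Rintegral -JE' JE.
apply/integrableP; split.
  apply: measurable_funTS; under eq_fun do rewrite EFinM -hE.
  by apply: emeasurable_funM => //; apply/measurable_EFinP; exact: measurable_kernel.
rewrite [X in (X < _)%E](_ : _ = J); first by rewrite JE ltry.
rewrite JE'; apply: eq_integral => tau _ /=.
rewrite ger0_norm// mulr_ge0// Rintegral_ge0// => w _.
by rewrite mulr_ge0.
Qed.

End bounded_weight.

Context (phi r : R -> R) (K : R).
Hypotheses (cphi : continuous phi) (phi1 : forall s, `|phi s| <= 1).
Hypotheses (mr : measurable_fun setT r) (rK : forall s, `|r s| <= K).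
Hypothesis phi_r : forall s : R, 0 < s -> is_derive s 1 phi (r s).

Let Phi s := \int[P]_w phi (s * M w).

Let int_phi s : P.-integrable setT (EFin \o (fun w => phi (s * M w))).
Proof.
apply: (@bounded_integrable _ 1) => //.
by apply: (measurableT_comp (continuous_measurable_fun cphi)); exact: measurable_funM.
Qed.

Let Phi_continuous : continuous Phi.
Proof.
move=> s0; pose s : R := s0; have sI : s \in (`]s - 1, s + 1[%classic : set R).
  by apply/mem_set; rewrite /= in_itv/= ltrBlDr ltrDl ltr01.
apply: (@continuity_under_integral R _ _ P (fun s w => phi (s * M w)) setT
  measurableT (s - 1) (s + 1) _ _ (cst 1)) => //.
- apply: aeW => w _ x _; apply: continuous_comp; last exact: cphi.
  by apply: continuousM; [exact: cvg_id|exact: cvg_cst].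
- by apply: (@bounded_integrable _ 1) => // w; rewrite normr1.
- by move=> x _; exact: aeW.
Qed.

Let phi_scale_derive (s : R) w : 0 < s ->
  is_derive s 1 (fun s => phi (s * M w)) (M w * r (s * M w)).
Proof.
(* [phi] is differentiable only on the open half-line. Where [M w] vanishes, which is where
   [Y w = 0], the function of [s] is constant. *)
move=> s0; have := M0 w; rewrite le_eqVlt => /orP[/eqP <-|Mw].
  by rewrite mul0r; under eq_fun do rewrite mulr0; exact: is_derive_cst.
have h1 : is_derive s 1 (fun x : R => x * M w) (M w).
  by apply: is_derive_eq; rewrite scaler0 add0r /GRing.scale/= mulr1.
rewrite [X in is_derive _ _ _ X]mulrC.
by have := @is_derive1_comp R phi _ s _ _ (phi_r (mulr_gt0 s0 Mw)) h1.
Qed.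

(** The derivative under the expectation is dominated by K Y^(-nu), which is integrable by
    [stable_neg_moment_lty]. *)
Let Phi_derive (s : R) : 0 < s -> is_derive s 1 Phi (\int[P]_w (M w * r (s * M w))).
Proof.
move=> s0; pose G0 w := K * M w.
have K0 : 0 <= K by exact: le_trans (normr_ge0 _) (rK 0).
have sI : (`]0, (s + 1)[%classic : set R) s by rewrite /= in_itv/= s0 ltrDl ltr01.
have dE (x : R) w : 0 < x -> derive1 (fun s => phi (s * M w)) x = M w * r (x * M w).
  by move=> x0; rewrite derive1E; apply: derive_val; exact: phi_scale_derive.
have i1 x : (`]0, (s + 1)[%classic : set R) x ->
    P.-integrable setT (EFin \o (fun w => phi (x * M w))) by move=> _; exact: int_phi.
have d1 (x : R) (w : T) : (`]0, (s + 1)[%classic : set R) x -> setT w ->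
    derivable (fun s : R => phi (s * M w)) x 1.
  by rewrite /= in_itv/= => /andP[x0 _] _; have [] := phi_scale_derive w x0.
have G00 w : 0 <= G0 w by rewrite mulr_ge0.
have iG : P.-integrable setT (EFin \o G0) by exact: (integrableZl measurableT K intM).
have ub (x : R) (w : T) : (`]0, (s + 1)[%classic : set R) x -> setT w ->
    `|partial1of2 (fun s w => phi (s * M w)) x w| <= G0 w.
  rewrite /= in_itv/= => /andP[x0 _] _; rewrite /partial1of2 dE//.
  by rewrite normrM ger0_norm// mulrC ler_wpM2r.
apply: DeriveDef.
  exact: (derivable_under_integral measurableT sI i1 d1 G00 iG ub).
rewrite -derive1E (differentiation_under_integral measurableT sI i1 d1 G00 iG ub).
by apply: eq_Rintegral => w _; rewrite /partial1of2 dE.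
Qed.

Let F t := Phi (t `^ nu).

Let F_derive (t : R) : 0 < t -> is_derive t 1 F
  (nu * t `^ (nu - 1) * \int[P]_w (M w * r (t `^ nu * M w))).
Proof.
move=> t0.
have h1 := is_derive_powR nu t0.
rewrite [X in is_derive _ _ _ X]mulrC.
by have := @is_derive1_comp R Phi _ t _ _ (Phi_derive (powR_gt0 nu t0)) h1.
Qed.

Let F_within_continuous (t : R) : 0 < t -> {within `[0, t], continuous F}.
Proof.
move=> t0.
have powc (x : R) : 0 < x -> {for x, continuous (fun y : R => y `^ nu)}.
  by move=> x0; exact: (is_derive_continuous (is_derive_powR nu x0)).
have F_continuous (x : R) : 0 < x -> {for x, continuous F}.
  by move=> x0; apply: continuous_comp; [exact: powc|exact: Phi_continuous].
apply/continuous_within_itvP => //; split.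
- move=> x; rewrite in_itv/= => /andP[x0 _].
  by exact: F_continuous.
- rewrite /F powR0 ?gt_eqF//; apply: cvg_comp; first exact: powR_cvg0.
  exact: Phi_continuous.
- apply: cvg_at_left_filter; exact: F_continuous.
Qed.

Lemma subordinated_is_caputo (t : R) : 0 < t ->
  is_caputo nu (fun t => \int[P]_w phi (t `^ nu * Y w `^ (- nu))) t
    (\int[P]_w r (t `^ nu * Y w `^ (- nu))).
Proof.
move=> t0.
have K0 : 0 <= K by exact: le_trans (normr_ge0 _) (rK 0).
(* The signed function [r] becomes a difference of two bounded nonnegative functions, to which
   [integrable_kernel_moment] applies. *)
pose g1 s := r s + K; pose g2 (s : R) := K.
have mg1 : measurable_fun setT g1 by exact: measurable_funD.
have g10 s : 0 <= g1 s.
  by have := rK s; rewrite /g1 ler_norml -lerBlDr sub0r => /andP[].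
have g1K s : g1 s <= K + K.
  by have := rK s; rewrite /g1 lerD2r ler_norml => /andP[].
have mg2 : measurable_fun setT g2 by exact: measurable_cst.
have [i1 I1] := integrable_kernel_moment mg1 g10 g1K t0.
have [i2 I2] := integrable_kernel_moment mg2 (fun=> K0) (fun=> lexx K) t0.
have integrandE tau : tau \in (`]0, t[%classic : set R) ->
    derive1 F tau / (t - tau) `^ nu =
    kernel t tau * \int[P]_w (M w * g1 (tau `^ nu * M w)) -
    kernel t tau * \int[P]_w (M w * g2 (tau `^ nu * M w)).
  move=> /set_mem/=; rewrite in_itv/= => /andP[tau0 _].
  rewrite derive1E; have -> := @derive_val _ _ _ _ _ _ _ (F_derive tau0).
  rewrite -mulrBr -RintegralB//; last 2 first.
    exact: (integrable_moment mg1 g10 g1K).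
    exact: (integrable_moment mg2 (fun=> K0) (fun=> lexx K)).
  rewrite /kernel powRN mulrA -!mulrA; congr (_ * (_ * _)); rewrite mulrC; congr (_ * _).
  by apply: eq_Rintegral => w _; rewrite /g1 /g2 mulrDr addrK.
have integrandEE : {in `]0, t[%classic, (fun tau : R => (derive1 F tau / (t - tau) `^ nu)%:E) =1
    (fun tau => (kernel t tau * \int[P]_w (M w * g1 (tau `^ nu * M w)))%:E -
      (kernel t tau * \int[P]_w (M w * g2 (tau `^ nu * M w)))%:E)%E}.
  by move=> tau htau; rewrite integrandE.
split; first split.
- exact: F_within_continuous.
- by move=> tau; rewrite in_itv/= => /andP[tau0 _]; have [] := F_derive tau0.
- have := integrableB _ i1 i2 => /(_ (measurable_itv _)); apply: eq_integrable => //.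
  by move=> tau htau; exact/esym/integrandEE.
rewrite /caputo; have -> : \int[mu]_(tau in `]0, t[) (derive1 F tau / (t - tau) `^ nu) =
    \int[mu]_(tau in `]0, t[)
      (kernel t tau * \int[P]_w (M w * g1 (tau `^ nu * M w)) -
       kernel t tau * \int[P]_w (M w * g2 (tau `^ nu * M w))).
  by apply: eq_Rintegral => tau htau; exact: integrandE.
rewrite RintegralB// I1 I2 -mulrBr.
have -> : Gamma (1 - nu) = G by [].
rewrite mulKf ?gt_eqF ?fine_gammaE_gt0//.
rewrite -RintegralB//.
- by apply: eq_Rintegral => w _; rewrite /g1 /g2 addrK.
- apply: (@bounded_integrable _ (K + K)).
    by apply: (measurableT_comp mg1); exact: measurable_funM.
  by move=> w; rewrite ger0_norm.
- apply: (@bounded_integrable _ K) => //.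
  by move=> w; rewrite ger0_norm.
Qed.

End subordinated_caputo.

(** * Fractional forward equation *)

(** Needed because the state probabilities are given by an expectation only at nonnegative times. *)
Lemma is_caputo_eq (R : realType) (nu t l : R) (f g : R -> R) :
  (forall s, 0 <= s -> f s = g s) -> is_caputo nu f t l -> is_caputo nu g t l.
Proof.
move=> fg [[cf df If] <-].
have fg' (s : R) : 0 < s -> \forall u \near s, f u = g u.
  by move=> s0; near=> u; apply/fg/ltW; near: u; exact: lt_nbhsr.
have dfg (tau : R) : 0 < tau -> derive1 f tau = derive1 g tau.
  by move=> tau0; rewrite !derive1E; apply: near_eq_derive; exact: fg'.
have memE (tau : R) : tau \in (`]0, t[%classic : set R) -> 0 < tau.
  by move=> /set_mem/=; rewrite in_itv/= => /andP[].
split; first split.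
- apply: subspace_eq_continuous cf => s /set_mem/=; rewrite in_itv/= => /andP[s0 _].
  exact: fg.
- move=> tau htau; have := df tau htau; apply: near_eq_derivable.
  by apply: fg'; move: htau; rewrite in_itv/= => /andP[].
- move: If; apply: eq_integrable => // tau htau.
  by rewrite dfg// memE.
- rewrite /caputo; suff -> : \int[lebesgue_measure]_(tau in `]0, t[)
      (derive1 g tau / (t - tau) `^ nu) =
    \int[lebesgue_measure]_(tau in `]0, t[) (derive1 f tau / (t - tau) `^ nu) by [].
  by apply: eq_Rintegral => tau htau; rewrite dfg// memE.
Unshelve. all: by end_near. Qed.

Definition state_event {R : realType} {T S : Type} (X : R -> T -> S) (t : R) (z : S) : set T :=
  [set w | X t w = z].

Section fractional_markov_chain.
Context (R : realType) d (T : measurableType d) (P : probability T R).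
Context (nu : R) (sigma : R -> T -> R).
Hypotheses (nu0 : 0 < nu) (nu1 : nu < 1).
Hypothesis hs : stable_subordinator P nu sigma.
Context (S : countType) (q : S -> S -> R) (X : R -> T -> S).
Hypotheses (hX : markov_chain P q X) (ind : independent_processes P sigma X).
Context (theta : R).
Hypothesis theta_max : forall x, - generator q x x <= theta.
Context (x0 : S).
Local Notation Y := (sigma 1).
Local Notation L := (inverse_process sigma).
Local Notation Xnu := (time_change X L).

Let mX (t : R) x : 0 <= t -> measurable (X t @^-1` [set x]).
Proof. by have [h _ _] := hX; exact: h. Qed.

Let rX w (t : R) : 0 <= t -> \forall u \near t^'+, X u w = X t w.
Proof. by have [_ h _] := hX; exact: h. Qed.

Let finP (A : set T) : measurable A -> P A \is a fin_num.
Proof. by move=> mA; exact: fin_num_measure. Qed.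

Let two_times (p : R -> S -> S -> R) (s : R) x : transition_function p ->
  (forall n (t : nat -> R) (x : nat -> S),
     0 <= t 0%N -> (forall i, t i < t i.+1) ->
     P (\bigcap_(i in `I_n.+2) (X (t i) @^-1` [set x i])) =
     (P (\bigcap_(i in `I_n.+1) (X (t i) @^-1` [set x i])) *
       (p (t n.+1 - t n) (x n) (x n.+1))%:E)%E) ->
  0 <= s ->
  P (X 0 @^-1` [set x0] `&` X s @^-1` [set x]) =
    (fine (P (X 0 @^-1` [set x0])) * p s x0 x)%:E.
Proof.
move=> tp law; have Pc := finP (mX x0 (lexx 0)); rewrite le_eqVlt => /orP[/eqP <-|s0].
  rewrite (transition0 tp) EFinM fineK//.
  have [<-|x0x] := eqVneq x0 x; first by rewrite setIid mule1.
  rewrite mule0 (_ : _ `&` _ = set0) ?measure0//.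
  by apply/seteqP; split => w //= [-> h]; rewrite h eqxx in x0x.
(* The Markov property asks for a whole strictly increasing sequence of times, though only 0 and [s]
   matter. This is why [s = 0] is treated apart. *)
pose t (i : nat) : R := i%:R * s.
pose y (i : nat) := if i is 0%N then x0 else x.
have ti i : t i < t i.+1.
  by rewrite /t (ltr_pM2r s0) ltr_nat.
have := law 0%N t y; rewrite /t mul0r => /(_ (lexx _) ti).
rewrite mul1r subr0 EFinM fineK// => h.
rewrite (_ : _ `&` _ = \bigcap_(i in `I_2) (X (t i) @^-1` [set y i])); last first.
  apply/seteqP; split => w /=.
    by move=> [h0 h1] [|[|//]] _ /=; rewrite /t ?mul0r ?mul1r.
  move=> hw; split; first by have := hw 0%N isT; rewrite /t /= mul0r.
  by have := hw 1%N isT; rewrite /t /= mul1r.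
rewrite h; congr (P _ * _)%E; apply/seteqP; split => w /=.
  by move=> hw; have := hw 0%N isT; rewrite /t /= mul0r.
by move=> hw [|//] _ /=; rewrite /t mul0r.
Qed.

Let process_event s x : 0 <= s ->
  process_sigma_algebra [set: set S] X (X 0 @^-1` [set x0] `&` X s @^-1` [set x]).
Proof.
move=> s0.
have basic (u : R) z : 0 <= u -> process_sigma_algebra [set: set S] X (X u @^-1` [set z]).
  by move=> u0; apply: sub_sigma_algebra; exists u, [set z].
pose Sg : set (set (g_sigma_algebraType [set A | exists t B,
  [/\ 0 <= t, [set: set S] B & A = X t @^-1` B]])) := measurable.
by rewrite -[X in X _]/Sg; apply: measurableI; exact: basic.
Qed.

Let inverse_event (t a b : R) : 0 <= a -> a < b ->
  process_sigma_algebra measurable sigma [set w | a <= L t w < b].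
Proof.
move=> a0 ab; pose Sg : set (set (g_sigma_algebraType [set A | exists u B,
  [/\ 0 <= u, measurable B & A = sigma u @^-1` B]])) := measurable.
rewrite -[X in X _]/Sg.
have mge (s : R) : 0 < s -> Sg [set w | s <= L t w].
  by move=> s0; exact: (inverse_process_sigma_algebra hs).
have mgea : Sg [set w | a <= L t w].
  move: a0; rewrite le_eqVlt => /orP[/eqP <-|]; last exact: mge.
  rewrite (_ : [set _ | _] = setT); first exact: measurableT.
  by apply/seteqP; split => // w _ /=; exact: inverse_process_ge0.
rewrite (_ : [set _ | _] = [set w | a <= L t w] `\` [set w | b <= L t w]).
  by apply: measurableD => //; apply: mge; exact: le_lt_trans ab.
apply/seteqP; split => w /=.
  by move=> /andP[-> wb]; split => //; apply/negP; rewrite -ltNge.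
by move=> [-> /negP]; rewrite -ltNge.
Qed.

Local Notation state_eq := (state_event Xnu).

Lemma measurable_time_changed_state t z : measurable (state_eq t z).
Proof.
apply: (measurable_time_change mX rX); first exact: (measurable_inverse_process hs).
exact: inverse_process_ge0.
Qed.

(** Since [L 0 = 0] almost surely, conditioning on the initial state of the time-changed process is
    conditioning on that of [X]. *)
Let setI_initial A : measurable A ->
  P (A `&` state_eq 0 x0) = P (X 0 @^-1` [set x0] `&` A).
Proof.
move=> mA; have mB := mX x0 (lexx 0).
have [N [mN PN0 LN]] := inverse_process0 nu0 hs.
have full B : measurable B -> P B = P (B `&` ~` N).
  move=> mB'; rewrite -[in LHS](setIT B) -(setUv N) setIUr measureU//.
  - have h : P (B `&` N) = 0%E.
      exact: (subset_measure0 (measurableI _ _ mB' mN) mN (@subIsetr _ _ _)).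
    by rewrite [X in (X + _)%E]h add0e.
  - exact: measurableI.
  - by apply: measurableI => //; exact: measurableC.
  - by rewrite setIACA setICr setI0.
rewrite full; last exact: measurableI (measurable_time_changed_state _ _).
rewrite [RHS]full; last exact: measurableI.
congr (P _); apply/seteqP; split => w [[h1 h2] Nw]; split => //.
- have L0 : L 0 w = 0 by apply: contrapT => h; apply: Nw; apply: LN.
  by split => //; move: h2; rewrite /state_event /time_change /= L0.
- have L0 : L 0 w = 0 by apply: contrapT => h; apply: Nw; apply: LN.
  by split => //; rewrite /state_event /time_change /= L0.
Qed.

Hypothesis init : P (state_eq 0 x0) != 0%E.

Let initX : P (X 0 @^-1` [set x0]) != 0%E.
Proof. by move: init; rewrite -[state_eq _ _]setTI setI_initial// setIT. Qed.

Lemma fractional_forward_equation (x : S) (F0 : {fset S}) (t : R) : x \in F0 ->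
  (forall z, z \notin F0 -> generator q z x = 0) -> 0 < t ->
  is_caputo nu (fun t => cond_prob P (state_eq t x) (state_eq 0 x0)) t
    (\sum_(z <- F0) generator q z x * cond_prob P (state_eq t z) (state_eq 0 x0)).
Proof.
move=> xF0 col t0; have [_ _ [p [tp hr law]]] := hX.
(* Frozen at its value at 0 for negative times, the transition probability is continuous on all of
   R, as [random_time_law] and [subordinated_is_caputo] demand. *)
pose phi z (s : R) := p (Num.max s 0) x0 z.
have max0 (s : R) : 0 <= Num.max s 0 by rewrite le_max lexx orbT.
have phi01 z s : 0 <= phi z s <= 1.
  by rewrite (transition_ge0 tp)// (transition_le1 tp).
have phi1 z s : `|phi z s| <= 1.
  by have /andP[a b] := phi01 z s; rewrite ger0_norm.
have theta0 : 0 <= theta by exact: (theta_ge0 tp hr theta_max x0).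
have phi_lip z (a b : R) : `|phi z a - phi z b| <= theta * `|a - b|.
  have main (u v : R) : 0 <= u -> u <= v -> `|p u x0 z - p v x0 z| <= theta * (v - u).
    move=> u0 uv; rewrite distrC.
    have := transition_lipschitz tp hr theta_max x0 z u0 (_ : 0 <= v - u).
    by rewrite subr_ge0 => /(_ uv); rewrite [u + _]addrC subrK.
  have maxle : `|Num.max a 0 - Num.max b 0| <= `|a - b|.
    have [a0|a0] := leP a 0; have [b0|b0] := leP b 0.
    - by rewrite subrr normr0.
    - by rewrite sub0r normrN gtr0_norm// ler0_norm; lra.
    - by rewrite subr0 gtr0_norm// ger0_norm; lra.
    - by [].
  apply: le_trans (ler_wpM2l theta0 maxle).
  have [ab|ba] := leP (Num.max a 0) (Num.max b 0).
    by apply: (le_trans (main _ _ (max0 a) ab)); rewrite distrC ger0_norm ?subr_ge0.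
  rewrite distrC; apply: (le_trans (main _ _ (max0 b) (ltW ba))).
  by rewrite ger0_norm ?subr_ge0// ltW.
have cphi z : continuous (phi z).
  move=> a; apply/cvgrPdist_le => e e0.
  have d0 : 0 < e / (theta + 1) by rewrite divr_gt0// ltr_wpDl.
  near=> b; apply: (le_trans (phi_lip z a b)).
  have ab : `|a - b| < e / (theta + 1).
    by near: b; exists (e / (theta + 1)).
  apply: (@le_trans _ _ (theta * (e / (theta + 1)))).
    by rewrite ler_wpM2l// ltW.
  by rewrite mulrA ler_pdivrMr ?ltr_wpDl// mulrC ler_wpM2l ?ltW// ltrDl.
have Pc := finP (mX x0 (lexx 0)).
have stateE (u : R) z : 0 <= u -> cond_prob P (state_eq u z) (state_eq 0 x0) =
    \int[P]_w phi z (u `^ nu * Y w `^ (- nu)).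
  move=> u0.
  have mphi : measurable_fun setT (phi z) by exact: continuous_measurable_fun.
  have -> : \int[P]_w phi z (u `^ nu * Y w `^ (- nu)) = fine (\int[P]_w (phi z (L u w))%:E)%E.
    (* The law of [L u] is known only for [u > 0]. At [u = 0] both arguments of [phi] are almost
       surely 0. *)
    congr fine; move: u0; rewrite le_eqVlt => /orP[/eqP <-|u0].
      under eq_integral do rewrite powR0 ?gt_eqF// mul0r.
      apply: ae_eq_integral => //.
        apply/measurable_EFinP; apply: (measurableT_comp mphi).
        exact: (measurable_inverse_process hs).
      have [N [mN PN0 LN]] := inverse_process0 nu0 hs; exists N; split => // w hw.
      by apply: LN => /= L0; apply: hw => _; rewrite L0.
    by rewrite (integral_inverse_process nu0 hs)// => s; have /andP[] := phi01 z s.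
  rewrite /cond_prob setI_initial; last exact: measurable_time_changed_state.
  rewrite -[state_eq 0 x0]setTI setI_initial// setIT.
  rewrite (@random_time_law R d T P S X (L u) mX rX (measurable_inverse_process hs u)
    (inverse_process_ge0 sigma u) _ z (phi z) (fine (P (X 0 @^-1` [set x0])))).
  - rewrite fineM//=; last first.
      apply: (integrable_fin_num _ (f := EFin \o (fun w => phi z (L u w)))) => //.
      apply: (@finite_integrable_bounded _ _ _ P _ 1) => //.
        by rewrite [X in (X < _)%E](@probability_setT _ _ _ P) ltry.
      exact: (measurableT_comp mphi (measurable_inverse_process hs u)).
    rewrite mulrAC divff ?mul1r//; by rewrite fine_eq0.
  - exact: mX.
  - exact: cphi.
  - exact: phi01.
  - move=> s s0; rewrite (two_times z tp law)// /phi.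
    by have -> : Num.max s 0 = s by exact/max_idPl.
  - move=> a b s a0 ab s0; apply: ind; first exact: inverse_event.
    exact: process_event.
pose r (s : R) := \sum_(z <- F0) phi z s * generator q z x.
have cr : continuous r.
  move=> s; apply: (@cvgr_sum R R S (nbhs s) _ F0 (fun z u => phi z u * generator q z x)) => z.
  by apply: cvgMl; exact: cphi.
have rK s : `|r s| <= \sum_(z <- F0) `|generator q z x|.
  apply: (le_trans (ler_norm_sum _ _ _)); apply: ler_sum => z _.
  by rewrite normrM -[leRHS]mul1r ler_wpM2r.
have phi_r (s : R) : 0 < s -> is_derive s 1 (phi x) (r s).
  move=> s0; have h := forward_derive tp hr theta_max x0 xF0 col s0.
  have -> : r s = \sum_(z <- F0) p s x0 z * generator q z x.
    by apply: eq_bigr => z _; rewrite /phi; have -> : Num.max s 0 = s by exact/max_idPl/ltW.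
  apply: near_eq_is_derive h; near=> u.
  by rewrite /phi; congr p; apply/esym/max_idPl/ltW; near: u; exact: lt_nbhsr.
have rE : \int[P]_w r (t `^ nu * Y w `^ (- nu)) =
    \sum_(z <- F0) generator q z x * cond_prob P (state_eq t z) (state_eq 0 x0).
  have mYt : measurable_fun setT (fun w => t `^ nu * Y w `^ (- nu)).
    apply: measurable_funM => //; apply: (measurableT_comp (measurable_powR _)).
    exact: (sigma_measurable hs).
  have iphi z : P.-integrable setT (EFin \o (fun w => phi z (t `^ nu * Y w `^ (- nu)))).
    apply: (@finite_integrable_bounded _ _ _ P _ 1) => //.
      by rewrite [X in (X < _)%E](@probability_setT _ _ _ P) ltry.
    by apply: (measurableT_comp (continuous_measurable_fun (cphi z))).
  have iphig z : P.-integrable setT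
      (EFin \o (fun w => phi z (t `^ nu * Y w `^ (- nu)) * generator q z x)).
    by exact: (integrableZr measurableT (generator q z x) (iphi z)).
  have isum (s : seq S) : P.-integrable setT
      (EFin \o (fun w => \sum_(z <- s) phi z (t `^ nu * Y w `^ (- nu)) * generator q z x)).
    rewrite /comp; under eq_fun do rewrite -sumEFin.
    by apply: integrable_sum => // z _; exact: iphig.
  rewrite /r; elim: (enum_fset F0) => [|z s IH].
    by under eq_Rintegral do rewrite big_nil; rewrite big_nil Rintegral_cst// mul0r.
  under eq_Rintegral do rewrite big_cons.
  rewrite big_cons -IH RintegralD// RintegralZr// stateE ?ltW//.
  by rewrite mulrC.
rewrite -rE.
have := @subordinated_is_caputo R nu nu0 nu1 d T P Y (sigma_measurable hs ler01)
  (fun w => sigma_ge0 hs w ler01) (sigma1_laplace hs) (phi x) r _ (cphi x) (phi1 x)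
  (continuous_measurable_fun cr) rK phi_r t t0.
by apply: is_caputo_eq => s s0; rewrite stateE.
Unshelve. all: by end_near. Qed.

End fractional_markov_chain.

(** * The Erlang queue *)

Lemma esum_single (R : realType) (S : choiceType) (D : set S) (u : S) (c : R) :
  0 <= c -> D u -> \esum_(z in D) (if z == u then c else 0)%:E = c%:E.
Proof.
move=> c0 Du; rewrite (esumID [set u]); last by move=> z _; rewrite lee_fin; case: ifP.
rewrite (_ : D `&` [set u] = [set u]); last by apply/setIidPr => z /= ->.
rewrite esum_set1 ?eqxx ?lee_fin// [X in (_ + X)%E]esum1 ?adde0// => z [_ /= zu].
by case: eqP.
Qed.

Section erlang_generator.
Context (R : realType) (lambda mu : R) (k : nat).

Definition erlang_up (v : nat * nat) : nat * nat :=
  (v.1.+1, if v.1 == 0%N then k else v.2).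

(** The state after completion of a phase. Its value at (0, 0) is meaningless, whence the guards in
    [erlang_gen]. *)
Definition erlang_down (v : nat * nat) : nat * nat :=
  if (2 <= v.2)%N then (v.1, v.2.-1) else if (2 <= v.1)%N then (v.1.-1, k) else (0%N, 0%N).

Definition erlang_valid (v : nat * nat) :=
  (v == (0, 0))%N || ((1 <= v.1) && (1 <= v.2 <= k))%N.

(** The generator matrix of the queue, extended to all pairs of naturals so that its entries can be
    computed without validity proofs. *)
Definition erlang_gen (u v : nat * nat) : R :=
  (if v == erlang_up u then lambda else 0) +
  (if (u != (0, 0)%N) && (v == erlang_down u) then k%:R * mu else 0) -
  (if u == v then lambda + (if u != (0, 0)%N then k%:R * mu else 0) else 0).

Lemma erlang_rateE (x y : erlang_state k) : erlang_rate lambda mu x y =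
  (if val y == erlang_up (val x) then lambda else 0) +
  (if (val x != (0, 0)%N) && (val y == erlang_down (val x)) then k%:R * mu else 0).
Proof.
case: x => -[n s] /= h; case: y => -[m r] /= h'.
rewrite /erlang_rate /erlang_up /erlang_down /=.
move: h h'; rewrite !xpair_eqE /=.
case: n => [|[|n]]; case: s => [|[|s]] //= h h'; rewrite ?xpair_eqE /= ?andbF ?addr0 ?add0r//.
all: do ?case: ifP; rewrite ?addr0 ?add0r//; move=> *; exfalso; lia.
Qed.

Lemma erlang_up_neq v : erlang_up v != v.
Proof. by case: v => n s; rewrite xpair_eqE /=; lia. Qed.

Lemma erlang_down_neq v : v != (0, 0)%N -> erlang_down v != v.
Proof.
case: v => n s; rewrite /erlang_down !xpair_eqE /=.
by case: ifP => ?; [|case: ifP => ?]; rewrite ?xpair_eqE /=; lia.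
Qed.

Lemma erlang_up_neq_down v : erlang_up v != erlang_down v.
Proof.
by case: v => n s; rewrite /erlang_up /erlang_down /=; do ?case: ifP => ?;
  rewrite ?xpair_eqE /=; lia.
Qed.

Lemma erlang_gen_up u v : erlang_up u = v -> erlang_gen u v = lambda.
Proof.
move=> <-; rewrite /erlang_gen eqxx (negbTE (erlang_up_neq_down u)) andbF eq_sym.
by rewrite (negbTE (erlang_up_neq u)) addr0 subr0.
Qed.

Lemma erlang_gen_down u v : u != (0, 0)%N -> erlang_down u = v ->
  erlang_gen u v = k%:R * mu.
Proof.
move=> u0 <-; rewrite /erlang_gen u0 eqxx eq_sym (negbTE (erlang_up_neq_down u)) eq_sym.
by rewrite (negbTE (erlang_down_neq u0)) add0r subr0.
Qed.

Lemma erlang_gen_diag u : u != (0, 0)%N -> erlang_gen u u = - (lambda + k%:R * mu).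
Proof.
move=> u0; rewrite /erlang_gen u0 eqxx [_ == erlang_up _]eq_sym (negbTE (erlang_up_neq u)).
by rewrite [_ == erlang_down _]eq_sym (negbTE (erlang_down_neq u0)) !add0r.
Qed.

Lemma erlang_gen_diag0 : erlang_gen (0, 0)%N (0, 0)%N = - lambda.
Proof. by rewrite /erlang_gen /erlang_up eqxx !xpair_eqE /= !add0r addr0. Qed.

Lemma erlang_gen_eq0 u v : v != erlang_up u -> (u != (0, 0)%N -> v != erlang_down u) ->
  u != v -> erlang_gen u v = 0.
Proof.
move=> /negbTE vu vd /negbTE uv; rewrite /erlang_gen vu uv subr0 add0r.
by case: ifP => // /andP[/vd/negbTE ->].
Qed.

Hypotheses (lambda0 : 0 < lambda) (mu0 : 0 < mu) (k1 : (1 <= k)%N).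

Let kmu0 : 0 <= k%:R * mu. Proof. by rewrite mulr_ge0// ltW. Qed.

Lemma erlang_up_valid v : erlang_valid v -> erlang_valid (erlang_up v).
Proof.
case: v => -[|n] s; rewrite /erlang_valid /erlang_up !xpair_eqE /=; first by rewrite k1 leqnn.
by [].
Qed.

Lemma erlang_down_valid v : erlang_valid v -> erlang_valid (erlang_down v).
Proof.
case: v => n s; rewrite /erlang_valid /erlang_down !xpair_eqE /=.
by case: ifP => ?; [|case: ifP => ?]; rewrite ?xpair_eqE /=; lia.
Qed.

Lemma generator_erlang (x y : erlang_state k) :
  generator (erlang_rate lambda mu) x y = erlang_gen (val x) (val y).
Proof.
rewrite /generator /erlang_gen -val_eqE; case: eqP => [/val_inj <-|_]; last first.
  by rewrite erlang_rateE subr0.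
have vx := valP x; rewrite eq_sym (negbTE (erlang_up_neq (val x))) add0r.
have -> : (val x != (0, 0)%N) && (val x == erlang_down (val x)) = false.
  by case: eqP => [//|/eqP h] /=; rewrite eq_sym; apply/negbTE/erlang_down_neq.
rewrite add0r; congr (- _).
pose u : erlang_state k := Sub (erlang_up (val x)) (erlang_up_valid vx).
pose v : erlang_state k := Sub (erlang_down (val x)) (erlang_down_valid vx).
have -> : (\esum_(z in [set z | z != x]) (erlang_rate lambda mu x z)%:E =
   \esum_(z in [set z | z != x]) ((if z == u then lambda else 0)%:E +
     (if z == v then if val x != (0, 0)%N then k%:R * mu else 0 else 0)%:E))%E.
  apply: eq_esum => z _; rewrite erlang_rateE EFinD -!val_eqE !SubK.
  by congr (_ + _%:E)%E; case: (val x != _); case: ifP.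
rewrite esumD; last 2 first.
  by move=> z _; rewrite lee_fin; case: ifP => // _; exact: ltW.
  by move=> z _; rewrite lee_fin; case: ifP => // _; case: ifP.
rewrite esum_single ?(ltW lambda0)//; last by rewrite /= -val_eqE SubK erlang_up_neq.
case: ifP => h; last by rewrite esum1 ?adde0 ?addr0//= => z _; case: ifP.
by rewrite esum_single//= -val_eqE SubK erlang_down_neq.
Qed.

Lemma erlang_generator_diag (x : erlang_state k) :
  - generator (erlang_rate lambda mu) x x <= lambda + k%:R * mu.
Proof.
rewrite generator_erlang /erlang_gen eqxx opprB.
have h1 : 0 <= if val x == erlang_up (val x) then lambda else 0 by case: ifP => // _; exact: ltW.
have h2 : 0 <= if (val x != (0, 0)%N) && (val x == erlang_down (val x)) then k%:R * mu else 0.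
  by case: ifP.
have h3 : (if val x != (0, 0)%N then k%:R * mu else 0) <= k%:R * mu by case: ifP.
by rewrite -[leRHS]subr0 lerB ?addr_ge0 ?lerD2l.
Qed.

Lemma sum_erlang_states (f : nat * nat -> R) (l : seq (nat * nat)) :
  uniq l -> all erlang_valid l ->
  \sum_(z <- [fset z in (pmap insub l : seq (erlang_state k))]%fset) f (val z) =
  \sum_(u <- l) f u.
Proof.
move=> ul vl; set s := (pmap insub l : seq (erlang_state k)).
have us : uniq s by exact: pmap_sub_uniq.
rewrite (perm_big s)/=; last first.
  by apply: uniq_perm => //; [exact: fset_uniq|move=> z; rewrite !inE].
rewrite -(big_map val xpredT) /s pmap_filter; last exact: insubK.
rewrite (_ : seq.filter _ l = l)//; apply/all_filterP; apply: sub_all vl => v vv.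
by rewrite insubT.
Qed.

End erlang_generator.

(** * State probabilities of the fractional queue *)

Section fractional_erlang.
Context (R : realType) d (T : measurableType d) (P : probability T R).
Context (lambda mu nu : R) (k : nat) (Q : R -> T -> erlang_state k) (sigma : R -> T -> R).
Hypotheses (lambda0 : 0 < lambda) (mu0 : 0 < mu) (k1 : (1 <= k)%N).
Hypotheses (nu0 : 0 < nu) (nu1 : nu < 1).
Hypothesis hQ : markov_chain P (erlang_rate lambda mu) Q.
Hypothesis hs : stable_subordinator P nu sigma.
Hypothesis hind : independent_processes P sigma Q.
Local Notation Qnu := (time_change Q (inverse_process sigma)).
Hypothesis hinit : P (in_state Qnu 0 0 0) != 0%E.
Local Notation gen := (erlang_gen lambda mu k).

Lemma in_stateE (x : erlang_state k) t :
  in_state Qnu (val x).1 (val x).2 t = state_event Qnu t x.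
Proof.
apply/seteqP; split => w; rewrite /in_state /state_event /=.
  by rewrite -surjective_pairing => /val_inj.
by move=> ->; rewrite -surjective_pairing.
Qed.

Let x0 : erlang_state k := Sub (0%N, 0%N) isT.

(** Reduces each equation of the system to arithmetic on pairs: [l] contains the state (n, s) and
    its predecessors, that is, the support of one column of the generator. *)
Lemma erlang_prob_caputo n s (l : seq (nat * nat)) (t a : R) :
  uniq l -> all (erlang_valid k) l -> (n, s) \in l ->
  (forall u, erlang_valid k u -> u \notin l -> gen u (n, s) = 0) ->
  \sum_(u <- l) gen u (n, s) * erlang_prob P Qnu u.1 u.2 t = a -> 0 < t ->
  is_caputo nu (erlang_prob P Qnu n s) t a.
Proof.
move=> ul vl nsl col <- t0.
have vns : erlang_valid k (n, s) by exact: (allP vl).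
pose x : erlang_state k := Sub (n, s) vns.
pose F0 := [fset z in (pmap insub l : seq (erlang_state k))]%fset.
have memF0 z : (z \in F0) = (val z \in l).
  by rewrite !inE/= mem_pmap_sub.
have probE z : erlang_prob P Qnu (val z).1 (val z).2 =
    fun t => cond_prob P (state_event Qnu t z) (state_event Qnu 0 x0).
  by apply/funext => u; rewrite /erlang_prob -(in_stateE x0) -in_stateE.
have hinit' : P (state_event Qnu 0 x0) != 0%E by rewrite -in_stateE.
have xF0 : x \in F0 by rewrite memF0.
have col' z : z \notin F0 -> generator (erlang_rate lambda mu) z x = 0.
  by rewrite memF0 => zl; rewrite generator_erlang//; apply: col => //; exact: valP.
have := fractional_forward_equation nu0 nu1 hs hQ hind
  (erlang_generator_diag lambda0 mu0 k1) hinit' xF0 col' t0.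
rewrite -(probE x).
rewrite -(@sum_erlang_states R k (fun u => gen u (n, s) * erlang_prob P Qnu u.1 u.2 t))//.
rewrite (_ : \sum_(z <- F0) generator _ z x * _ =
  \sum_(z <- F0) gen (val z) (n, s) * erlang_prob P Qnu (val z).1 (val z).2 t)//.
by apply: eq_bigr => z _; rewrite generator_erlang// probE.
Qed.

Lemma erlang_prob_initial n s : (1 <= n)%N -> erlang_prob P Qnu n s 0 = 0.
Proof.
move=> n1; rewrite /erlang_prob /cond_prob (_ : _ `&` _ = set0) ?measure0 ?mul0r//.
apply/seteqP; split => w // [h1 h2]; move: h1; rewrite /in_state/= in h2 *.
by rewrite h2 => -[n0 _]; rewrite -n0 in n1.
Qed.

Lemma erlang_prob00_initial : erlang_prob P Qnu 0 0 0 = 1.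
Proof.
rewrite /erlang_prob /cond_prob setIid divff// fine_eq0// fin_num_measure//.
rewrite (in_stateE x0); exact: (measurable_time_changed_state hs hQ).
Qed.

End fractional_erlang.

Ltac erlang_lia :=
  rewrite /erlang_valid /erlang_up /erlang_down /= ?inE ?xpair_eqE /=;
  do ?case: ifP => ?; rewrite ?xpair_eqE /=; lia.

Theorem theorem3p1 (R : realType) (d : measure_display) (T : measurableType d)
    (P : probability T R) (lambda mu nu : R) (k : nat)
    (Q : R -> T -> erlang_state k) (sigma : R -> T -> R)
    (hlambda : 0 < lambda) (hmu : 0 < mu) (hk : (1 <= k)%N)
    (hnu0 : 0 < nu) (hnu1 : nu < 1)
    (hQ : markov_chain P (erlang_rate lambda mu) Q)
    (hsigma : stable_subordinator P nu sigma)
    (hind : independent_processes P sigma Q)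
    (Qnu : R -> T -> erlang_state k)
    (hQnu : Qnu = time_change Q (inverse_process sigma))
    (hinit : P (in_state Qnu 0 0 0) != 0%E)
    (p : nat -> nat -> R -> R) (hp : p = erlang_prob P Qnu)
    (p0 : R -> R) (hp0 : p0 = p 0%N 0%N) :
  (forall t : R, 0 < t ->
    [/\ is_caputo nu p0 t (- lambda * p0 t + k%:R * mu * p 1%N 1%N t),
        forall s : nat, (1 <= s <= k - 1)%N ->
          is_caputo nu (p 1%N s) t
            (- (lambda + k%:R * mu) * p 1%N s t + k%:R * mu * p 1%N s.+1 t),
        is_caputo nu (p 1%N k) t
          (- (lambda + k%:R * mu) * p 1%N k t + k%:R * mu * p 2%N 1%N t
           + lambda * p0 t),
        forall n s : nat, (2 <= n)%N -> (1 <= s <= k - 1)%N ->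
          is_caputo nu (p n s) t
            (- (lambda + k%:R * mu) * p n s t + k%:R * mu * p n s.+1 t
             + lambda * p n.-1 s t) &
        forall n : nat, (2 <= n)%N ->
          is_caputo nu (p n k) t
            (- (lambda + k%:R * mu) * p n k t + k%:R * mu * p n.+1 1%N t
             + lambda * p n.-1 k t)]) /\
  p0 0 = 1 /\
  (forall n s : nat, (1 <= n)%N -> (1 <= s <= k)%N -> p n s 0 = 0).
Proof.
subst Qnu p p0; split; last first.
  split; first exact: (erlang_prob00_initial hQ hsigma hinit).
  by move=> n s n1 _; exact: erlang_prob_initial.
move=> t t0.
have main n s l a := @erlang_prob_caputo R d T P lambda mu nu k Q sigma hlambda hmu hk
  hnu0 hnu1 hQ hsigma hind hinit n s l t a.
split.
(* In this list and the following ones the state itself comes first, then the states from which a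
   phase completion or an arrival leads to it. *)
- apply: (main 0%N 0%N [:: (0, 0); (1, 1)]%N) => //.
  + by erlang_lia.
  + move=> [a b] va ul; apply: erlang_gen_eq0; move: va ul; erlang_lia.
  + rewrite !big_cons big_nil addr0 erlang_gen_diag0.
    by rewrite (@erlang_gen_down _ _ _ _ (1, 1)%N).
- move=> s hs; apply: (main 1%N s [:: (1, s); (1, s.+1)]%N) => //.
  + by erlang_lia.
  + by erlang_lia.
  + by erlang_lia.
  + move=> [a b] va ul; apply: erlang_gen_eq0; move: va ul; erlang_lia.
  + rewrite !big_cons big_nil addr0 erlang_gen_diag//.
    by rewrite (@erlang_gen_down _ _ _ _ (1, s.+1)%N)// /erlang_down ifT//=; lia.
- apply: (main 1%N k [:: (1, k); (2, 1); (0, 0)]%N) => //.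
  + by erlang_lia.
  + by erlang_lia.
  + move=> [a b] va ul; apply: erlang_gen_eq0; move: va ul; erlang_lia.
  + rewrite !big_cons big_nil addr0 erlang_gen_diag// addrA.
    by rewrite (@erlang_gen_down _ _ _ _ (2, 1)%N)// (@erlang_gen_up _ _ _ _ (0, 0)%N).
- move=> n s n2 hs; apply: (main n s [:: (n, s); (n, s.+1); (n.-1, s)]%N) => //.
  + by erlang_lia.
  + by erlang_lia.
  + by erlang_lia.
  + move=> [a b] va ul; apply: erlang_gen_eq0; move: va ul; erlang_lia.
  + rewrite !big_cons big_nil addr0 erlang_gen_diag; last by erlang_lia.
    rewrite (@erlang_gen_down _ _ _ _ (n, s.+1)%N); last 2 first.
    * by erlang_lia.
    * by rewrite /erlang_down ifT//=; lia.
    rewrite (@erlang_gen_up _ _ _ _ (n.-1, s)%N) ?addrA//.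
    by rewrite /erlang_up /=; case: n n2 => [|[|n]].
- move=> n n2; apply: (main n k [:: (n, k); (n.+1, 1); (n.-1, k)]%N) => //.
  + by erlang_lia.
  + by erlang_lia.
  + by erlang_lia.
  + move=> [a b] va ul; apply: erlang_gen_eq0; move: va ul; erlang_lia.
  + rewrite !big_cons big_nil addr0 erlang_gen_diag; last by erlang_lia.
    rewrite (@erlang_gen_down _ _ _ _ (n.+1, 1)%N); last 2 first.
    * by erlang_lia.
    * by rewrite /erlang_down/=; case: n n2 => [|[|n]].
    rewrite (@erlang_gen_up _ _ _ _ (n.-1, k)%N) ?addrA//.
    by rewrite /erlang_up /=; case: n n2 => [|[|n]].
Qed.
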